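(* Let $1\le p<\infty$, $1/p+1/p'=1$. Let $A_{r-\ell,0}\in(W^n_p)^{m\times m}$ ($\ell=1,\ldots,r$), $f_0\in(W^n_p)^m$, $c_0\in\mathbb{C}^{rm}$, $t_0\in[a,b]$, $\alpha_{s,0}\in\mathbb{C}^{rm\times m}$ ($s=0,\ldots,n+r-1$) and $\Phi_0\in L_{p'}([a,b];\mathbb{C}^{rm\times m})$ be given, and put $$L_0y:=y^{(r)}+\sum_{\ell=1}^rA_{r-\ell,0}\,y^{(r-\ell)},\qquad B_0y:=\sum_{s=0}^{n+r-1}\alpha_{s,0}\,y^{(s)}(t_0)+\int_a^b\Phi_0(t)\,y^{(n+r)}(t)\,dt,\qquad y\in(W^{n+r}_p)^m.$$ Let $\mathcal{P}$ be a dense subset of $[a,b]$. Assume that the homogeneous boundary-value problem $L_0y=0$ on $(a,b)$, $B_0y=0$ has only the trivial solution in $(W^{n+r}_p)^m$, and let $y_0\in(W^{n+r}_p)^m$ be the solution of $L_0y_0=f_0$, $B_0y_0=c_0$. Then there exists a sequence of well-posed multipoint boundary-value problems ($k=1,2,3,\ldots$) $$(L_ky_k)(t):=y_k^{(r)}(t)+\sum_{\ell=1}^rA_{r-\ell,k}(t)\,y_k^{(r-\ell)}(t)=f_k(t),\quad t\in(a,b),$$ $$B_ky_k:=\sum_{s=0}^{n+r-1}\alpha_{s,k}\,y_k^{(s)}(t_0)+\sum_{j=0}^{N(k)}\beta_{j,k}\,y_k^{(n+r-1)}(t_{j,k})=c_k,$$ where all entries of the coefficients $A_{r-\ell,k}$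 and of the right-hand sides $f_k$ are algebraic polynomials, $\alpha_{s,k},\beta_{j,k}\in\mathbb{C}^{rm\times m}$, $c_k\in\mathbb{C}^{rm}$, $t_{j,k}\in\mathcal{P}$, $N(k)\in\mathbb{N}\cup\{0\}$, and $f_k\to f_0$ in $(W^n_p)^m$, $c_k\to c_0$ in $\mathbb{C}^{rm}$ as $k\to\infty$, such that: (i) if $1<p<\infty$, then $$\bigl\|(L_k,B_k)^{-1}-(L_0,B_0)^{-1}\bigr\|\to0\quad\text{as }k\to\infty;$$ (ii) if $p=1$, then $(L_k,B_k)^{-1}\to(L_0,B_0)^{-1}$ in the strong operator topology and $y_k\to y_0$ in $(W^{n+r}_1)^m$ as $k\to\infty$.
   Context: $(a,b)\subset\mathbb{R}$ is a finite interval, $n\in\mathbb{N}\cup\{0\}$, $m,r\in\mathbb{N}=\{1,2,\ldots\}$. $W^{k}_p=W^k_p([a,b];\mathbb{C})$ is the complex Sobolev space with norm $\|y\|_{k,p}=\sum_{s=0}^{k}\|y^{(s)}\|_{L_p}$, and $W^0_p=L_p$. $(W^k_p)^m$ and $(W^k_p)^{m\times m}$ denote the spaces of $\mathbb{C}^m$-valued (column) and $\mathbb{C}^{m\times m}$-valued functions with all entries in $W^k_p$; their norms are the sums of the norms of the entries. For $k\ge0$, $(L_k,B_k)$ denotes the continuous linear operator $y\mapsto(L_ky,B_ky)$ from $(W^{n+r}_p)^m$ to $(W^n_p)^m\times\mathbb{C}^{rm}$. A boundary-value problem is well-posed if this operator is invertible, i.e. the problem has a unique solution in $(W^{n+r}_p)^m$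 for arbitrary right-hand sides in $(W^n_p)^m\times\mathbb{C}^{rm}$. Any such operator (with coefficients in $(W^n_p)^{m\times m}$ and $B_k$ continuous into $\mathbb{C}^{rm}$) is Fredholm of index zero, so it is invertible as soon as the homogeneous problem has only the trivial solution. $y_k$ denotes the unique solution of the $k$-th problem. *)

(* Defs.v *)
From HB Require Import structures.
From mathcomp Require Import all_boot all_order all_algebra.
From mathcomp Require Import complex.
From mathcomp Require Import all_classical all_reals all_analysis.

Set Implicit Arguments.
Unset Strict Implicit.
Unset Printing Implicit Defensive.

Import Order.TTheory GRing.Theory Num.Theory.
Import numFieldNormedType.Exports.

Local Open Scope classical_set_scope.
Local Open Scope ring_scope.
Local Open Scope complex_scope.

(* Functions on [a, b] are total functions on R of which only the values on
   [a, b] matter: every notion below is insensitive to the other values.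
   Elements of L_p are represented by functions, not by classes; equality in
   L_p is equality almost everywhere on [a, b]. *)

Local Notation normc := ComplexField.Normc.normc.

Section Scalar.
Context {R : realType}.
Implicit Types (a b t : R) (f : R -> R[i]).

Definition ae_on a b (P : R -> Prop) : Prop :=
  {ae (@lebesgue_measure R), forall t, t \in `[a, b] -> P t}.

(* The limit is taken along u in [a, b], u != t, so that derivatives at the
   endpoints are one-sided. *)
Definition diff_quotient (g : R -> R) t : R -> R :=
  fun u => (g u - g t) / (u - t).

Definition near_in a b t : set_system R := within `[a, b] t^'.

Definition derivable_in a b f t : Prop :=
  cvg (diff_quotient (fun u => complex.Re (f u)) t @ near_in a b t) /\
  cvg (diff_quotient (fun u => complex.Im (f u)) t @ near_in a b t).

Definition derive_in a b f : R -> R[i] := fun t =>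
  lim (diff_quotient (fun u => complex.Re (f u)) t @ near_in a b t) +i*
  lim (diff_quotient (fun u => complex.Im (f u)) t @ near_in a b t).

Definition derive_in_n a b (s : nat) f : R -> R[i] := iter s (derive_in a b) f.

Definition abs_continuous a b f : Prop :=
  forall eps : R, 0 < eps -> exists2 delta : R, 0 < delta &
    forall (N : nat) (u v : 'I_N -> R),
      (forall i, [/\ a <= u i, u i <= v i & v i <= b]) ->
      trivIset setT (fun i => `]u i, v i[%classic) ->
      \sum_(i < N) (v i - u i) < delta ->
      \sum_(i < N) normc (f (v i) - f (u i)) < eps.

Definition Lp_norm a b (q : \bar R) f : \bar R :=
  Lnorm (@lebesgue_measure R) q (EFin \o ((fun t => normc (f t)) \_ `[a, b])).

(* Measurability is Lebesgue measurability: f agrees almost everywhere with a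
   Borel function. *)
Definition in_Lp a b (q : \bar R) f : Prop :=
  (Lp_norm a b q f < +oo)%E /\
  exists g : R -> R[i],
    [/\ measurable_fun `[a, b] (fun t => complex.Re (g t)),
        measurable_fun `[a, b] (fun t => complex.Im (g t)) &
        ae_on a b (fun t => f t = g t)].

(* W^k_p consists of the f in C^(k-1)([a, b]) with f^(k-1) absolutely
   continuous and f^(k) in L_p. Absolute continuity entails continuity of
   f^(k-1), and the existence of f^(k) almost everywhere. *)
Definition in_sobolev a b (k : nat) (p : R) f : Prop :=
  if k is k'.+1 then
    [/\ forall s t, (s < k')%N -> t \in `[a, b] ->
          derivable_in a b (derive_in_n a b s f) t,
        abs_continuous a b (derive_in_n a b k' f) &
        in_Lp a b p%:E (derive_in_n a b k f)]
  else in_Lp a b p%:E f.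

Definition sobolev_norm a b (k : nat) (p : R) f : \bar R :=
  (\sum_(s < k.+1) Lp_norm a b p%:E (derive_in_n a b s f))%E.

Definition cintegral a b f : R[i] :=
  (\int[@lebesgue_measure R]_(t in `[a, b]) complex.Re (f t)) +i*
  (\int[@lebesgue_measure R]_(t in `[a, b]) complex.Im (f t)).

End Scalar.

Section Matrices.
Context {R : realType}.
Variables (a b : R).

Definition mderive_n (h l : nat) (s : nat) (f : R -> 'M[R[i]]_(h, l)) :
    R -> 'M[R[i]]_(h, l) :=
  fun t => \matrix_(i, j) derive_in_n a b s (fun u => f u i j) t.

Definition mintegral (h l : nat) (f : R -> 'M[R[i]]_(h, l)) : 'M[R[i]]_(h, l) :=
  \matrix_(i, j) cintegral a b (fun t => f t i j).

Definition min_Lp (h l : nat) (q : \bar R) (f : R -> 'M[R[i]]_(h, l)) : Prop :=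
  forall i j, in_Lp a b q (fun t => f t i j).

Definition min_sobolev (h l : nat) (k : nat) (p : R)
    (f : R -> 'M[R[i]]_(h, l)) : Prop :=
  forall i j, in_sobolev a b k p (fun t => f t i j).

Definition msobolev_norm (h l : nat) (k : nat) (p : R)
    (f : R -> 'M[R[i]]_(h, l)) : \bar R :=
  (\sum_(i < h) \sum_(j < l) sobolev_norm a b k p (fun t => f t i j))%E.

Definition mnormc (h l : nat) (M : 'M[R[i]]_(h, l)) : R :=
  \sum_(i < h) \sum_(j < l) normc (M i j).

Definition poly_mx (h l : nat) (P : 'M[{poly R[i]}]_(h, l)) :
    R -> 'M[R[i]]_(h, l) :=
  fun t => map_mx (fun q : {poly R[i]} => q.[t%:C]) P.

End Matrices.

Section BVP.
Context {R : realType}.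
Variables (a b p : R) (n m r : nat).

Local Notation rhs := ((R -> 'cV[R[i]]_m) * 'cV[R[i]]_(r * m))%type.
Local Notation fct := (R -> 'cV[R[i]]_m).

(* The sum over j < r is the sum over l = 1, ..., r with j = r - l. *)
Definition diff_op (A : 'I_r -> R -> 'M[R[i]]_m) (y : fct) : fct :=
  fun t => mderive_n a b r y t + \sum_(j < r) A j t *m mderive_n a b j y t.

Definition boundary_op (t0 : R) (alpha : 'I_(n + r) -> 'M[R[i]]_(r * m, m))
    (Phi : R -> 'M[R[i]]_(r * m, m)) (y : fct) : 'cV[R[i]]_(r * m) :=
  \sum_(s < n + r) alpha s *m mderive_n a b s y t0 +
  mintegral a b (fun t => Phi t *m mderive_n a b (n + r) y t).

Definition multipoint_op (t0 : R) (alpha : 'I_(n + r) -> 'M[R[i]]_(r * m, m))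
    (N : nat) (beta : nat -> 'M[R[i]]_(r * m, m)) (tau : nat -> R) (y : fct) :
    'cV[R[i]]_(r * m) :=
  \sum_(s < n + r) alpha s *m mderive_n a b s y t0 +
  \sum_(j < N.+1) beta j *m mderive_n a b (n + r).-1 y (tau j).

(* L y = f is equality of elements of (W^n_p)^m; for n > 0 both sides are
   continuous, so that it then holds at every point of [a, b]. *)
Definition bvp_solution (L : fct -> fct) (B : fct -> 'cV[R[i]]_(r * m))
    (fc : rhs) (y : fct) : Prop :=
  [/\ min_sobolev a b (n + r) p y, ae_on a b (fun t => L y t = fc.1 t) &
      B y = fc.2].

Definition bvp_well_posed (L : fct -> fct) (B : fct -> 'cV[R[i]]_(r * m)) :
    Prop :=
  forall fc : rhs, min_sobolev a b n p fc.1 ->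
    (exists y, bvp_solution L B fc y) /\
    (forall y z, bvp_solution L B fc y -> bvp_solution L B fc z ->
       forall t, t \in `[a, b] -> y t = z t).

(* The operator (L, B)^-1; meaningful for well-posed problems, where the
   solution is unique up to its values outside [a, b]. *)
Definition bvp_inv (L : fct -> fct) (B : fct -> 'cV[R[i]]_(r * m)) (fc : rhs) :
    fct :=
  xget (fun=> 0) [set y | bvp_solution L B fc y].

Definition rhs_norm (fc : rhs) : \bar R :=
  (msobolev_norm a b n p fc.1 + (mnormc fc.2)%:E)%E.

(* Norm of an operator from (W^n_p)^m x C^(rm) to (W^(n+r)_p)^m. *)
Definition op_norm (T : rhs -> fct) : \bar R :=
  ereal_sup [set msobolev_norm a b (n + r) p (T fc) |
    fc in [set fc : rhs | min_sobolev a b n p fc.1 /\ (rhs_norm fc <= 1)%E]].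

End BVP.

(* Main.v *)
Require Import Defs.
From HB Require Import structures.
From mathcomp Require Import all_boot all_order all_algebra.
From mathcomp Require Import complex.
From mathcomp Require Import all_classical all_reals all_analysis.
Import Order.TTheory GRing.Theory Num.Theory.
Import numFieldNormedType.Exports.
Local Open Scope classical_set_scope.
Local Open Scope ring_scope.
Local Open Scope complex_scope.
From mathcomp Require Import measurable_realfun ring lra.

Set Implicit Arguments.
Unset Strict Implicit.
Unset Printing Implicit Defensive.

Local Notation normc := ComplexField.Normc.normc.

(* On W^n_p the problem L y = f is equivalent to its n-th derivative, a system of
   order n + r with coefficients in L_p, together with the conditions
   (L y)^(s)(a) = f^(s)(a), s < n, which can be treated as further boundary
   conditions. Cauchy data at a make the fundamental solutions finite in number,
   so a problem is well-posed as soon as the matrix of the boundary conditions on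
   a fundamental system is invertible. This gives an estimate
   |y| <= C (|L y| + |B y|) which persists, with a uniform C, for (L_k, B_k) with
   L_k -> L_0 in norm and B_k bounded and strongly convergent to B_0. Applied to
   z = (L_k, B_k)^-1 g - (L_0, B_0)^-1 g, for which L_k z = (L_0 - L_k) (L_0, B_0)^-1 g
   and B_k z = (B_0 - B_k) (L_0, B_0)^-1 g, it yields both modes of convergence.
   Polynomials are dense in W^n_p. A step function in place of Phi_0, with jumps in
   P, integrates y^(n+r) to a combination of values of y^(n+r-1) at points of P;
   step functions are dense in L_p' for p > 1, whereas for p = 1 they only
   approximate Phi_0 boundedly and in L_1, which is why B_k -> B_0 only strongly. *)

(** * Absolutely continuous functions are primitives *)

(** The estimate survives the passage to (L_k, B_k), although B_k need not converge in norm, because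
    B_k - B_0 has to be small only on a finite-dimensional space. Write Y as the solution W of L_0 W
    = 0 with the Cauchy data of Y at a, plus a remainder Z with zero data. Z is controlled by L_0 Y
    alone, so a uniform bound for B_k suffices on it; W lies in the span of finitely many
    fundamental solutions, where strong convergence is convergence of matrices. Norm convergence of
    B_k enters only at the end, where the defect (B_k - B_0) (L_0, B_0)^-1 g must be small uniformly
    over the unit ball of g.

    The estimate holds for large k only; a shift of the index makes every problem of the sequence
    well-posed. Only the integral term of B_0 is approximated: alpha_{s,k} = alpha_{s,0} and c_k =
    c_0 throughout.

    The functions of the statement have derivatives defined as limits and are Borel only up to null
    sets. They are replaced by Borel families linked by integration, and the theorem that absolutely
    continuous functions are primitives gives access to these. *)

Section AbsolutelyContinuous.
Context {R : realType}.
Local Notation mu := (@lebesgue_measure R).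

(** Absolute continuity with an arbitrary finite index type: the argument about total variation
    indexes subintervals by pairs made of an interval and a position in its partition. *)
Definition racont (a b : R) (f : R -> R) : Prop :=
  forall eps, 0 < eps -> exists2 delta : R, 0 < delta &
    forall (T : finType) (u v : T -> R),
      (forall i, [/\ a <= u i, u i <= v i & v i <= b]) ->
      trivIset setT (fun i => `]u i, v i[%classic) ->
      \sum_i (v i - u i) < delta ->
      \sum_i `|f (v i) - f (u i)| < eps.

(** Subdividing each interval of a disjoint family gives a disjoint family of the same total length,
    to which the hypothesis applies. *)
Lemma racont_variation_sum (a b eps delta : R) (f : R -> R) :
  (forall (T : finType) (u v : T -> R),
      (forall i, [/\ a <= u i, u i <= v i & v i <= b]) ->
      trivIset setT (fun i => `]u i, v i[%classic) ->
      \sum_i (v i - u i) < delta ->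
      \sum_i `|f (v i) - f (u i)| < eps) ->
  forall (T : finType) (u v : T -> R) (s : T -> seq R),
      (forall i, [/\ a <= u i, u i <= v i & v i <= b]) ->
      trivIset setT (fun i => `]u i, v i[%classic) ->
      \sum_i (v i - u i) < delta ->
      (forall i, itv_partition (u i) (v i) (s i)) ->
      \sum_i variation (u i) (v i) f (s i) < eps.
Proof.
move=> H T u v s uv tI sd ps.
pose F i n := nth (v i) (u i :: s i) n.
have F0 i : F i 0%N = u i by [].
have Fs i : F i (size (s i)) = v i.
  rewrite /F -[size _]/(size (u i :: s i)).-1 nth_last /=.
  by case: (ps i) => _ /eqP.
have Fm i n m' : (n <= m')%N -> (m' <= size (s i))%N -> F i n <= F i m'.
  move=> nm ms; have [pi _] := ps i.
  have so : sorted <=%O (u i :: s i).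
    by apply: (sub_sorted (e := <%O)); [move=> ? ? /ltW|].
  by apply: (sorted_leq_nth le_trans (fun x => lexx x) (v i) so) => //; rewrite inE /= ltnS ?(leq_trans nm).
pose T' : finType := {i : T & 'I_(size (s i))}.
have := H T' (fun p => F (tag p) (tagged p)) (fun p => F (tag p) (tagged p).+1).
rewrite (_ : \sum_i variation _ _ _ _ =
   \sum_(p : T') `|f (F (tag p) (tagged p).+1) - f (F (tag p) (tagged p))|); last first.
  rewrite -(sig_big_dep xpredT (fun i => xpredT) (fun i (n : 'I_(size (s i))) =>
    `|f (F i n.+1) - f (F i n)|)).
  by apply: eq_bigr => i _; rewrite /variation big_mkord.
apply.
- move=> [i n] /=; have [au uvi vb] := uv i; split.
  + by rewrite (le_trans au)// -F0 Fm// ltnW.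
  + by apply: Fm => //; exact: ltn_ord.
  + by rewrite (le_trans _ vb)// -Fs Fm.
- move=> [i n] [j n'] _ _ [x /= []]; rewrite !in_itv/= => /andP[x1 x2] /andP[x3 x4].
  have ij : i = j.
    apply: (tI i j Logic.I Logic.I); exists x; split; rewrite /= in_itv /=; apply/andP; split.
    + by rewrite (le_lt_trans _ x1)// -F0 Fm// ltnW.
    + by rewrite (lt_le_trans x2)// -Fs Fm.
    + by rewrite (le_lt_trans _ x3)// -F0 Fm// ltnW.
    + by rewrite (lt_le_trans x4)// -Fs Fm.
  subst j; congr existT; apply: val_inj => /=.
  case: (ltngtP n n') => // nn; exfalso.
  + have := Fm i _ _ nn (ltnW (ltn_ord n')) => h.
    by have := lt_trans (le_lt_trans h x3) x2; rewrite ltxx.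
  + have := Fm i _ _ nn (ltnW (ltn_ord n)) => h.
    by have := lt_trans (le_lt_trans h x1) x4; rewrite ltxx.
- rewrite (le_lt_trans _ sd)// le_eqVlt; apply/orP; left; apply/eqP.
  rewrite -(sig_big_dep xpredT (fun i => xpredT) (fun i (n : 'I_(size (s i))) =>
    (F i n.+1 - F i n))).
  apply: eq_bigr => i _; rewrite -(big_mkord xpredT (fun n => F i n.+1 - F i n)).
  by rewrite telescope_sumr// Fs.
Qed.

(** Each total variation is a supremum, so a partition that nearly attains it is chosen on every
    interval; the bound becomes non-strict in the limit. *)
Lemma racont_TV_sum (a b eps delta : R) (f : R -> R) :
  (forall (T : finType) (u v : T -> R),
      (forall i, [/\ a <= u i, u i <= v i & v i <= b]) ->
      trivIset setT (fun i => `]u i, v i[%classic) ->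
      \sum_i (v i - u i) < delta ->
      \sum_i `|f (v i) - f (u i)| < eps) ->
  (forall u v, a <= u -> u <= v -> v <= b -> v - u < delta ->
     (total_variation u v f < +oo)%E) /\
  forall (T : finType) (u v : T -> R),
      (forall i, [/\ a <= u i, u i <= v i & v i <= b]) ->
      trivIset setT (fun i => `]u i, v i[%classic) ->
      \sum_i (v i - u i) < delta ->
      \sum_i fine (total_variation (u i) (v i) f) <= eps.
Proof.
move=> /racont_variation_sum H.
have fin u v : a <= u -> u <= v -> v <= b -> v - u < delta ->
     (total_variation u v f < +oo)%E.
  move=> au uv vb d; rewrite (@le_lt_trans _ _ eps%:E) ?ltry//.
  apply: ge_ereal_sup => _ [_ [s ps <-] <-].
  have := H unit (fun=> u) (fun=> v) (fun=> s).
  rewrite !big_const !card_unit /= !addr0 lee_fin => h.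
  by apply/ltW/h => //; move=> [] [].
split => // T u v uv tI sd; apply/ler_addgt0Pr => e e0.
have vu0 i : 0 <= v i - u i by have [] := uv i; rewrite subr_ge0.
have di i : v i - u i < delta.
  by rewrite (le_lt_trans _ sd)// (bigD1 i)//= lerDl sumr_ge0.
(* The slack [e] is divided among the intervals; the successor keeps [c] positive when [T] is
   empty. *)
pose c : R := #|T|.+1%:R.
have c0 : 0 < c by rewrite ltr0n.
have ex i : {s | itv_partition (u i) (v i) s &
     fine (total_variation (u i) (v i) f) <= variation (u i) (v i) f s + e / c}.
  apply: cid2; have [au uvi vb] := uv i.
  have [->|neq] := eqVneq (u i) (v i).
    exists [::]; first by split.
    by rewrite total_variationxx /= addr_ge0 ?variation_ge0// divr_ge0// ltW.
  have tf : total_variation (u i) (v i) f \is a fin_num.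
    by rewrite ge0_fin_numE ?total_variation_ge0// fin.
  have : (total_variation (u i) (v i) f - (e / c)%:E < total_variation (u i) (v i) f)%E.
    by rewrite lteBlDr// lteDl// lte_fin divr_gt0.
  move=> /ereal_sup_gt[_ [_ [s ps <-] <-]] h; exists s => //.
  by rewrite -lerBlDr ltW// -lte_fin EFinB fineK.
apply: (@le_trans _ _ (\sum_i (variation (u i) (v i) f (s2val (ex i)) + e / c))).
  by apply: ler_sum => i _; exact: (s2valP' (ex i)).
rewrite big_split /= lerD//.
  by apply/ltW/H => // i; exact: (s2valP (ex i)).
rewrite sumr_const -mulr_natr mulrAC ler_pdivrMr// ler_pM2l// ler_nat.
by rewrite leqnSn.
Qed.

(** Intervals shorter than [d] have finite variation; [a, x] is exhausted by steps of length
    [d / 2], and total variation is additive. *)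
Lemma racont_TV_fin (a b : R) (f : R -> R) : racont a b f ->
  forall x, a <= x -> x <= b -> (total_variation a x f < +oo)%E.
Proof.
move=> /(_ 1 ltr01)[d d0 /racont_TV_sum[H _]].
suff K k : forall x, a <= x -> x <= b -> x <= a + k%:R * (d / 2) ->
   (total_variation a x f < +oo)%E.
  move=> x ax xb; apply: (K (Num.bound ((x - a) / (d / 2)))) => //.
  rewrite -lerBlDl -ler_pdivrMr ?divr_gt0//.
  by rewrite ltW// archi_boundP// divr_ge0 ?subr_ge0// ltW// divr_gt0.
elim: k => [|k IH] x ax xb.
  rewrite mul0r addr0 => xa; have -> : x = a by apply/eqP; rewrite eq_le xa.
  by rewrite total_variationxx.
move=> xk; have [xc|cx] := leP x (a + k%:R * (d / 2)); first exact: IH.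
have ac : a <= a + k%:R * (d / 2).
  by rewrite lerDl mulr_ge0// divr_ge0// ltW.
rewrite (total_variationD f ac (ltW cx)) lte_add_pinfty//.
  by apply: IH => //; rewrite (le_trans (ltW cx)).
apply: H => //; first exact: ltW.
rewrite (le_lt_trans (y := d / 2))//; last by rewrite ltr_pdivrMr// ltr_pMr// ltr1n.
rewrite lerBlDl (le_trans xk)// -addrA lerD2l -{3}[d / 2]mul1r -mulrDl.
by rewrite -natr1.
Qed.

(** Jordan decomposition: [f] is the difference of the nondecreasing functions V and V - f, where V
    x is the variation on [a, x]. As V inherits absolute continuity from [f], both are covered by
    the monotone case. *)
Lemma racont_TV (a b : R) (f : R -> R) : racont a b f ->
  [/\ racont a b (fun x => fine (total_variation a x f)),
     {in `[a, b] &, {homo (fun x => fine (total_variation a x f)) : x y / x <= y}} &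
     {in `[a, b] &, {homo (fun x => fine (total_variation a x f) - f x) : x y / x <= y}}].
Proof.
move=> af; have fin := racont_TV_fin af.
pose V x := fine (total_variation a x f).
have VD u v : a <= u -> u <= v -> v <= b -> V v - V u = fine (total_variation u v f).
  move=> au uv vb; have av := le_trans au uv.
  have := fin v av vb; rewrite /V (total_variationD f au uv) => h.
  have fu : total_variation a u f \is a fin_num.
    by rewrite ge0_fin_numE ?total_variation_ge0// fin// (le_trans uv).
  have fuv : total_variation u v f \is a fin_num.
    rewrite ge0_fin_numE ?total_variation_ge0// (le_lt_trans _ h)// leeDr//.
    exact: total_variation_ge0.
  by rewrite fineD// addrC addKr.
have V0 u v : a <= u -> u <= v -> v <= b -> `|f v - f u| <= V v - V u.
  move=> au uv vb; have av := le_trans au uv.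
  rewrite VD//; rewrite -lee_fin fineK ?total_variation_ge//.
  have := fin v av vb; rewrite (total_variationD f au uv) => h.
  rewrite ge0_fin_numE ?total_variation_ge0// (le_lt_trans _ h)// leeDr//.
  exact: total_variation_ge0.
split.
- move=> e e0; have e20 : 0 < e / 2 by rewrite divr_gt0.
  have [d d0 /racont_TV_sum[_ H]] := af _ e20.
  exists d => // T u v uv tI sd; apply: (@le_lt_trans _ _ (e / 2)); last first.
    by rewrite ltr_pdivrMr// ltr_pMr// ltr1n.
  apply: le_trans (H T u v uv tI sd); apply: ler_sum => i _.
  have [au uvi vb] := uv i.
  by rewrite -/(V _) -/(V _) -VD// ger0_norm// (le_trans _ (V0 _ _ _ _ _)).
- move=> x y; rewrite !in_itv/= => /andP[ax xb] /andP[ay yb] xy.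
  by rewrite -subr_ge0 (le_trans _ (V0 _ _ _ _ _)).
- move=> x y; rewrite !in_itv/= => /andP[ax xb] /andP[ay yb] xy.
  have /ler_normlP[] := V0 _ _ ax xy yb; rewrite /V; lra.
Qed.

Lemma racontB (a b : R) (f g : R -> R) : racont a b f -> racont a b g ->
  racont a b (fun x => f x - g x).
Proof.
move=> af ag e e0; have e20 : 0 < e / 2 by rewrite divr_gt0.
have [d d0 H] := af _ e20; have [d' d'0 H'] := ag _ e20.
exists (Num.min d d'); first by rewrite lt_min d0.
move=> T u v uv tI; rewrite lt_min => /andP[/(H T u v uv tI) h /(H' T u v uv tI) h'].
rewrite (splitr e) (le_lt_trans _ (ltrD h h'))// -big_split /=; apply: ler_sum => i _.
rewrite (le_trans _ (ler_normB _ _))// le_eqVlt; apply/orP; left; apply/eqP.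
by congr `| _ |; ring.
Qed.

(** Meant for the components of an open set of finite measure, over which increments of a function
    are summed. The empty set is written as ]0, 0[. *)
Lemma open_itv_bounded (I : set R) : open I -> is_interval I -> (mu I < +oo)%E ->
  exists uv : R * R, uv.1 <= uv.2 /\ I = `]uv.1, uv.2[%classic.
Proof.
move=> oI /is_intervalP; move: (Rhull I) => i Ii.
rewrite {I}Ii in oI *; move: oI => /interior_id.
have oo (u v : R) : exists uv : R * R, uv.1 <= uv.2 /\ `]u, v[%classic = `]uv.1, uv.2[%classic.
  have [uv|vu] := leP u v; first by exists (u, v).
  by exists (0, 0); split => //=; rewrite set_itvoo0 set_itv_ge// bnd_simp -leNgt ltW.
have mu0 : exists uv : R * R, uv.1 <= uv.2 /\ @set0 R = `]uv.1, uv.2[%classic.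
  by exists (0, 0); split => //=; rewrite set_itvoo0.
case: i => -[bu u|[]] [bv v|[]].
- by rewrite interior_itv => <- _; exact: oo.
- by rewrite set_itv_infty_set0.
- by rewrite lebesgue_measure_itv /= ltry.
- by rewrite lebesgue_measure_itv /= ltNyr.
- by rewrite set_itv_infty_set0.
- by rewrite lebesgue_measure_itv /=.
- by rewrite set_itv_infty_set0.
- by rewrite set_itv_infty_set0.
- by rewrite set_itv_infty_set0.
Qed.

(** Composition with [clamp a b] extends a function on [a, b] by its end values, so that
    monotonicity and absolute continuity hold on the whole line. *)
Definition clamp (a b x : R) := Num.max a (Num.min b x).

Lemma clamp_homo a b : {homo clamp a b : x y / x <= y}.
Proof. by move=> x y xy; rewrite /clamp le_max2// le_min2. Qed.

Lemma clamp_in a b x : a <= b -> a <= clamp a b x <= b.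
Proof. by move=> ab; rewrite /clamp le_max lexx /= ge_max ab ge_min lexx. Qed.

Lemma clampB a b x y : a <= b -> x <= y -> clamp a b y - clamp a b x <= y - x.
Proof.
move=> ab xy; rewrite /clamp.
case: (ltP b x) => ?; case: (ltP b y) => ?; case: (ltP a b) => ?;
  case: (ltP a x) => ?; case: (ltP a y) => ?; lra.
Qed.

Lemma clamp_id a b x : a <= x -> x <= b -> clamp a b x = x.
Proof. by move=> ax xb; rewrite /clamp (min_idPr xb) (max_idPr ax). Qed.

(** Clamping shrinks an open interval to a part of itself, hence keeps disjoint families
    disjoint. *)
Lemma clamp_oo a b u v x : a <= b -> clamp a b u < x -> x < clamp a b v -> u < x < v.
Proof.
rewrite /clamp; case: (ltP b u) => ?; case: (ltP b v) => ?; case: (ltP a b) => ?;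
  case: (ltP a u) => ?; case: (ltP a v) => ? ? ? ?; apply/andP; lra.
Qed.

(** The Lebesgue-Stieltjes measure of the extended [G] is absolutely continuous with respect to
    Lebesgue measure, and its Radon-Nikodym density is the required [g]. *)
Lemma racont_ndecr_integral (a b : R) (G : R -> R) : a <= b ->
  {in `[a, b] &, {homo G : x y / x <= y}} -> racont a b G ->
  exists2 g : R -> R, mu.-integrable setT (EFin \o g) &
    forall t, a <= t -> t <= b -> G t = G a + \int[mu]_(x in `[a, t]) g x.
Proof.
move=> ab ndG aG; pose G' := G \o clamp a b.
have cI x : clamp a b x \in `[a, b] by rewrite in_itv /= clamp_in.
have ndG' : {homo G' : x y / x <= y}.
  by move=> x y xy; apply: ndG => //; exact: clamp_homo.
have aG' (e : R) : 0 < e -> exists2 delta : R, 0 < delta &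
    forall (T : finType) (u v : T -> R), (forall i, u i <= v i) ->
      trivIset setT (fun i => `]u i, v i[%classic) ->
      \sum_i (v i - u i) < delta -> \sum_i (G' (v i) - G' (u i)) < e.
  move=> e0; have [d d0 H] := aG _ e0; exists d => // T u v uv tI sd.
  have := H T (clamp a b \o u) (clamp a b \o v).
  rewrite [X in _ -> _ -> _ -> X < _](eq_bigr (fun i => G' (v i) - G' (u i))); last first.
    by move=> i _; rewrite ger0_norm// subr_ge0 ndG'.
  apply.
  - by move=> i; have /andP[] := clamp_in (u i) ab; have /andP[] := clamp_in (v i) ab;
      split => //; apply: clamp_homo.
  - move=> i j _ _ [x /= []]; rewrite !in_itv /= => /andP[x1 x2] /andP[x3 x4].
    by apply: (tI i j Logic.I Logic.I); exists x; split; rewrite /= in_itv /=;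
      apply: (@clamp_oo a b).
  - by rewrite (le_lt_trans _ sd)//; apply: ler_sum => i _; apply: clampB.
have rcG' : right_continuous G'.
  move=> x; apply/cvgrPdist_lt => e e0; have [d d0 H] := aG' _ e0.
  near=> y; have xy : x < y by near: y; exact: nbhs_right_gt.
  rewrite distrC ger0_norm ?subr_ge0 ?ndG'// ?ltW//.
  have := H unit (fun=> x) (fun=> y); rewrite !big_const card_unit /= !addr0; apply.
  - by move=> _; exact: ltW.
  - by move=> [] [].
  - by rewrite ltrBlDl; near: y; apply: nbhs_right_lt; rewrite ltrDl.
pose HF := isCumulative.Build R _ R G' ndG' rcG'.
pose F : cumulative R R := HB.pack G' HF.
pose nu0 : {measure set (measurableTypeR R) -> \bar R} := lebesgue_stieltjes_measure F.
have nu0E u v : u <= v -> nu0 `]u, v]%classic = (G' v - G' u)%:E.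
  move=> uv; rewrite (_ : nu0 _ = lebesgue_stieltjes_measure F `]u, v]%classic)//.
  rewrite /lebesgue_stieltjes_measure /measure_extension.
  by rewrite measurable_mu_extE /= ?wlength_itv_bnd//; exact: is_ocitv.
(* Restriction to ]a, b] makes the measure finite, so that the Radon-Nikodym theorem applies. *)
have mD : measurable (`]a, b]%classic : set (measurableTypeR R)) by exact: measurable_itv.
have fD : (nu0 `]a, b]%classic < +oo)%E by rewrite nu0E// ltry.
pose nu : {finite_measure set (measurableTypeR R) -> \bar R} := mfrestr mD fD.
have dom : nu `<< mu.
  move=> N nullN A mA AN; rewrite (_ : nu A = nu0 (A `&` `]a, b]%classic))//.
  have mAD : measurable (A `&` `]a, b]%classic) by exact: measurableI.
  have muAD : mu (A `&` `]a, b]%classic) = 0.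
    by apply: nullN => // x [/AN].
  apply/eqP; rewrite eq_le measure_ge0 andbT; apply/lee_addgt0Pr => e e0.
  (* Outer regularity encloses the null set in an open set of measure below [d]. Absolute continuity
     bounds every finite sum of increments of [G'] over the components of this open set, hence the
     measure of the whole, by [e]. *)
  rewrite add0e; have [d d0 H] := aG' _ e0.
  have [|U [oU DU Ud]] := @lebesgue_regularity_outer R _ d mAD _ d0.
    exact: (eq_ind_r (fun x => (x < +oo)%E) (ltry 0) muAD).
  have mU : measurable U by exact: open_measurable.
  have muU : (mu U < d%:E)%E.
    rewrite (measureDI mu mU mAD) [X in (_ + mu X)%E]setIidr//.
    by rewrite [X in (_ + X)%E](_ : _ = 0%E)// adde0.
  apply: (@le_trans _ _ (nu0 U)); first by rewrite le_measure ?inE.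
  pose I := open_disjoint_itv oU.
  have mI n : measurable (I n).
    by apply: open_measurable; exact: open_disjoint_itv_open.
  have IU n : I n `<=` U.
    by rewrite [in X in _ `<=` X](open_disjoint_itv_bigcup oU); exact: bigcup_sup.
  have /choice[uv uvP] : forall n, exists uv : R * R, uv.1 <= uv.2 /\ I n = `]uv.1, uv.2[%classic.
    move=> n; apply: open_itv_bounded.
    - exact: open_disjoint_itv_open.
    - exact: open_disjoint_itv_is_interval.
    - rewrite (@le_lt_trans _ _ (mu U))//; first by apply: le_measure; [rewrite inE; exact: mI|rewrite inE; exact: mU|exact: IU].
      by rewrite (lt_trans muU)// ltry.
  rewrite [X in nu0 X](open_disjoint_itv_bigcup oU) measure_bigcup//; first last.
  - exact: open_disjoint_itv_trivIset.
  - by move=> n _; exact: mI.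
  apply: lime_le; first by apply: is_cvg_nneseries.
  near=> n; rewrite big_mkord.
  apply: (@le_trans _ _ (\sum_(i < n) (G' (uv i).2 - G' (uv i).1))%:E).
    rewrite -sumEFin big_mkcond/=; apply: lee_sum => i _.
    rewrite mem_set//.
    have [uvi Ii] := uvP i.
    rewrite -nu0E// -/(I i) Ii; apply: (@le_measure _ _ _ nu0); rewrite ?inE; do ?exact: measurable_itv.
    by apply: subset_itvl; rewrite bnd_simp.
  rewrite lee_fin ltW//; apply: H.
  - by move=> i; have [] := uvP i.
  - move=> i j _ _ ij; apply: val_inj => /=.
    apply: (@open_disjoint_itv_trivIset R U oU i j Logic.I Logic.I).
    by have [_ Ii] := uvP i; have [_ Ij] := uvP j; rewrite -/(I i) -/(I j) Ii Ij.
  - rewrite -lte_fin (le_lt_trans _ muU)//.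
    rewrite -sumEFin (_ : \sum_(i < n) _ = \sum_(i < n) mu (I i))%E; last first.
      apply: eq_bigr => i _; have [uvi ->] := uvP i.
      by rewrite lebesgue_measure_itv/= lte_fin; case: ltP => // h;
        rewrite (@le_anti _ _ (uv i).1 (uv i).2) ?uvi// subrr.
    rewrite -measure_bigsetU//; last exact: open_disjoint_itv_trivIset.
    apply: (@le_measure _ _ _ mu); rewrite ?inE; last 1 first.
    + by rewrite -bigcup_mkord => x [k _ /IU].
    + by apply: bigsetU_measurable => i _; exact: mI.
    + exact: mU.
have [f [f0 ffin fint fE]] := radon_nikodym_sigma_finite dom.
exists (fine \o f).
  rewrite (_ : EFin \o _ = f)//; by apply/funext => x /=; rewrite fineK.
move=> t at_ tb.
have : (nu0 `]a, t]%classic = \int[mu]_(x in `]a, t]) f x)%E.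
  rewrite -fE; last exact: measurable_itv.
  rewrite (_ : nu _ = nu0 (`]a, t]%classic `&` `]a, b]%classic))//; congr (nu0 _).
  by rewrite setIidl//; apply: subset_itvl; rewrite bnd_simp.
rewrite nu0E// /G' /= clamp_id// clamp_id// => Ht.
rewrite -(@Rintegral_itv_obnd_cbnd _ a (BRight t) (fine \o f)).
  rewrite /Rintegral (_ : (fun x : R => ((fine \o f) x)%:E) = f) -?Ht /=; first ring.
  by apply/funext => x /=; rewrite fineK.
rewrite (_ : EFin \o _ = f); first exact: integrableS fint.
by apply/funext => x /=; rewrite fineK.
Unshelve. all: by end_near. Qed.

Lemma racont_integral (a b : R) (f : R -> R) : a <= b -> racont a b f ->
  exists2 g : R -> R, mu.-integrable setT (EFin \o g) &
    forall t, a <= t -> t <= b -> f t = f a + \int[mu]_(x in `[a, t]) g x.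
Proof.
move=> ab af; have [aV ndV ndVf] := racont_TV af.
have [g ig gE] := racont_ndecr_integral ab ndV aV.
have [h ih hE] := racont_ndecr_integral ab ndVf (racontB aV af).
exists (g \- h).
  rewrite (_ : EFin \o _ = (EFin \o g) \- (EFin \o h))%E; first exact: integrableB.
  by apply/funext => x.
move=> t at_ tb; have := hE t at_ tb; have := gE t at_ tb.
have ig' : mu.-integrable `[a, t] (EFin \o g) by exact: integrableS ig.
have ih' : mu.-integrable `[a, t] (EFin \o h) by exact: integrableS ih.
rewrite RintegralB//; lra.
Qed.

End AbsolutelyContinuous.

Local Notation RtoC := (real_complex _).

(** * Complex-valued L_p functions *)

Section NonnegativeIntegral.
Context d (T : measurableType d) (R : realType) (mu : {measure set T -> \bar R}).
Import HBNNSimple.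
Local Open Scope ereal_scope.

(* The integral of a nonnegative function is a supremum over simple functions
   below it, so monotonicity up to null sets needs no measurability. *)
Lemma ge0_ae_le_integral (D : set T) (f g : T -> \bar R) :
  (forall x, D x -> 0 <= f x) -> (forall x, D x -> 0 <= g x) ->
  {ae mu, forall x, D x -> f x <= g x} ->
  \int[mu]_(x in D) f x <= \int[mu]_(x in D) g x.
Proof.
move=> f0 g0 [N [mN muN fgN]].
rewrite ge0_integralE// [leRHS]ge0_integralE//.
apply: ge_ereal_sup => _ [h /= hf <-].
have mNC : measurable (~` N) by exact: measurableC.
apply: ereal_sup_ubound; exists (mul_nnsfun h (indic_nnsfun R mNC)) => /=.
  move=> x; rewrite mindicE; have [xN|xN] := pselect (N x).
    rewrite memNset; last by move=> /(_ xN).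
    by rewrite mulr0 erestrict_ge0.
  rewrite mem_set// mulr1; move: (hf x); rewrite /patch; case: ifPn => // xD h1.
  apply: (le_trans h1); have [//|fg] := leP (f x) (g x).
  exfalso; apply: xN; apply: fgN => /= H; move: fg; rewrite ltNge H//.
  exact: set_mem.
have E (k : {nnsfun T >-> R}) : sintegral mu k = \int[mu]_x (k x)%:E.
  by rewrite integral_nnsfun// patch_setT.
rewrite !E; apply: ae_eq_integral => //.
- exact/measurable_EFinP/measurable_funPT.
- exact/measurable_EFinP/measurable_funPT.
- exists N; split => // x /= H; apply: contrapT => xN; apply: H => _.
  by rewrite /= mindicE mem_set// mulr1.
Qed.

Lemma ge0_ae_eq_integral_nomeas (D : set T) (f g : T -> \bar R) :
  (forall x, D x -> 0 <= f x) -> (forall x, D x -> 0 <= g x) ->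
  {ae mu, forall x, D x -> f x = g x} ->
  \int[mu]_(x in D) f x = \int[mu]_(x in D) g x.
Proof.
move=> f0 g0 fg; apply/eqP; rewrite eq_le; apply/andP; split;
  apply: ge0_ae_le_integral => //; apply: filterS fg => x H Dx; by rewrite H.
Qed.

(** Functions of the statement are only almost everywhere equal to Borel functions; this lemma lets
    their integrals be computed from Borel representatives. *)
Lemma ae_eq_integral_nomeas (D : set T) (f g : T -> \bar R) :
  {ae mu, forall x, D x -> f x = g x} ->
  \int[mu]_(x in D) f x = \int[mu]_(x in D) g x.
Proof.
move=> fg; rewrite integralE [RHS]integralE; congr (_ - _);
  apply: ge0_ae_eq_integral_nomeas => //; apply: filterS fg => x H Dx.
- by rewrite unlock H.
- by rewrite unlock H.
Qed.

End NonnegativeIntegral.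

Lemma le_poweR (R : realType) (r : R) (x y : \bar R) :
  (0 <= r) -> (0 <= x)%E -> (x <= y)%E -> (x `^ r <= y `^ r)%E.
Proof.
move=> r0 x0 xy; apply: (gt0_ler_poweR r0) => //.
all: by rewrite in_itv /= ?leey ?andbT// (le_trans x0).
Qed.

Section ComplexNorm.
Context {R : rcfType}.
Implicit Types z w : R[i].

Lemma normc_ge0 z : 0 <= normc z.
Proof. by case: z => x y /=; exact: sqrtr_ge0. Qed.

Lemma normc_le_ReIm z : normc z <= `|complex.Re z| + `|complex.Im z|.
Proof.
case: z => x y /=; rewrite -(@ler_pXn2r _ 2) ?nnegrE ?sqrtr_ge0 ?addr_ge0//.
rewrite sqr_sqrtr ?addr_ge0 ?sqr_ge0// -(real_normK (num_real x)) -(real_normK (num_real y)).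
have := normr_ge0 x; have := normr_ge0 y; nra.
Qed.

Lemma Re_le_normc z : `|complex.Re z| <= normc z.
Proof.
case: z => x y /=; rewrite -sqrtr_sqr ler_wsqrtr// lerDl sqr_ge0//.
Qed.

Lemma Im_le_normc z : `|complex.Im z| <= normc z.
Proof.
case: z => x y /=; rewrite -sqrtr_sqr ler_wsqrtr// lerDr sqr_ge0//.
Qed.

Lemma normc_triangle z w : normc (z + w) <= normc z + normc w.
Proof. exact: le_normcD. Qed.

Lemma normc_opp z : normc (- z) = normc z.
Proof. exact: normcN. Qed.

Lemma normcB z w : normc (z - w) <= normc z + normc w.
Proof. by rewrite -(normc_opp w) normc_triangle. Qed.

Lemma normcBC z w : normc (z - w) = normc (w - z).
Proof. by rewrite -normc_opp opprB. Qed.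

Lemma normc_sum (I : Type) (s : seq I) (P : pred I) (F : I -> R[i]) :
  normc (\sum_(i <- s | P i) F i) <= \sum_(i <- s | P i) normc (F i).
Proof.
elim/big_ind2 : _ => [|x1 x2 y1 y2 h1 h2|//].
  by rewrite ComplexField.Normc.normc0.
by rewrite (le_trans (normc_triangle _ _))// lerD.
Qed.

Lemma normc_real (x : R) : normc (x%:C) = `|x|.
Proof. by rewrite /= expr0n /= addr0 sqrtr_sqr. Qed.

Lemma normcM z w : normc (z * w) = normc z * normc w.
Proof. exact: ComplexField.Normc.normcM. Qed.

Lemma ReD z w : complex.Re (z + w) = complex.Re z + complex.Re w.
Proof. by case: z; case: w. Qed.
Lemma ImD z w : complex.Im (z + w) = complex.Im z + complex.Im w.
Proof. by case: z; case: w. Qed.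
Lemma ReN z : complex.Re (- z) = - complex.Re z.
Proof. by case: z. Qed.
Lemma ImN z : complex.Im (- z) = - complex.Im z.
Proof. by case: z. Qed.
Lemma ReM z w : complex.Re (z * w) = complex.Re z * complex.Re w - complex.Im z * complex.Im w.
Proof. by case: z; case: w. Qed.
Lemma ImM z w : complex.Im (z * w) = complex.Re z * complex.Im w + complex.Im z * complex.Re w.
Proof. by case: z; case: w. Qed.
Lemma complex_eqP z w : complex.Re z = complex.Re w -> complex.Im z = complex.Im w -> z = w.
Proof. by case: z; case: w => ? ? ? ? /= -> ->. Qed.

End ComplexNorm.

Section Lp.
Context {R : realType} (a b : R).
Context (hab : a < b).
Local Notation mu := (@lebesgue_measure R).
Local Notation D := (`[a, b]%classic : set R).
Implicit Types (f g u : R -> R[i]) (q : R).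

Let mD : measurable D. Proof. exact: measurable_itv. Qed.

Definition cmeas f := measurable_fun D (fun t => complex.Re (f t)) /\
  measurable_fun D (fun t => complex.Im (f t)).

Lemma cmeasD f g : cmeas f -> cmeas g -> cmeas (fun t => f t + g t).
Proof.
move=> [mf mf'] [mg mg']; split.
  rewrite (_ : (fun t => _) = fun t => complex.Re (f t) + complex.Re (g t)).
    exact: measurable_funD.
  by apply/funext => t; rewrite ReD.
rewrite (_ : (fun t => _) = fun t => complex.Im (f t) + complex.Im (g t)).
  exact: measurable_funD.
by apply/funext => t; rewrite ImD.
Qed.

Lemma cmeasM f g : cmeas f -> cmeas g -> cmeas (fun t => f t * g t).
Proof.
move=> [mf mf'] [mg mg']; split.
  rewrite (_ : (fun t => _) = fun t => complex.Re (f t) * complex.Re (g t) -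
    complex.Im (f t) * complex.Im (g t)).
    by apply: measurable_funB; exact: measurable_funM.
  by apply/funext => t; rewrite ReM.
rewrite (_ : (fun t => _) = fun t => complex.Re (f t) * complex.Im (g t) +
  complex.Im (f t) * complex.Re (g t)).
  by apply: measurable_funD; exact: measurable_funM.
by apply/funext => t; rewrite ImM.
Qed.

Lemma cmeas_cst (c : R[i]) : cmeas (fun=> c).
Proof. by split; exact: measurable_cst. Qed.

Lemma cmeasZ c f : cmeas f -> cmeas (fun t => c * f t).
Proof. by move=> mf; apply: cmeasM => //; exact: cmeas_cst. Qed.

Lemma cmeasN f : cmeas f -> cmeas (fun t => - f t).
Proof. by move=> mf; under [X in cmeas X]eq_fun do rewrite -mulN1r; exact: cmeasZ. Qed.

Lemma cmeasB f g : cmeas f -> cmeas g -> cmeas (fun t => f t - g t).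
Proof. by move=> mf mg; apply: cmeasD => //; exact: cmeasN. Qed.

Lemma cmeas_sum (I : Type) (s : seq I) (F : I -> R -> R[i]) :
  (forall i, cmeas (F i)) -> cmeas (fun t => \sum_(i <- s) F i t).
Proof.
move=> mF; elim: s => [|i s IH].
  rewrite (_ : (fun t => _) = fun=> 0); first exact: cmeas_cst.
  by apply/funext => t; rewrite big_nil.
rewrite (_ : (fun t => _) = fun t => F i t + \sum_(j <- s) F j t); first exact: cmeasD.
by apply/funext => t; rewrite big_cons.
Qed.

Lemma cmeas_normc f : cmeas f -> measurable_fun D (fun t => normc (f t)).
Proof.
move=> [mf mf'].
rewrite (_ : (fun t => _) = fun t => (complex.Re (f t) ^+ 2 + complex.Im (f t) ^+ 2) `^ 2^-1).
  apply: (measurableT_comp (measurable_powR _)).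
  by apply: measurable_funD; exact: measurable_funX.
apply/funext => t; rewrite powR12_sqrt ?addr_ge0 ?sqr_ge0//.
by case: (f t).
Qed.

Lemma cmeas_eq f g : (forall t, D t -> f t = g t) -> cmeas f -> cmeas g.
Proof.
move=> fg [mf mf']; split.
  by apply: eq_measurable_fun mf => t /set_mem /fg ->.
by apply: eq_measurable_fun mf' => t /set_mem /fg ->.
Qed.

Lemma Lp_normE q f : q != 0 ->
  Lp_norm a b q%:E f = ((\int[mu]_(x in D) ((normc (f x)) `^ q)%:E) `^ q^-1)%E.
Proof.
move=> q0; rewrite /Lp_norm unlock; apply: (congr1 (fun x => x `^ q^-1)%E).
rewrite [RHS]integral_mkcond; apply: eq_integral => x _ /=; rewrite /patch.
case: ifPn => xD /=; first by rewrite ger0_norm ?normc_ge0.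
by rewrite normr0 powR0.
Qed.

Lemma Lp_norm_ge0 (q : \bar R) f : (0 <= Lp_norm a b q f)%E.
Proof. exact: Lnorm_ge0. Qed.

Lemma ae_onS (P Q : R -> Prop) : (forall t, t \in `[a, b] -> P t -> Q t) ->
  ae_on a b P -> ae_on a b Q.
Proof. by rewrite /ae_on => PQ; apply: (@filterS _ _ (ae_filter_ringOfSetsType mu)) => t H tD; apply: PQ => //; exact: H. Qed.

Lemma ae_onI (P Q : R -> Prop) : ae_on a b P -> ae_on a b Q ->
  ae_on a b (fun t => P t /\ Q t).
Proof. by rewrite /ae_on => aP aQ; apply: (@filterS2 _ _ (ae_filter_ringOfSetsType mu)) aP aQ => t H H' tD; split; [exact: H|exact: H']. Qed.

Lemma ae_onT (P : R -> Prop) : (forall t, t \in `[a, b] -> P t) -> ae_on a b P.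
Proof. by move=> H; apply: aeW. Qed.

(** Stated for arbitrary functions, so that a function of the statement can be compared with its
    Borel representative. *)
Lemma Lp_norm_ae_le q f g : 0 < q -> ae_on a b (fun t => normc (f t) <= normc (g t)) ->
  (Lp_norm a b q%:E f <= Lp_norm a b q%:E g)%E.
Proof.
move=> q0 fg; rewrite !(Lp_normE _ (lt0r_neq0 q0)).
apply: le_poweR; first by rewrite invr_ge0 ltW.
  by apply: integral_ge0 => x _; rewrite lee_fin powR_ge0.
apply: ge0_ae_le_integral; try by move=> x _; rewrite lee_fin powR_ge0.
by apply: ae_onS fg => x xD fgx; rewrite lee_fin ge0_ler_powR ?nnegrE ?normc_ge0// (ltW q0).
Qed.

Lemma Lp_norm_ae_eq q f g : 0 < q -> ae_on a b (fun t => f t = g t) ->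
  Lp_norm a b q%:E f = Lp_norm a b q%:E g.
Proof.
move=> q0 fg; apply/eqP; rewrite eq_le; apply/andP; split; apply: Lp_norm_ae_le => //;
  by apply: ae_onS fg => x xD ->.
Qed.

Lemma Lp_normZ q c f : 0 < q -> cmeas f ->
  Lp_norm a b q%:E (fun t => c * f t) = ((normc c)%:E * Lp_norm a b q%:E f)%E.
Proof.
move=> q0 mf; rewrite !(Lp_normE _ (lt0r_neq0 q0)).
under eq_integral do rewrite normcM powRM ?normc_ge0// EFinM.
have mfq : measurable_fun D (fun t => ((normc (f t)) `^ q)%:E).
  apply/measurable_EFinP; apply: (measurableT_comp (measurable_powR _)).
  exact: cmeas_normc.
rewrite ge0_integralZl//; last first.
- by rewrite lee_fin powR_ge0.
- by move=> x _; rewrite lee_fin powR_ge0.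
rewrite poweRM ?lee_fin ?powR_ge0//; last first.
  by apply: integral_ge0 => x _; rewrite lee_fin powR_ge0.
by rewrite poweR_EFin -powRrM mulfV ?gt_eqF// powRr1// normc_ge0.
Qed.

Lemma Lp_normD q f g : 1 <= q -> cmeas f -> cmeas g ->
  (Lp_norm a b q%:E (fun t => f t + g t)%R <= Lp_norm a b q%:E f + Lp_norm a b q%:E g)%E.
Proof.
move=> q1 mf mg.
have q0 : 0 < q by rewrite (lt_le_trans _ q1).
pose hf := (fun t => normc (f t)) \_ D; pose hg := (fun t => normc (g t)) \_ D.
have mhf : measurable_fun setT hf by apply/(measurable_restrictT _ mD); exact: cmeas_normc.
have mhg : measurable_fun setT hg by apply/(measurable_restrictT _ mD); exact: cmeas_normc.
apply: le_trans (minkowski_EFin mu mhf mhg q1).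
rewrite (Lp_normE _ (lt0r_neq0 q0)) integral_mkcond unlock.
apply: le_poweR; first by rewrite invr_ge0 ltW.
  by apply: integral_ge0 => x _; rewrite /patch; case: ifP => // _; rewrite lee_fin powR_ge0.
apply: ge0_ae_le_integral.
- by move=> x _; rewrite /patch; case: ifP => // _; rewrite lee_fin powR_ge0.
- by move=> x _; rewrite poweR_ge0.
apply: aeW => x _ /=; rewrite /hf /hg /patch; case: ifPn => xD /=.
  rewrite lee_fin ge0_ler_powR ?nnegrE ?normc_ge0 ?(ltW q0)//.
  by rewrite ger0_norm ?addr_ge0 ?normc_ge0 ?normc_triangle.
by rewrite lee_fin powR_ge0.
Qed.

(* Borel representatives of L_q; [in_Lp] is equality almost everywhere with one. *)
Definition MLp q f := cmeas f /\ (Lp_norm a b q%:E f < +oo)%E.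

Definition Ln q f : R := fine (Lp_norm a b q%:E f).

Lemma Ln_ge0 q f : 0 <= Ln q f.
Proof. by rewrite fine_ge0// Lp_norm_ge0. Qed.

Lemma LnE q f : (Lp_norm a b q%:E f < +oo)%E -> (Ln q f)%:E = Lp_norm a b q%:E f.
Proof. by move=> fq; rewrite fineK// ge0_fin_numE// Lp_norm_ge0. Qed.

Lemma MLp_ae_le q (M : R) f g : 0 < q -> cmeas f -> MLp q g -> 0 <= M ->
  ae_on a b (fun t => normc (f t) <= M * normc (g t)) ->
  MLp q f /\ Ln q f <= M * Ln q g.
Proof.
move=> q0 mf [mg gq] M0 fg.
have H : (Lp_norm a b q%:E f <= (M * Ln q g)%:E)%E.
  rewrite EFinM LnE//.
  have -> : M = normc (M%:C) by rewrite normc_real ger0_norm.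
  rewrite -Lp_normZ//; apply: Lp_norm_ae_le => //.
  by apply: ae_onS fg => t _; rewrite normcM normc_real ger0_norm.
have fq : (Lp_norm a b q%:E f < +oo)%E by rewrite (le_lt_trans H)// ltry.
by split => //; rewrite -lee_fin LnE.
Qed.

Lemma MLp_le q (M : R) f g : 0 < q -> cmeas f -> MLp q g -> 0 <= M ->
  (forall t, D t -> normc (f t) <= M * normc (g t)) ->
  MLp q f /\ Ln q f <= M * Ln q g.
Proof. by move=> q0 mf gq M0 fg; apply: MLp_ae_le => //; apply: ae_onT. Qed.

Lemma Ln_ae_eq q f g : 0 < q -> ae_on a b (fun t => f t = g t) -> Ln q f = Ln q g.
Proof. by move=> q0 fg; rewrite /Ln (Lp_norm_ae_eq q0 fg). Qed.

Lemma Ln_eq q f g : 0 < q -> (forall t, D t -> f t = g t) -> Ln q f = Ln q g.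
Proof. by move=> q0 fg; apply: Ln_ae_eq => //; exact: ae_onT. Qed.

Lemma MLp_eq q f g : 0 < q -> (forall t, D t -> f t = g t) -> MLp q f -> MLp q g.
Proof.
move=> q0 fg [mf fq]; split; first exact: cmeas_eq mf.
by rewrite -(@Lp_norm_ae_eq q f g)//; exact: ae_onT.
Qed.

Section FixedExponent.
Context (q : R) (q1 : 1 <= q).

Let q0 : 0 < q. Proof. by rewrite (lt_le_trans _ q1). Qed.

Lemma MLpD f g : MLp q f -> MLp q g ->
  MLp q (fun t => f t + g t) /\ Ln q (fun t => f t + g t) <= Ln q f + Ln q g.
Proof.
move=> [mf fq] [mg gq].
have H := Lp_normD q1 mf mg.
have fgq : (Lp_norm a b q%:E (fun t => f t + g t)%R < +oo)%E.
  by rewrite (le_lt_trans H)// lte_add_pinfty.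
by split; [split => //; exact: cmeasD|rewrite -lee_fin EFinD !LnE].
Qed.

Lemma MLpZ c f : MLp q f -> MLp q (fun t => c * f t) /\
  Ln q (fun t => c * f t) = normc c * Ln q f.
Proof.
move=> [mf fq]; have H := Lp_normZ c q0 mf.
have cfq : (Lp_norm a b q%:E (fun t => c * f t)%R < +oo)%E.
  by rewrite H -LnE// -EFinM ltry.
split; first by split => //; exact: cmeasZ.
by apply: EFin_inj; rewrite EFinM !LnE.
Qed.

Lemma MLpN f : MLp q f -> MLp q (fun t => - f t) /\ Ln q (fun t => - f t) = Ln q f.
Proof.
move=> fq; have [h1 h2] := MLpZ (-1) fq.
have E : (fun t => - f t) = (fun t => -1 * f t) by apply/funext => t; rewrite mulN1r.
by rewrite E; split => //; rewrite h2 normc_opp ComplexField.Normc.normc1 mul1r.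
Qed.

Lemma MLpB f g : MLp q f -> MLp q g ->
  MLp q (fun t => f t - g t) /\ Ln q (fun t => f t - g t) <= Ln q f + Ln q g.
Proof. by move=> fq /MLpN[gq <-]; exact: MLpD. Qed.

Lemma MLp_cst c : MLp q (fun=> c).
Proof.
split; first exact: cmeas_cst.
rewrite Lp_normE ?gt_eqF//; apply: poweR_lty.
rewrite integral_cst//= lebesgue_measure_itv /= lte_fin hab -EFinD -EFinM.
exact: ltry.
Qed.

Lemma MLp_bounded (M : R) u : cmeas u -> (forall t, D t -> normc (u t) <= M) ->
  MLp q u /\ Ln q u <= M * Ln q (fun=> 1).
Proof.
move=> mu_ uM; apply: MLp_le => //.
- exact: MLp_cst.
- by rewrite (le_trans (normc_ge0 (u a)))// uM// /= in_itv /= lexx ltW.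
- by move=> t tD; rewrite ComplexField.Normc.normc1 mulr1 uM.
Qed.

Lemma MLpM_bounded (M : R) u f : cmeas u -> (forall t, D t -> normc (u t) <= M) ->
  MLp q f -> MLp q (fun t => u t * f t) /\ Ln q (fun t => u t * f t) <= M * Ln q f.
Proof.
move=> mu_ uM fq; apply: MLp_le => //.
- by apply: cmeasM => //; case: fq.
- by rewrite (le_trans (normc_ge0 (u a)))// uM// /= in_itv /= lexx ltW.
- by move=> t tD; rewrite normcM ler_wpM2r ?normc_ge0 ?uM.
Qed.

Lemma MLp_sum (I : Type) (s : seq I) (F : I -> R -> R[i]) :
  (forall i, MLp q (F i)) ->
  MLp q (fun t => \sum_(i <- s) F i t) /\
  Ln q (fun t => \sum_(i <- s) F i t) <= \sum_(i <- s) Ln q (F i).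
Proof.
move=> Fq; elim: s => [|i s [IH1 IH2]].
  rewrite (_ : (fun t => _) = fun=> 0); last by apply/funext => t; rewrite big_nil.
  split; first exact: MLp_cst.
  rewrite big_nil; have [_] := MLpZ 0 (MLp_cst 0).
  by under eq_fun do rewrite mul0r; rewrite ComplexField.Normc.normc0 mul0r => ->.
rewrite (_ : (fun t => _) = fun t => F i t + \sum_(j <- s) F j t); last first.
  by apply/funext => t; rewrite big_cons.
have [h1 h2] := MLpD (Fq i) IH1; split => //.
by rewrite big_cons (le_trans h2)// lerD2l.
Qed.

End FixedExponent.

Lemma L1P f : MLp 1 f <-> cmeas f /\ mu.-integrable D (fun t => (normc (f t))%:E).
Proof.
have E : Lp_norm a b 1%:E f = (\int[mu]_(x in D) `|(normc (f x))%:E|)%E.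
  rewrite Lp_normE ?oner_eq0// invr1 poweRe1.
    by apply: eq_integral => x _; rewrite powRr1 ?normc_ge0// abse_EFin ger0_norm ?normc_ge0.
  by apply: integral_ge0 => x _; rewrite lee_fin powR_ge0.
rewrite /MLp E; split => [[mf fi]|[mf /integrableP[_ fi]]]; split => //.
by apply/integrableP; split => //; apply/measurable_EFinP; exact: cmeas_normc.
Qed.

Lemma Ln1E f : Ln 1 f = \int[mu]_(x in D) normc (f x).
Proof.
rewrite /Ln Lp_normE ?oner_eq0// invr1 poweRe1.
  by congr fine; apply: eq_integral => x _; rewrite powRr1 ?normc_ge0.
by apply: integral_ge0 => x _; rewrite lee_fin powR_ge0.
Qed.

Lemma L1_Re f : MLp 1 f -> mu.-integrable D (EFin \o (fun t => complex.Re (f t))).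
Proof.
move=> /L1P[[mf _] fi]; apply: le_integrable fi => //; first exact/measurable_EFinP.
by move=> x _; rewrite /= lee_fin [leRHS]ger0_norm ?normc_ge0// Re_le_normc.
Qed.

Lemma L1_Im f : MLp 1 f -> mu.-integrable D (EFin \o (fun t => complex.Im (f t))).
Proof.
move=> /L1P[[_ mf] fi]; apply: le_integrable fi => //; first exact/measurable_EFinP.
by move=> x _; rewrite /= lee_fin [leRHS]ger0_norm ?normc_ge0// Im_le_normc.
Qed.

Lemma MLp_hoelder q q' f g : 0 < q -> 0 < q' -> q^-1 + q'^-1 = 1 ->
  MLp q f -> MLp q' g ->
  MLp 1 (fun t => f t * g t) /\ Ln 1 (fun t => f t * g t) <= Ln q f * Ln q' g.
Proof.
move=> q0 q'0 qq' [mf fq] [mg gq].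
pose hf := (fun t => normc (f t)) \_ D; pose hg := (fun t => normc (g t)) \_ D.
have mhf : measurable_fun setT hf by apply/(measurable_restrictT _ mD); exact: cmeas_normc.
have mhg : measurable_fun setT hg by apply/(measurable_restrictT _ mD); exact: cmeas_normc.
have H := hoelder mu mhf mhg q0 q'0 qq'.
have E : Lnorm mu 1 (EFin \o (hf \* hg)) = Lp_norm a b 1%:E (fun t => f t * g t).
  rewrite /Lp_norm; congr Lnorm; apply/funext => t /=.
  by rewrite /hf /hg /patch; case: ifP => _; rewrite ?normcM// mul0r.
rewrite E in H.
have fgq : (Lp_norm a b 1%:E (fun t => f t * g t)%R < +oo)%E.
  rewrite (le_lt_trans H)// -/(Lp_norm a b q%:E f) -/(Lp_norm a b q'%:E g).
  by rewrite -LnE// -LnE// -EFinM ltry.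
split; first by split => //; exact: cmeasM.
by rewrite -lee_fin EFinM !LnE.
Qed.

(** Hoelder's inequality against the constant 1; the case [q = 1] is separate because its conjugate
    exponent is infinite. *)
Lemma MLp_L1 q : 1 <= q -> exists2 C : R, 0 <= C &
  forall f, MLp q f -> MLp 1 f /\ Ln 1 f <= C * Ln q f.
Proof.
rewrite le_eqVlt => /predU1P[<-|q1].
  by exists 1 => // f fq; rewrite mul1r.
have q0 : 0 < q by rewrite (lt_trans _ q1).
pose q' := (1 - q^-1)^-1.
have q'0 : 0 < q' by rewrite invr_gt0 subr_gt0 invf_lt1.
have q'1 : 1 <= q' by rewrite invf_ge1 ?subr_gt0 ?invf_lt1// lerBlDl lerDr invr_ge0 ltW.
exists (Ln q' (fun=> 1)); first exact: Ln_ge0.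
move=> f fq; have [|h1 h2] := MLp_hoelder q'0 q0 _ (MLp_cst q'1 1) fq.
  by rewrite invrK subrK.
by move: h1 h2; under eq_fun do rewrite mul1r.
Qed.

End Lp.

(** * Derivatives and primitives on an interval *)

Section OneSidedDerivative.
Context {R : realType} (a b : R).
Context (hab : a < b).
Implicit Types (f g : R -> R) (t l : R).

(* [l] is the derivative of [f] at [t] along [near_in a b t]. *)
Definition dq f t l := forall e : R, 0 < e -> exists2 d : R, 0 < d &
  forall u, a <= u <= b -> u != t -> `|u - t| < d -> `|(f u - f t) / (u - t) - l| < e.

(** Properness makes limits along [near_in] unique, so that [derive_in] is determined by [dq]. The
    witness lies to the right of [t], except at [t = b]. *)
Lemma near_in_proper t : a <= t <= b -> ProperFilter (near_in a b t).
Proof.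
move=> /andP[at_ tb]; split; last exact: within_filter.
move=> /= [d /= d0 H].
have [tb'|bt] := ltP t b.
  pose m := Num.min b (t + d / 2).
  have tm : t < m by rewrite lt_min tb' ltrDl divr_gt0.
  apply: (H m) => /=.
  - rewrite ltr0_norm ?subr_lt0// opprB ltrBlDl (le_lt_trans (y := t + d / 2))//.
      by rewrite ge_min lexx orbT.
    by rewrite ltrD2l ltr_pdivrMr// ltr_pMr// ltr1n.
  - by rewrite gt_eqF.
  - by rewrite in_itv /= (le_trans at_ (ltW tm)) ge_min lexx.
have {}tb : t = b by apply/eqP; rewrite eq_le tb.
pose m := Num.max a (t - d / 2).
have tm : m < t by rewrite gt_max tb hab /= ltrBlDr ltrDl divr_gt0.
apply: (H m) => /=.
- rewrite gtr0_norm ?subr_gt0// ltrBlDl -ltrBlDr (lt_le_trans (y := t - d / 2))//.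
    by rewrite ltrD2l ltrN2 ltr_pdivrMr// ltr_pMr// ltr1n.
  by rewrite le_max lexx orbT.
- by rewrite lt_eqF.
- by rewrite in_itv /= le_max lexx /= -tb ltW.
Qed.

Lemma dq_cvg f t l : dq f t l -> diff_quotient f t @ near_in a b t --> l.
Proof.
move=> H; apply/cvgrPdist_lt => e e0; have [d d0 Hd] := H e e0.
exists d => //= u ud ut uab; rewrite distrC; apply: Hd => //.
by rewrite distrC.
Qed.

Lemma cvg_dq f t l : diff_quotient f t @ near_in a b t --> l -> dq f t l.
Proof.
move=> /cvgrPdist_lt H e e0; have [d /= d0 Hd] := H e e0.
exists d => // u uab ut ud; rewrite distrC; apply: (Hd u) => //=.
by rewrite distrC.
Qed.

Lemma dq_lim f t l : a <= t <= b -> dq f t l ->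
  lim (diff_quotient f t @ near_in a b t) = l.
Proof.
move=> tab /dq_cvg H; have PF := near_in_proper tab.
exact: (cvg_lim (@Rhausdorff R) H).
Qed.

Lemma dq_eq f g t l : a <= t <= b -> (forall u, a <= u <= b -> f u = g u) ->
  dq f t l -> dq g t l.
Proof.
move=> tab fg H e e0; have [d d0 Hd] := H e e0; exists d => // u uab ut ud.
by rewrite -!fg//; exact: Hd.
Qed.

Lemma dqB f g t l l' : dq f t l -> dq g t l' -> dq (fun u => f u - g u) t (l - l').
Proof.
move=> H H' e e0; have e20 : 0 < e / 2 by rewrite divr_gt0.
have [d d0 Hd] := H _ e20; have [d' d'0 Hd'] := H' _ e20.
exists (Num.min d d'); first by rewrite lt_min d0.
move=> u uab ut; rewrite lt_min => /andP[/(Hd u uab ut) h /(Hd' u uab ut) h'].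
rewrite (splitr e) (le_lt_trans _ (ltrD h h'))//.
apply: le_trans (ler_normB _ _); rewrite le_eqVlt; apply/orP; left; apply/eqP.
by congr `| _ |; ring.
Qed.

Definition contAt f t := forall e : R, 0 < e -> exists2 d : R, 0 < d &
  forall u, a <= u <= b -> `|u - t| < d -> `|f u - f t| < e.

Lemma dq_cont f t l : dq f t l -> contAt f t.
Proof.
move=> H e e0; have [d d0 Hd] := H 1 ltr01.
have M0 : 0 < `|l| + 1 by rewrite ltr_wpDl.
exists (Num.min d (e / (`|l| + 1))); first by rewrite lt_min d0 divr_gt0.
move=> u uab; rewrite lt_min => /andP[ud ue].
have [->|ut] := eqVneq u t; first by rewrite subrr normr0.
have := Hd u uab ut ud; have ut0 : 0 < `|u - t| by rewrite normr_gt0 subr_eq0.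
move=> h.
have {}h : `|(f u - f t) / (u - t)| < `|l| + 1.
  rewrite -ltrBlDl (le_lt_trans _ h)//.
  by rewrite (le_trans _ (lerB_dist _ _)).
move: h; rewrite normrM normfV ltr_pdivrMr// => h.
by rewrite (lt_trans h)// mulrC -ltr_pdivlMr.
Qed.

Lemma contAt_within f : (forall t, a <= t <= b -> contAt f t) ->
  {within `[a, b], continuous f}.
Proof.
move=> H; apply/continuous_within_itvP => //; split.
- move=> t tab; have tab' : a <= t <= b by move: tab; rewrite in_itv/= => /andP[/ltW -> /ltW].
  apply/cvgrPdist_lt => e e0; have [d d0 Hd] := H t tab' e e0.
  near=> u; rewrite distrC; apply: Hd.
    have /andP[] : a < u < b by near: u; exact: near_in_itvoo.
    by move=> /ltW -> /ltW.
  by near: u; exists d => //= u; rewrite /ball_ distrC.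
- apply/cvgrPdist_lt => e e0; have [|d d0 Hd] := H a _ e e0; first by rewrite lexx ltW.
  near=> u; rewrite distrC; apply: Hd.
    apply/andP; split; first by near: u; exact: nbhs_right_ge.
    by near: u; exact: nbhs_right_le.
  rewrite ger0_norm ?subr_ge0; last by near: u; exact: nbhs_right_ge.
  by rewrite ltrBlDl; near: u; apply: nbhs_right_lt; rewrite ltrDl.
- apply/cvgrPdist_lt => e e0; have [|d d0 Hd] := H b _ e e0; first by rewrite lexx ltW.
  near=> u; rewrite distrC; apply: Hd.
    apply/andP; split; first by near: u; exact: nbhs_left_ge.
    by near: u; exact: nbhs_left_le.
  rewrite distrC ger0_norm ?subr_ge0; last by near: u; exact: nbhs_left_le.
  by rewrite ltrBlDl -ltrBlDr; near: u; apply: nbhs_left_gt; rewrite ltrBlDr ltrDl.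
Unshelve. all: by end_near. Qed.

Lemma dq_is_derive f t l : a < t < b -> dq f t l -> is_derive t 1 f l.
Proof.
move=> /andP[at_ tb] H.
have C : h^-1 *: (f (h *: 1 + t) - f t) @[h --> 0^'] --> l.
  apply/cvgrPdist_lt => e e0; have [d d0 Hd] := H e e0.
  have m0 : 0 < Num.min d (Num.min (t - a) (b - t)).
    by rewrite !lt_min d0 !subr_gt0 at_.
  exists (Num.min d (Num.min (t - a) (b - t))) => //= h; rewrite /= sub0r normrN.
  rewrite !lt_min => /andP[hd /andP[ha hb]] h0.
  have E : h *: 1 + t - t = h by rewrite addrK /GRing.scale/= mulr1.
  have := Hd (h *: 1 + t); rewrite E mulrC distrC; apply => //.
  - move: ha hb => /ltr_normlP[h1 h2] /ltr_normlP[h3 h4].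
    by rewrite /GRing.scale/= mulr1; apply/andP; split; lra.
  - by rewrite -subr_eq0 E.
apply: DeriveDef; first by apply/cvg_ex; exists l.
exact: (cvg_lim (@Rhausdorff R) C).
Qed.

Lemma derivable_dq f t : a < t < b -> derivable f t 1 -> dq f t ('D_1 f t).
Proof.
move=> /andP[at_ tb] /cvg_ex[l fl].
have -> : 'D_1 f t = l.
  by apply: (cvg_lim (@Rhausdorff R)).
move=> e e0; have /cvgrPdist_lt/(_ e e0)[d /= d0 Hd] := fl.
exists d => // u uab ut ud; have := Hd (u - t); rewrite /= sub0r normrN ud subr_eq0 ut.
move=> /(_ isT isT); rewrite distrC mulrC /GRing.scale /= ?mulr1 subrK.
by rewrite mulrC.
Qed.

Lemma dq0_cst f : (forall t, a <= t <= b -> dq f t 0) ->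
  forall t, a <= t <= b -> f t = f a.
Proof.
move=> H t /andP[at_ tb].
have [->//|neq] := eqVneq t a.
have lt_at : a < t by rewrite lt_neqAle eq_sym neq.
have cf := contAt_within (fun t tab => dq_cont (H t tab)).
have cft : {within `[a, t], continuous f}.
  apply: continuous_subspaceW cf; apply: subset_itvl; rewrite bnd_simp//.
have [|c _] := @MVT_segment R f (fun=> 0) a t at_ _ cft.
  move=> x; rewrite in_itv /= => /andP[ax xt].
  have xb : x < b := lt_le_trans xt tb.
  by apply: dq_is_derive; [rewrite ax|apply: H; rewrite !ltW].
by rewrite mul0r => /eqP; rewrite subr_eq0 => /eqP.
Qed.

End OneSidedDerivative.

Section RealPrimitive.
Context {R : realType} (a b : R).
Context (hab : a < b).
Local Notation mu := (@lebesgue_measure R).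
Local Notation D := (`[a, b]%classic : set R).
Implicit Types (h k : R -> R).

Definition rJ h t := \int[mu]_(x in `[a, t]) h x.

Lemma integrable_sub h (A : set R) : measurable A -> A `<=` D ->
  mu.-integrable D (EFin \o h) -> mu.-integrable A (EFin \o h).
Proof. by move=> mA AD; apply: integrableS => //; exact: measurable_itv. Qed.

Lemma sub_at t : t <= b -> `[a, t]%classic `<=` D.
Proof. by move=> tb; apply: subset_itvl; rewrite bnd_simp. Qed.

Lemma sub_st s t : a <= s -> t <= b -> `]s, t]%classic `<=` D.
Proof. by move=> as_ tb; apply: subset_itv; rewrite bnd_simp. Qed.

Lemma rintB h k (A : set R) : measurable A -> mu.-integrable A (EFin \o h) ->
  mu.-integrable A (EFin \o k) -> mu.-integrable A (EFin \o (fun x => h x - k x)).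
Proof.
move=> mA ih ik; rewrite (_ : EFin \o _ = fun x => ((EFin \o h) x - (EFin \o k) x)%E).
  exact: integrableB.
by apply/funext.
Qed.

Lemma rintD h k (A : set R) : measurable A -> mu.-integrable A (EFin \o h) ->
  mu.-integrable A (EFin \o k) -> mu.-integrable A (EFin \o (fun x => h x + k x)).
Proof.
move=> mA ih ik; rewrite (_ : EFin \o _ = fun x => ((EFin \o h) x + (EFin \o k) x)%E).
  exact: integrableD.
by apply/funext.
Qed.

Lemma rintZ h c (A : set R) : measurable A -> mu.-integrable A (EFin \o h) ->
  mu.-integrable A (EFin \o (fun x => c * h x)).
Proof.
move=> mA ih; rewrite (_ : EFin \o _ = fun x => (c%:E * (EFin \o h) x)%E).
  exact: integrableZl.
by apply/funext.
Qed.

Lemma bounded_on (A : set R) h M : (forall x, A x -> `|h x| <= M) -> [bounded h x | x in A].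
Proof.
move=> H; exists M; split; first exact: num_real.
by move=> y My x Ax /=; apply: le_trans (H x Ax) _; exact: ltW.
Qed.

Lemma integrable_cst_itv c x y (s t : R) :
  mu.-integrable [set` Interval (BSide x s) (BSide y t)] (EFin \o (fun=> c)).
Proof.
have fin : (mu [set` Interval (BSide x s) (BSide y t)] < +oo)%E.
  by rewrite lebesgue_measure_itv /=; case: ifP => _; rewrite -?EFinB ltry.
apply/integrableP; split; first exact/measurable_EFinP.
rewrite (_ : integral _ _ _ = `|c|%:E * mu [set` Interval (BSide x s) (BSide y t)])%E.
  by rewrite lte_mul_pinfty.
by rewrite /= integral_cst//; exact: measurable_itv.
Qed.

Lemma integrable_at h t : t <= b ->
  mu.-integrable D (EFin \o h) -> mu.-integrable `[a, t] (EFin \o h).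
Proof. by move=> tb; apply: integrable_sub; [exact: measurable_itv|exact: sub_at]. Qed.

Lemma integrable_st h s t : a <= s -> t <= b ->
  mu.-integrable D (EFin \o h) -> mu.-integrable `]s, t] (EFin \o h).
Proof. by move=> as_ tb; apply: integrable_sub; [exact: measurable_itv|exact: sub_st]. Qed.

Lemma rJB h s t : mu.-integrable D (EFin \o h) -> a <= s -> s <= t -> t <= b ->
  rJ h t - rJ h s = \int[mu]_(x in `]s, t]) h x.
Proof.
move=> ih as_ st tb; rewrite /rJ Rintegral_itvB ?bnd_simp//.
exact: integrable_at.
Qed.

Lemma rJ_a h : rJ h a = 0.
Proof. by rewrite /rJ set_itv1 Rintegral_set1. Qed.

Lemma rJ_eq_ae h k t : t <= b -> ae_on a b (fun x => h x = k x) -> rJ h t = rJ k t.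
Proof.
move=> tb hk; congr fine; apply: ae_eq_integral_nomeas.
apply: (@filterS _ _ (ae_filter_ringOfSetsType mu) _ _ _ hk) => x H xat; rewrite H//.
by apply: sub_at xat.
Qed.

(** The difference quotient is a mean of [h] between the two points, so its distance to [h t] is at
    most the oscillation of [h] there. Each side of [t] is treated separately, which covers the
    endpoints. *)
Lemma rJ_dq_cont h t : mu.-integrable D (EFin \o h) -> a <= t <= b ->
  contAt a b h t -> dq a b (rJ h) t (h t).
Proof.
move=> ih /andP[at_ tb] ch e e0; have e20 : 0 < e / 2 by rewrite divr_gt0.
have e2e : e / 2 < e by rewrite ltr_pdivrMr// ltr_pMr// ltr1n.
have [d d0 Hd] := ch _ e20; exists d => // u /andP[au ub] ut ud.
have key s s' : a <= s -> s < s' -> s' <= b ->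
    (forall x, s <= x <= s' -> `|h x - h t| <= e / 2) ->
    `|(rJ h s' - rJ h s) / (s' - s) - h t| <= e / 2.
  move=> as_ ss sb H; rewrite (rJB ih as_ (ltW ss) sb).
  have ihs := integrable_st as_ sb ih.
  have ic (c : R) : mu.-integrable `]s, s'] (EFin \o (fun=> c)).
    exact: integrable_cst_itv.
  have s0 : 0 < s' - s by rewrite subr_gt0.
  have mus (c : R) : \int[mu]_(x in `]s, s']) c = c * (s' - s).
    rewrite Rintegral_cst; last exact: measurable_itv.
    have := lebesgue_measure_itv (`]s, s'] : interval R).
    by rewrite /= lte_fin ss => ->.
  rewrite -[X in _ - X](mulfK (lt0r_neq0 s0)) -mulrBl -mus -RintegralB//.
  rewrite normrM normfV (gtr0_norm s0) ler_pdivrMr// -mus.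
  apply: (le_trans (le_normr_Rintegral _ _)) => //; first exact: rintB.
  apply: le_Rintegral => //.
    exact/integrable_norm/rintB.
  move=> x; rewrite /= in_itv /= => /andP[sx xs]; apply: H.
  by rewrite xs ltW.
apply: (le_lt_trans _ e2e).
case: (ltgtP t u) ut => // [tu|ut_] _.
  apply: key => // x /andP[tx xu]; apply/ltW/Hd; first by rewrite (le_trans at_)// (le_trans xu).
  by rewrite ger0_norm ?subr_ge0//; move: ud; rewrite ger0_norm ?subr_ge0 ?ltW// => ud; lra.
have -> : (rJ h u - rJ h t) / (u - t) = (rJ h t - rJ h u) / (t - u).
  by rewrite -(opprB t u) -(opprB (rJ h t)) invrN mulrNN.
apply: key => // x /andP[ux xt]; apply/ltW/Hd; first by rewrite (le_trans au)// (le_trans xt).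
move: ud; rewrite distrC gtr0_norm ?subr_gt0// distrC ger0_norm ?subr_ge0// => ud; lra.
Qed.

(** Lebesgue's differentiation theorem, applied to the extension of [h] by zero; the two endpoints
    are discarded as a null set. *)
Lemma rJ_dq_ae h : mu.-integrable D (EFin \o h) ->
  ae_on a b (fun t => dq a b (rJ h) t (h t)).
Proof.
move=> ih; pose h' := h \_ D.
have mD : measurable D by exact: measurable_itv.
have ih' : mu.-integrable setT (EFin \o h').
  by rewrite /h' -restrict_EFin; apply/integrable_restrict => //=; rewrite setTI.
have loc := integrable_locally mD ih.
have iy y : mu.-integrable [set` Interval (BLeft a) (BRight y)] (EFin \o h').
  exact: integrableS ih'.
have FT := FTC1 iy loc.
have neq c : \forall x \ae mu, x <> c.
  exists [set c]; split; first exact: measurable_set1.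
    exact: lebesgue_measure_set1.
  by move=> x /= /contrapT.
have := @filterS3 _ _ (ae_filter_ringOfSetsType mu) _ _ _ _ _ FT (neq a) (neq b).
apply => t FTt ta tb; rewrite in_itv /= => /andP[at_ tb'].
have {}at_ : a < t by rewrite lt_neqAle at_ andbT eq_sym; apply/eqP.
have {}tb : t < b by rewrite lt_neqAle tb' andbT; apply/eqP.
have [|dF FE] := FTt; first by rewrite lte_fin.
have tab : a < t < b by rewrite at_.
have := derivable_dq tab dF; rewrite -derive1E FE.
have -> : h' t = h t by rewrite /h' patchE mem_set//= in_itv /= !ltW.
apply: dq_eq; first by rewrite !ltW.
move=> u /andP[au ub]; apply: eq_Rintegral => x /set_mem /(sub_at ub) xD.
by rewrite /h' patchE mem_set.
Qed.

Lemma integrable_MR h k (A : set R) M : measurable A -> mu.-integrable A (EFin \o h) ->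
  measurable_fun A k -> (forall x, A x -> `|k x| <= M) ->
  mu.-integrable A (EFin \o (fun x => h x * k x)).
Proof.
move=> mA ih mk kM; rewrite (_ : EFin \o _ = (EFin \o h) \* (EFin \o k))%E.
  by apply: integrableMl => //; exact: bounded_on kM.
by apply/funext.
Qed.

End RealPrimitive.

Section Primitive.
Context {R : realType} (a b : R).
Context (hab : a < b).
Local Notation mu := (@lebesgue_measure R).
Local Notation D := (`[a, b]%classic : set R).
Local Notation cmeas := (cmeas a b).
Local Notation MLp := (MLp a b).
Local Notation Ln := (Ln a b).
Implicit Types (f g : R -> R[i]).

Definition J f t := cintegral a t f.

Definition V f t := \int[mu]_(x in `[a, t]) normc (f x).

Lemma JE f t : J f t = rJ a (fun x => complex.Re (f x)) t +i* rJ a (fun x => complex.Im (f x)) t.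
Proof. by []. Qed.

Lemma J_a f : J f a = 0.
Proof. by rewrite JE !rJ_a. Qed.

Lemma L1_normc f : MLp 1 f -> mu.-integrable D (EFin \o (fun x => normc (f x))).
Proof. by move=> /(L1P a b)[]. Qed.

Lemma V_b f : V f b = Ln 1 f.
Proof. by rewrite Ln1E. Qed.

Lemma V_a f : V f a = 0.
Proof. exact: rJ_a. Qed.

Lemma V_homo f s t : MLp 1 f -> a <= s -> s <= t -> t <= b -> V f s <= V f t.
Proof.
move=> f1 as_ st tb; rewrite -subr_ge0 (rJB (L1_normc f1))//.
by apply: Rintegral_ge0 => x _; exact: normc_ge0.
Qed.

Lemma V_le f t : MLp 1 f -> a <= t -> t <= b -> V f t <= Ln 1 f.
Proof. by move=> f1 at_ tb; rewrite -V_b V_homo// ltW. Qed.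

(** The factor 2 is the price of estimating real and imaginary parts separately. *)
Lemma J_normcB f s t : MLp 1 f -> a <= s -> s <= t -> t <= b ->
  normc (J f t - J f s) <= 2 * (V f t - V f s).
Proof.
move=> f1 as_ st tb; apply: (le_trans (normc_le_ReIm _)).
rewrite !JE ReD ImD ReN ImN /= (rJB (L1_Re f1))// (rJB (L1_Im f1))//.
rewrite (rJB (L1_normc f1))// mulr_natl mulr2n.
have mst : measurable (`]s, t]%classic : set R) by exact: measurable_itv.
apply: lerD; apply: (le_trans (le_normr_Rintegral _ _)) => //.
- by apply: (@integrable_st _ a b) => //; exact: L1_Re.
- apply: le_Rintegral => //.
  + by apply: integrable_norm; apply: (@integrable_st _ a b) => //; exact: L1_Re.
  + by apply: (@integrable_st _ a b) => //; exact: L1_normc.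
  + by move=> x _ /=; exact: Re_le_normc.
- by apply: (@integrable_st _ a b) => //; exact: L1_Im.
- apply: le_Rintegral => //.
  + by apply: integrable_norm; apply: (@integrable_st _ a b) => //; exact: L1_Im.
  + by apply: (@integrable_st _ a b) => //; exact: L1_normc.
  + by move=> x _ /=; exact: Im_le_normc.
Qed.

Lemma J_normc f t : MLp 1 f -> a <= t -> t <= b -> normc (J f t) <= 2 * V f t.
Proof. by move=> f1 at_ tb; have := J_normcB f1 (lexx a) at_ tb; rewrite J_a V_a !subr0. Qed.

Lemma J_bound f t : MLp 1 f -> a <= t -> t <= b -> normc (J f t) <= 2 * Ln 1 f.
Proof.
by move=> f1 at_ tb; rewrite (le_trans (J_normc f1 at_ tb))// ler_wpM2l ?V_le.
Qed.

Lemma JD f g t : MLp 1 f -> MLp 1 g -> t <= b -> J (fun x => f x + g x) t = J f t + J g t.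
Proof.
move=> f1 g1 tb; apply: complex_eqP; rewrite /= ?ReD ?ImD /=.
  rewrite -RintegralD//; try exact: measurable_itv; try by apply: (@integrable_at _ a b) => //; exact: L1_Re.
  by apply: eq_Rintegral => x _; rewrite ReD.
rewrite -RintegralD//; try exact: measurable_itv; try by apply: (@integrable_at _ a b) => //; exact: L1_Im.
by apply: eq_Rintegral => x _; rewrite ImD.
Qed.

Lemma JZ c f t : MLp 1 f -> t <= b -> J (fun x => c * f x) t = c * J f t.
Proof.
move=> f1 tb.
have mt : measurable (`[a, t]%classic : set R) by exact: measurable_itv.
have iR : mu.-integrable `[a, t] (EFin \o (fun x => complex.Re (f x))).
  by apply: (@integrable_at _ a b) => //; exact: L1_Re.
have iI : mu.-integrable `[a, t] (EFin \o (fun x => complex.Im (f x))).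
  by apply: (@integrable_at _ a b) => //; exact: L1_Im.
apply: complex_eqP; rewrite /= ?ReM ?ImM /=.
  rewrite -!RintegralZl// -RintegralB//; try exact: rintZ.
  by apply: eq_Rintegral => x _; rewrite ReM.
rewrite -!RintegralZl// -RintegralD//; try exact: rintZ.
by apply: eq_Rintegral => x _; rewrite ImM.
Qed.

Lemma JN f t : MLp 1 f -> t <= b -> J (fun x => - f x) t = - J f t.
Proof.
move=> f1 tb; rewrite -mulN1r -JZ//; congr J.
by apply/funext => x; rewrite mulN1r.
Qed.

Lemma JB f g t : MLp 1 f -> MLp 1 g -> t <= b -> J (fun x => f x - g x) t = J f t - J g t.
Proof. by move=> f1 g1 tb; rewrite JD ?JN//; have [] := MLpN (lexx 1) g1. Qed.

Lemma J_eq_ae f g t : t <= b -> ae_on a b (fun x => f x = g x) -> J f t = J g t.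
Proof.
move=> tb fg; rewrite !JE; congr (_ +i* _); apply: rJ_eq_ae tb _;
  by apply: ae_onS fg => x _ ->.
Qed.

Lemma J_eq f g t : t <= b -> (forall x, a <= x <= b -> f x = g x) -> J f t = J g t.
Proof.
by move=> tb fg; apply: J_eq_ae => //; apply: ae_onT => x; rewrite in_itv; exact: fg.
Qed.

Lemma J0 t : t <= b -> J (fun=> 0) t = 0.
Proof.
move=> tb; rewrite -[RHS](mul0r (J (fun=> 0) t)) -JZ//; last exact: MLp_cst.
by congr J; apply/funext => x; rewrite mul0r.
Qed.

Lemma J_sum (I : Type) (s : seq I) (F : I -> R -> R[i]) t : (forall i, MLp 1 (F i)) ->
  t <= b -> J (fun x => \sum_(i <- s) F i x) t = \sum_(i <- s) J (F i) t.
Proof.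
move=> F1 tb; elim: s => [|i s IH].
  rewrite big_nil -[RHS](J0 tb); congr J; apply/funext => x; exact: big_nil.
rewrite big_cons -IH -JD//; last by have [] := MLp_sum hab (lexx 1) s F1.
by congr J; apply/funext => x; exact: big_cons.
Qed.

Lemma cmeas_J f : MLp 1 f -> cmeas (J f).
Proof.
move=> f1; split.
  apply: subspace_continuous_measurable_fun => //.
  exact: (parameterized_integral_continuous (ltW hab) (L1_Re f1)).
apply: subspace_continuous_measurable_fun => //.
exact: (parameterized_integral_continuous (ltW hab) (L1_Im f1)).
Qed.

Lemma J_dq_ae f : MLp 1 f -> ae_on a b (fun t =>
  dq a b (fun u => complex.Re (J f u)) t (complex.Re (f t)) /\
  dq a b (fun u => complex.Im (J f u)) t (complex.Im (f t))).
Proof. by move=> f1; apply: ae_onI; apply: rJ_dq_ae => //; [exact: L1_Re|exact: L1_Im]. Qed.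

Lemma abs_continuous_J c f : MLp 1 f -> abs_continuous a b (fun t => c + J f t).
Proof.
move=> f1 e e0.
pose h := (fun x => normc (f x)) \_ D.
have ih : mu.-integrable setT (EFin \o h).
  by rewrite /h -restrict_EFin; apply/integrable_restrict => //=; rewrite setTI; exact: L1_normc.
(* Absolute continuity of the integral, to be applied to the union of the intervals; [e / 2] makes
   up for the factor 2 in [J_normcB]. *)
have [|d [d0 Hd]] := @integral_normr_continuous _ _ R mu h ih (e / 2); first by rewrite divr_gt0.
exists d => // N u v uv tI sd.
pose F (i : 'I_N) : set R := `]u i, v i[%classic.
pose A := \big[setU/set0]_(i <- index_enum 'I_N) F i.
have mF i : measurable (F i) by exact: measurable_itv.
have mA : measurable A by apply: bigsetU_measurable => i _.
have tF : trivIset [set` index_enum 'I_N] F by move=> i j _ _; exact: tI.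
have muA : (mu A < d%:E)%E.
  rewrite -[X in (X < _)%E]mul1e -(integral_cst mu mA) /A.
  rewrite ge0_integral_bigsetU ?index_enum_uniq//.
  rewrite (eq_bigr (fun i => (v i - u i)%:E)); first by rewrite sumEFin lte_fin.
  move=> i _; rewrite integral_cst; last exact: mF.
  rewrite mul1e; have := lebesgue_measure_itv (`]u i, v i[ : interval R).
  move=> mui; apply: (eq_trans mui); rewrite /= lte_fin.
  by case: ltP => // vui; have [_ uvi _] := uv i; rewrite (@le_anti _ _ (u i) (v i)) ?uvi// subrr.
have ihF i : mu.-integrable (F i) (EFin \o h).
  by apply: (@integrableS _ _ _ mu setT) => //; exact: mF.
have ihA : mu.-integrable A (EFin \o h) by apply: (@integrableS _ _ _ mu setT).
have E : \sum_(i < N) \int[mu]_(x in F i) h x = \int[mu]_(x in A) `|h x|.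
  apply: EFin_inj; rewrite -sumEFin fineK; last first.
    by apply: integrable_fin_num => //; exact: integrable_norm.
  transitivity (\int[mu]_(x in A) (h x)%:E)%E; last first.
    by apply: eq_integral => x _; rewrite ger0_norm// /h patchE; case: ifP => // _; exact: normc_ge0.
  rewrite /A integral_bigsetU_EFin ?index_enum_uniq//; last exact: measurable_int ihA.
  apply: eq_bigr => i _; rewrite /Rintegral fineK//.
  by apply: integrable_fin_num; [exact: mF|exact: ihF].
have := Hd A mA muA; rewrite -E => lt_e.
apply: (@le_lt_trans _ _ (2 * \sum_(i < N) \int[mu]_(x in F i) h x)); last by lra.
rewrite mulr_sumr; apply: ler_sum => i _; have [au uvi vb] := uv i.
rewrite opprD addrACA subrr add0r (le_trans (J_normcB f1 au uvi vb))//.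
rewrite ler_wpM2l// (rJB (L1_normc f1))// -Rintegral_itv_bndo_bndc; last first.
  apply: (integrable_sub (a := a) (b := b) _ _ (L1_normc f1)); first exact: measurable_itv.
  by apply: subset_itv; rewrite bnd_simp.
rewrite le_eqVlt; apply/orP; left; apply/eqP; apply: eq_Rintegral => x /set_mem xF.
rewrite /h patchE mem_set//=; move: xF; rewrite /= !in_itv /= => /andP[ux xv].
by rewrite (le_trans au (ltW ux)) (le_trans (ltW xv)).
Qed.

(** Real and imaginary parts are absolutely continuous real functions, hence primitives of
    integrable functions. *)
Lemma abs_continuousP f : abs_continuous a b f ->
  exists2 g, MLp 1 g & forall t, a <= t <= b -> f t = f a + J g t.
Proof.
move=> af.
(* A real function that is 1-Lipschitz for [normc] preserves absolute continuity; enumerating [T]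
   passes from ordinals to an arbitrary finite index type. *)
have ra (F : R[i] -> R) : (forall z w, `|F z - F w| <= normc (z - w)) ->
    racont a b (fun t => F (f t)).
  move=> FL e e0; have [d d0 H] := af e e0; exists d => // T u v uv tI sd.
  have := H #|T| (fun i => u (enum_val i)) (fun i => v (enum_val i)).
  move=> /(_ (fun i => uv (enum_val i))) H'.
  apply: (@le_lt_trans _ _ (\sum_(i < #|T|)
    normc (f (v (enum_val i)) - f (u (enum_val i))))).
    rewrite -(big_enum_val (A := T) (fun i => normc (f (v i) - f (u i)))).
    by apply: ler_sum => i _; exact: FL.
  apply: H'.
    move=> i j _ _ [x xij]; apply: enum_val_inj; apply: (tI _ _ Logic.I Logic.I).
    by exists x.
  by rewrite -(big_enum_val (A := T) (fun i => v i - u i)).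
have [g1 ig1 g1E] : exists2 g : R -> R, mu.-integrable setT (EFin \o g) &
    forall t, a <= t -> t <= b -> complex.Re (f t) = complex.Re (f a) + \int[mu]_(x in `[a, t]) g x.
  apply: (racont_integral (ltW hab)); apply: ra => z w.
  by rewrite -ReN -ReD Re_le_normc.
have [g2 ig2 g2E] : exists2 g : R -> R, mu.-integrable setT (EFin \o g) &
    forall t, a <= t -> t <= b -> complex.Im (f t) = complex.Im (f a) + \int[mu]_(x in `[a, t]) g x.
  apply: (racont_integral (ltW hab)); apply: ra => z w.
  by rewrite -ImN -ImD Im_le_normc.
have jg1 : mu.-integrable D (EFin \o g1) by exact: integrableS ig1.
have jg2 : mu.-integrable D (EFin \o g2) by exact: integrableS ig2.
exists (fun t => g1 t +i* g2 t).
  apply/L1P; have mg : cmeas (fun t => g1 t +i* g2 t).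
    by split => /=; apply/measurable_EFinP; [case/integrableP: jg1|case/integrableP: jg2].
  split => //.
  have ig : mu.-integrable D (EFin \o (fun x => `|g1 x| + `|g2 x|)).
    by apply: rintD => //; exact: integrable_norm.
  apply: le_integrable ig => //.
  - by apply/measurable_EFinP; exact: cmeas_normc.
  - move=> x _; rewrite /= lee_fin ger0_norm ?sqrtr_ge0// ger0_norm ?addr_ge0//.
    exact: (normc_le_ReIm (g1 x +i* g2 x)).
move=> t /andP[at_ tb]; apply: complex_eqP; rewrite ?ReD ?ImD /=; [exact: g1E|exact: g2E].
Qed.

End Primitive.

(** * Sobolev functions as jets *)

Section Jets.
Context {R : realType} (a b p : R).
Context (hab : a < b) (hp : 1 <= p).
Local Notation cmeas := (cmeas a b).
Local Notation MLp := (MLp a b).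
Local Notation Ln := (Ln a b).
Local Notation J := (J a).
Implicit Types (f g : R -> R[i]).

Let p0 : 0 < p. Proof. by rewrite (lt_le_trans _ hp). Qed.

Definition cdq f t (l : R[i]) :=
  dq a b (fun x => complex.Re (f x)) t (complex.Re l) /\
  dq a b (fun x => complex.Im (f x)) t (complex.Im l).

Definition ccont f t :=
  contAt a b (fun x => complex.Re (f x)) t /\ contAt a b (fun x => complex.Im (f x)) t.

Lemma cdq_derivable f t l : cdq f t l -> derivable_in a b f t.
Proof. by move=> [/dq_cvg h1 /dq_cvg h2]; split; [exact: cvgP h1|exact: cvgP h2]. Qed.

Lemma cdq_derive f t l : a <= t <= b -> cdq f t l -> derive_in a b f t = l.
Proof.
move=> tab [h1 h2]; rewrite /derive_in (dq_lim hab tab h1) (dq_lim hab tab h2).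
by case: l h1 h2.
Qed.

Lemma derivable_cdq f t : derivable_in a b f t -> cdq f t (derive_in a b f t).
Proof. by move=> [h1 h2]; split; exact: cvg_dq. Qed.

Lemma cdq_ccont f t l : cdq f t l -> ccont f t.
Proof. by move=> [/dq_cont h1 /dq_cont h2]. Qed.

Lemma cdq_eq f g t l : a <= t <= b -> (forall x, a <= x <= b -> f x = g x) ->
  cdq f t l -> cdq g t l.
Proof. by move=> tab fg [h1 h2]; split; [apply: dq_eq h1|apply: dq_eq h2] => // x /fg ->. Qed.

Lemma contAt_eq (h k : R -> R) t : a <= t <= b -> (forall x, a <= x <= b -> h x = k x) ->
  contAt a b h t -> contAt a b k t.
Proof.
move=> tab hk H e e0; have [d d0 Hd] := H e e0; exists d => // x xab xd.
by rewrite -!hk//; exact: Hd.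
Qed.

Lemma ccont_eq f g t : a <= t <= b -> (forall x, a <= x <= b -> f x = g x) ->
  ccont f t -> ccont g t.
Proof. by move=> tab fg [h1 h2]; split; [apply: contAt_eq h1|apply: contAt_eq h2] => // x /fg ->. Qed.

Lemma dq_addc (h : R -> R) (c : R) t l : dq a b h t l -> dq a b (fun x => c + h x) t l.
Proof.
move=> H e e0; have [d d0 Hd] := H e e0; exists d => // x xab xt xd.
by rewrite opprD addrACA subrr add0r; exact: Hd.
Qed.

Lemma cdq_addc f c t l : cdq f t l -> cdq (fun x => c + f x) t l.
Proof.
move=> [h1 h2]; split.
  rewrite (_ : (fun x => _) = fun x => complex.Re c + complex.Re (f x)); first exact: dq_addc.
  by apply/funext => x; rewrite ReD.
rewrite (_ : (fun x => _) = fun x => complex.Im c + complex.Im (f x)); first exact: dq_addc.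
by apply/funext => x; rewrite ImD.
Qed.

Lemma J_cdq_ae c g : MLp 1 g -> ae_on a b (fun t => cdq (fun x => c + J g x) t (g t)).
Proof.
move=> g1; move: (J_dq_ae g1); apply: ae_onS => t tab H.
exact: cdq_addc.
Qed.

Lemma J_cdq c g t : MLp 1 g -> a <= t <= b -> ccont g t -> cdq (fun x => c + J g x) t (g t).
Proof.
move=> g1 tab [h1 h2]; apply: cdq_addc; split; apply: rJ_dq_cont => //.
- exact: L1_Re.
- exact: L1_Im.
Qed.

Lemma abs_continuous_ccont f t : a <= t <= b -> abs_continuous a b f -> ccont f t.
Proof.
move=> /andP[at_ tb] af.
have key e : 0 < e -> exists2 d : R, 0 < d & forall x, a <= x <= b ->
    `|x - t| < d -> normc (f x - f t) < e.
  move=> e0; have [d d0 Hd] := af e e0; exists d => // x /andP[ax xb] xd.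
  have H (u v : R) : a <= u -> u <= v -> v <= b -> v - u < d -> normc (f v - f u) < e.
    move=> au uv vb vu; have := Hd 1%N (fun=> u) (fun=> v); rewrite !big_ord1; apply => //.
    by move=> i j _ _ _; rewrite !ord1.
  have [xt|tx] := leP x t; last first.
    by apply: H => //; [exact: ltW|move: xd; rewrite gtr0_norm ?subr_gt0].
  by rewrite normcBC; apply: H => //; move: xd; rewrite distrC ger0_norm ?subr_ge0.
split=> e e0; have [d d0 Hd] := key e e0; exists d => // x xab xd.
- by rewrite -ReN -ReD (le_lt_trans (Re_le_normc _))// Hd.
- by rewrite -ImN -ImD (le_lt_trans (Im_le_normc _))// Hd.
Qed.

Lemma abs_continuous_eq f g : (forall t, a <= t <= b -> f t = g t) ->
  abs_continuous a b f -> abs_continuous a b g.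
Proof.
move=> fg H e e0; have [d d0 Hd] := H e e0; exists d => // N u v uv tI sd.
have := Hd N u v uv tI sd; congr (_ < _); apply: eq_bigr => i _.
by have [au uvi vb] := uv i; rewrite !fg ?(le_trans au)// ?(le_trans uvi)// ?au.
Qed.

(** What derivatives below the top order satisfy: enough to multiply L_p functions by them and to
    differentiate their primitives at every point. *)
Definition nice f := [/\ cmeas f, exists M, forall t, a <= t <= b -> normc (f t) <= M &
  forall t, a <= t <= b -> ccont f t].

Lemma nice_MLp q f : 1 <= q -> nice f -> MLp q f.
Proof. by move=> q1 [mf [M fM] _]; have [] := MLp_bounded hab q1 mf fM. Qed.

Lemma nice_J c f g : MLp 1 g -> (forall t, a <= t <= b -> f t = c + J g t) -> nice f.
Proof.
move=> g1 fE; split.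
- apply: (@cmeas_eq _ a b (fun t => c + J g t)); first by move=> t; rewrite /= in_itv /= => /fE.
  by apply: cmeasD; [exact: cmeas_cst|exact: cmeas_J].
- exists (normc c + 2 * Ln 1 g) => t /[dup] /andP[at_ tb] tab.
  by rewrite fE// (le_trans (normc_triangle _ _))// lerD2l (J_bound g1).
- move=> t tab; apply: (@ccont_eq (fun t => c + J g t)) => //; first by move=> x /fE.
  by apply: abs_continuous_ccont => //; exact: abs_continuous_J.
Qed.

(* An element of W^k_p together with its derivatives: [Y s] is the s-th one. Since
   consecutive levels are linked by integration, only [Y k] involves null sets. *)
Definition jet k (Y : nat -> R -> R[i]) :=
  (forall s, (s < k)%N -> forall t, a <= t <= b -> Y s t = Y s a + J (Y s.+1) t) /\
  MLp p (Y k).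

Lemma L1_Lp f : MLp p f -> MLp 1 f.
Proof. by move=> fp; have [C _ /(_ f fp)[]] := MLp_L1 hab hp. Qed.

(** [j] counts orders downwards from k - 1: the derivative of order k - 1 is the primitive of an L_1
    function, and each lower one is the primitive of a nice function. *)
Lemma jet_nice k Y s : jet k Y -> (s < k)%N -> nice (Y s).
Proof.
move=> [YE Yk] sk.
suff H j : (j < k)%N -> nice (Y (k.-1 - j)%N).
  have := H (k.-1 - s)%N; rewrite subKn; last by case: k sk {YE Yk H}.
  by apply; case: k sk {YE Yk H} => // k sk /=; rewrite ltnS leq_subr.
elim: j => [|j IH] jk.
  apply: (@nice_J (Y (k.-1 - 0)%N a) _ (Y k)); first exact: L1_Lp.
  by move=> t /YE; rewrite subn0; move/(_ k.-1); case: k sk jk {YE Yk} => // k _ _ ->.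
have jk' : (j < k)%N by exact: ltnW.
apply: (@nice_J (Y (k.-1 - j.+1)%N a) _ (Y (k.-1 - j)%N)).
  exact: nice_MLp (IH jk').
move=> t tab; rewrite YE//; last by case: k jk {YE Yk sk IH jk'} => // k _ /=; rewrite ltnS leq_subr.
rewrite subnSK//; by case: k jk {YE Yk sk IH jk'}.
Qed.

Lemma jet_MLp k Y s : jet k Y -> (s <= k)%N -> MLp p (Y s).
Proof.
move=> jY; rewrite leq_eqVlt => /predU1P[->|sk]; first by case: jY.
exact: nice_MLp (jet_nice jY sk).
Qed.

Lemma jet_L1 k Y s : jet k Y -> (s <= k)%N -> MLp 1 (Y s).
Proof. by move=> jY sk; apply/L1_Lp/(jet_MLp jY). Qed.

Lemma jet_eqJ k Y s t : jet k Y -> (s < k)%N -> a <= t <= b -> Y s t = Y s a + J (Y s.+1) t.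
Proof. by move=> [H _] sk tab; exact: H. Qed.

Lemma jetD k Y Z : jet k Y -> jet k Z -> jet k (fun s t => Y s t + Z s t).
Proof.
move=> jY jZ; split; last by have [] := MLpD hp (jet_MLp jY (leqnn k)) (jet_MLp jZ (leqnn k)).
move=> s sk t /[dup] tab /andP[at_ tb].
rewrite (jet_eqJ jY sk tab) (jet_eqJ jZ sk tab) (JD (jet_L1 jY sk) (jet_L1 jZ sk) tb).
by rewrite addrACA.
Qed.

Lemma jetZ k Y c : jet k Y -> jet k (fun s t => c * Y s t).
Proof.
move=> jY; split; last by have [] := MLpZ hp c (jet_MLp jY (leqnn k)).
move=> s sk t /[dup] tab /andP[at_ tb].
by rewrite (jet_eqJ jY sk tab) (JZ c (jet_L1 jY sk) tb) mulrDr.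
Qed.

Lemma jet_eq k Y Z : (forall s t, (s <= k)%N -> a <= t <= b -> Y s t = Z s t) ->
  jet k Y -> jet k Z.
Proof.
move=> YZ jY; split; last first.
  by apply: MLp_eq (jet_MLp jY (leqnn k)) => // t; rewrite /= in_itv /=; exact: YZ.
move=> s sk t /[dup] tab /andP[at_ tb].
rewrite -!YZ ?(ltnW sk)// ?lexx ?ltW// (jet_eqJ jY sk tab); congr (_ + _).
by apply: (@J_eq _ a b) => // x xab; exact: YZ.
Qed.

Lemma jet0 k : jet k (fun _ _ => 0).
Proof.
split; last exact: MLp_cst.
by move=> s sk t /andP[_ tb]; rewrite (J0 hab tb) addr0.
Qed.

Lemma jetN k Y : jet k Y -> jet k (fun s t => - Y s t).
Proof. by move=> /(jetZ (-1)); apply: jet_eq => s t _ _; rewrite mulN1r. Qed.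

Lemma jetB k Y Z : jet k Y -> jet k Z -> jet k (fun s t => Y s t - Z s t).
Proof. by move=> jY /jetN; exact: jetD. Qed.

Lemma jet_sum (I : Type) (r : seq I) k (Y : I -> nat -> R -> R[i]) :
  (forall i, jet k (Y i)) -> jet k (fun s t => \sum_(i <- r) Y i s t).
Proof.
move=> jY; elim: r => [|i r IH].
  by apply: jet_eq (jet0 k) => s t _ _; rewrite big_nil.
by apply: jet_eq (jetD (jY i) IH) => s t _ _; rewrite big_cons.
Qed.

Lemma jet_le k j Y : (j <= k)%N -> jet k Y -> jet j Y.
Proof.
move=> jk jY; split; last exact: jet_MLp jY jk.
by move=> s sj t tab; apply: (jet_eqJ jY) => //; exact: leq_trans jk.
Qed.

Lemma jet_shift k j Y : jet (j + k) Y -> jet k (fun s => Y (j + s)%N).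
Proof.
move=> jY; split; last exact: jet_MLp jY (leqnn _).
by move=> s sk t tab; rewrite (jet_eqJ jY)// ?addnS// ltn_add2l.
Qed.

(** Links a function of the statement to its jet. The derivative of top order exists only almost
    everywhere; for [k = 0] this clause alone remains, as befits an element of L_p. *)
Definition rep k f (Y : nat -> R -> R[i]) :=
  (forall s, (s < k)%N -> forall t, a <= t <= b -> derive_in_n a b s f t = Y s t) /\
  ae_on a b (fun t => derive_in_n a b k f t = Y k t).

Lemma MLp_in_Lp q f g : 0 < q -> MLp q g -> ae_on a b (fun t => f t = g t) -> in_Lp a b q%:E f.
Proof.
move=> q0 [mg gq] fg; split; first by rewrite (Lp_norm_ae_eq q0 fg).
by exists g; case: mg.
Qed.

Lemma in_Lp_MLp q f : 0 < q -> in_Lp a b q%:E f -> exists2 g, MLp q g & ae_on a b (fun t => f t = g t).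
Proof.
move=> q0 [fq [g [m1 m2 fg]]]; exists g => //; split=> //.
by rewrite -(Lp_norm_ae_eq q0 fg).
Qed.

Lemma jet_cdq k Y s t : jet k Y -> (s.+1 < k)%N -> a <= t <= b -> cdq (Y s) t (Y s.+1 t).
Proof.
move=> jY sk tab; have sk' := ltnW sk.
apply: (@cdq_eq (fun x => Y s a + J (Y s.+1) x)) => //.
  by move=> x xab; rewrite -(jet_eqJ jY sk' xab).
apply: J_cdq => //; first exact: jet_L1 jY sk'.
by have [_ _] := jet_nice jY sk; apply.
Qed.

Lemma jet_cdq_ae k Y s : jet k Y -> (s < k)%N -> ae_on a b (fun t => cdq (Y s) t (Y s.+1 t)).
Proof.
move=> jY sk; apply: ae_onS (J_cdq_ae (Y s a) (jet_L1 jY sk)) => t; rewrite in_itv /= => tab.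
by apply: cdq_eq => // x xab; rewrite -(jet_eqJ jY sk xab).
Qed.

Lemma jet_rep k f Y : jet k Y -> (forall t, (0 < k)%N -> a <= t <= b -> f t = Y 0%N t) ->
  ae_on a b (fun t => f t = Y 0%N t) -> rep k f Y.
Proof.
move=> jY fY fYae.
have H s : (s < k)%N -> forall t, a <= t <= b -> derive_in_n a b s f t = Y s t.
  elim: s => [|s IH] sk t tab; first by rewrite /derive_in_n /= fY.
  rewrite /derive_in_n iterS; apply: cdq_derive => //.
  apply: (@cdq_eq (Y s)) => //; last exact: jet_cdq jY sk tab.
  by move=> x xab; rewrite -IH// ltnW.
split => //; case: k jY fY H => [|k] jY fY H; first exact: fYae.
apply: ae_onS (jet_cdq_ae jY (ltnSn k)) => t; rewrite in_itv /= => tab ct.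
apply: cdq_derive => //.
apply: (@cdq_eq (Y k)) => //.
by move=> x xab; rewrite -H.
Qed.

Lemma rep_sobolev k f Y : jet k Y -> rep k f Y -> in_sobolev a b k p f.
Proof.
move=> jY [fs approx_rhs]; case: k jY fs approx_rhs => [|k] jY fs approx_rhs /=.
  by apply: MLp_in_Lp approx_rhs => //; exact: jet_MLp jY _.
split.
- move=> s t sk; rewrite in_itv /= => tab; apply: (@cdq_derivable _ _ (Y s.+1 t)).
  apply: (@cdq_eq (Y s)) => //; last exact: jet_cdq jY _ tab.
  by move=> x xab; rewrite -fs// (ltn_trans sk).
- apply: (@abs_continuous_eq (fun t => Y k a + J (Y k.+1) t)).
    by move=> t tab; rewrite fs// -(jet_eqJ jY).
  by apply: abs_continuous_J => //; exact: jet_L1 jY _.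
- by apply: MLp_in_Lp approx_rhs => //; exact: jet_MLp jY _.
Qed.

(** Both sides have the same derivative at every point, endpoints included, so their difference is
    constant by the mean value theorem. *)
Lemma cdq_J h h' : nice h' -> (forall t, a <= t <= b -> cdq h t (h' t)) ->
  forall t, a <= t <= b -> h t = h a + J h' t.
Proof.
move=> nh' hd t tab.
have h'1 := nice_MLp (lexx 1) nh'; have [_ _ ch'] := nh'.
have hJ x : a <= x <= b -> cdq (fun u => 0 + J h' u) x (h' x).
  by move=> xab; apply: J_cdq => //; exact: ch'.
apply: complex_eqP; rewrite ?ReD ?ImD.
- have : forall x, a <= x <= b -> dq a b (fun u => complex.Re (h u) - complex.Re (0 + J h' u)) x 0.
    move=> x xab; rewrite -(subrr (complex.Re (h' x))); apply: dqB.
    + by have [] := hd x xab.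
    + by have [] := hJ x xab.
  by move=> /(dq0_cst hab)/(_ t tab); rewrite !add0r J_a /=; lra.
- have : forall x, a <= x <= b -> dq a b (fun u => complex.Im (h u) - complex.Im (0 + J h' u)) x 0.
    move=> x xab; rewrite -(subrr (complex.Im (h' x))); apply: dqB.
    + by have [] := hd x xab.
    + by have [] := hJ x xab.
  by move=> /(dq0_cst hab)/(_ t tab); rewrite !add0r J_a /=; lra.
Qed.

(** Below the top order the jet consists of the derivatives themselves; at the top it is the Borel
    density given by [abs_continuousP], which equals the derivative almost everywhere. Niceness is
    propagated downwards, each derivative being the primitive of the next. *)
Lemma sobolev_rep k f : in_sobolev a b k p f -> exists2 Y, jet k Y & rep k f Y.
Proof.
case: k => [|k] /=.
  move=> /(in_Lp_MLp p0)[g gp fg]; exists (fun=> g) => //; by split.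
move=> [ds ac Lk]; have [g g1 gE] := abs_continuousP hab ac.
have kae : ae_on a b (fun t => derive_in_n a b k.+1 f t = g t).
  apply: ae_onS (J_cdq_ae (derive_in_n a b k f a) g1) => t; rewrite in_itv /= => tab ct.
  apply: cdq_derive => //.
  by apply: cdq_eq ct => // x xab; rewrite -gE.
have gp : MLp p g.
  split; first by case: g1.
  by rewrite -(Lp_norm_ae_eq p0 kae); case: Lk.
have dE s : (s < k)%N -> nice (derive_in_n a b s.+1 f) -> forall t, a <= t <= b ->
    derive_in_n a b s f t = derive_in_n a b s f a + J (derive_in_n a b s.+1 f) t.
  move=> sk ns; apply: cdq_J => // t tab; apply: derivable_cdq.
  by apply: ds => //; rewrite in_itv.
have H j : (j <= k)%N -> nice (derive_in_n a b (k - j) f).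
  elim: j => [|j IH] jk; first by rewrite subn0; exact: nice_J g1 gE.
  have nj := IH (ltnW jk).
  have E : (k - j.+1).+1 = (k - j)%N by rewrite subnSK.
  have sk : (k - j.+1 < k)%N by rewrite E leq_subr.
  apply: (@nice_J (derive_in_n a b (k - j.+1) f a) _ (derive_in_n a b (k - j.+1).+1 f)).
    by rewrite E; exact: nice_MLp nj.
  by apply: dE => //; rewrite E.
have ns s : (s <= k)%N -> nice (derive_in_n a b s f).
  by move=> sk; rewrite -(subKn sk); apply: H; exact: leq_subr.
exists (fun s => if (s <= k)%N then derive_in_n a b s f else g); last first.
  by split=> [s|]; [rewrite ltnS => -> |rewrite ltnn].
split; last by rewrite ltnn.
move=> s; rewrite ltnS => /[dup] sk; rewrite leq_eqVlt => /predU1P[->|sk'] t tab.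
  by rewrite eqxx ltnn; exact: gE.
by rewrite sk' orbT; apply: dE => //; exact: ns.
Qed.

Lemma dqM (h k : R -> R) t l l' : dq a b h t l -> dq a b k t l' ->
  dq a b (fun u => h u * k u) t (l * k t + h t * l').
Proof.
move=> H K e e0.
have ch := dq_cont H.
pose M := `|k t| + `|l'| + `|h t| + 2.
have kt := normr_ge0 (k t); have l'0 := normr_ge0 l'; have ht := normr_ge0 (h t).
have M0 : 0 < M by rewrite /M; lra.
have eM : 0 < Num.min 1 (e / (3 * M)) by rewrite lt_min ltr01 divr_gt0// mulr_gt0.
have [d d0 Hd] := H _ eM; have [d' d'0 Kd] := K _ eM; have [d2 d20 Cd] := ch _ eM.
exists (Num.min d (Num.min d' d2)); first by rewrite !lt_min d0 d'0.
move=> u uab ut; rewrite !lt_min => /andP[ud /andP[ud' ud2]].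
have := Hd u uab ut ud; have := Kd u uab ut ud'; have := Cd u uab ud2.
set x := (h u - h t) / _ - l; set y := (k u - k t) / _ - l'; set z := h u - h t.
move=> z1 y1 x1.
have -> : (h u * k u - h t * k t) / (u - t) - (l * k t + h t * l') =
    x * k t + (h t + z) * y + z * l'.
  by rewrite /x /y /z; ring.
move: z1 y1 x1; rewrite !lt_min => /andP[z1 z2] /andP[y1 y2] /andP[x1 x2].
have E3 : 3 * M * (e / (3 * M)) = e by rewrite mulrC divfK// gt_eqF// mulr_gt0.
set w := e / (3 * M) in x2 y2 z2 E3 *.
have w0 : 0 <= w by exact: (le_trans (normr_ge0 _) (ltW x2)).
apply: (@le_lt_trans _ _ (`|x| * `|k t| + (`|h t| + `|z|) * `|y| + `|z| * `|l'|)).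
  rewrite (le_trans (ler_normD _ _))// normrM lerD// (le_trans (ler_normD _ _))// !normrM lerD//.
  by rewrite ler_wpM2r// ler_normD.
rewrite -E3; have x0 := normr_ge0 x; have y0 := normr_ge0 y; have z0 := normr_ge0 z.
have : `|x| * `|k t| <= w * `|k t| by rewrite ler_wpM2r// ltW.
have : `|z| * `|l'| <= w * `|l'| by rewrite ler_wpM2r// ltW.
have : (`|h t| + `|z|) * `|y| <= (`|h t| + 1) * w.
  by apply: ler_pM; rewrite ?addr_ge0// ?lerD2l ltW.
have wp : 0 < w by exact: le_lt_trans (normr_ge0 _) x2.
rewrite /M; nra.
Qed.

Lemma cdqM f g t l l' : cdq f t l -> cdq g t l' ->
  cdq (fun u => f u * g u) t (l * g t + f t * l').
Proof.
move=> [f1 f2] [g1 g2]; split.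
  rewrite (_ : (fun x => _) = fun x => complex.Re (f x) * complex.Re (g x) -
    complex.Im (f x) * complex.Im (g x)); last by apply/funext => x; rewrite ReM.
  rewrite ReD !ReM (_ : _ + _ = (complex.Re l * complex.Re (g t) + complex.Re (f t) * complex.Re l')
    - (complex.Im l * complex.Im (g t) + complex.Im (f t) * complex.Im l')); last by ring.
  by apply: dqB; exact: dqM.
rewrite (_ : (fun x => _) = fun x => complex.Re (f x) * complex.Im (g x) -
    (- complex.Im (f x)) * complex.Re (g x)); last by apply/funext => x; rewrite ImM; ring.
rewrite ImD !ImM (_ : _ + _ = (complex.Re l * complex.Im (g t) + complex.Re (f t) * complex.Im l')
    - ((- complex.Im l) * complex.Re (g t) + (- complex.Im (f t)) * complex.Re l')); last by ring.
apply: dqB; first exact: dqM.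
apply: dqM => // e e0; have [d d0 Hd] := f2 e e0; exists d => // u uab ut ud.
by rewrite -opprD mulNr -opprD normrN; exact: Hd.
Qed.

Lemma abs_continuousM f g : nice f -> nice g -> abs_continuous a b f -> abs_continuous a b g ->
  abs_continuous a b (fun t => f t * g t).
Proof.
move=> [_ [M fM] _] [_ [M' gM] _] af ag e e0.
pose K := `|M| + `|M'| + 1.
have K0 : 0 < K by rewrite /K ltr_wpDl// addr_ge0.
have eK : 0 < e / (2 * K) by rewrite divr_gt0// mulr_gt0.
have [d d0 Hd] := af _ eK; have [d' d'0 Hd'] := ag _ eK.
exists (Num.min d d'); first by rewrite lt_min d0.
move=> N u v uv tI; rewrite lt_min => /andP[/(Hd N u v uv tI) h /(Hd' N u v uv tI) h'].
have E : e = K * (e / (2 * K)) + K * (e / (2 * K)).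
  by field; rewrite gt_eqF.
rewrite E; apply: (@le_lt_trans _ _ (K * (\sum_(i < N) normc (f (v i) - f (u i))) +
   K * (\sum_(i < N) normc (g (v i) - g (u i))))); last first.
  by apply: ltrD; rewrite ltr_pM2l.
rewrite !mulr_sumr -big_split /=; apply: ler_sum => i _; have [au uvi vb] := uv i.
have -> : f (v i) * g (v i) - f (u i) * g (u i) =
  g (v i) * (f (v i) - f (u i)) + f (u i) * (g (v i) - g (u i)) by ring.
rewrite (le_trans (normc_triangle _ _))// !normcM lerD// ler_wpM2r ?normc_ge0//.
- rewrite (le_trans (gM _ _)) ?(le_trans au)// /K.
  by have := ler_norm M'; have := normr_ge0 M; lra.
- rewrite (le_trans (fM _ _)) ?au ?(le_trans uvi)// /K.
  by have := ler_norm M; have := normr_ge0 M'; lra.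
Qed.

(* The product rule: the primitive given by absolute continuity of the product
   has the right density because derivatives exist almost everywhere. *)
Lemma J_prod f f' g g' : MLp 1 f' -> MLp 1 g' ->
  (forall t, a <= t <= b -> f t = f a + J f' t) ->
  (forall t, a <= t <= b -> g t = g a + J g' t) ->
  forall t, a <= t <= b -> f t * g t = f a * g a + J (fun x => f' x * g x + f x * g' x) t.
Proof.
move=> f'1 g'1 fE gE.
have nf := nice_J f'1 fE; have ng := nice_J g'1 gE.
have af : abs_continuous a b f.
  by apply: (@abs_continuous_eq (fun t => f a + J f' t)); [move=> t /fE|exact: abs_continuous_J].
have ag : abs_continuous a b g.
  by apply: (@abs_continuous_eq (fun t => g a + J g' t)); [move=> t /gE|exact: abs_continuous_J].
have [w w1 wE] := abs_continuousP hab (abs_continuousM nf ng af ag).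
move=> t /[dup] tab /andP[_ tb]; rewrite wE//; congr (_ + _).
apply: (@J_eq_ae _ a b) => //.
have H1 := J_cdq_ae (f a) f'1; have H2 := J_cdq_ae (g a) g'1.
have H3 := J_cdq_ae (f a * g a) w1.
move: (ae_onI H1 (ae_onI H2 H3)); apply: ae_onS => x; rewrite in_itv /= => xab [c1 [c2 c3]].
have c1' : cdq f x (f' x) by apply: cdq_eq c1 => // u /fE.
have c2' : cdq g x (g' x) by apply: cdq_eq c2 => // u /gE.
have c4 := cdqM c1' c2'.
have c3' : cdq (fun u => f u * g u) x (w x) by apply: cdq_eq c3 => // u /wE.
by rewrite -(cdq_derive xab c4) (cdq_derive xab c3').
Qed.

End Jets.

(** * Volterra equations *)

Section GeometricLimit.
Context {R : realType}.

Lemma half_pow_small (e : R) : 0 < e -> exists k : nat, forall i, (k <= i)%N -> 2 ^- i < e.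
Proof.
move=> e0; exists (Num.bound e^-1) => i ki.
by rewrite invf_plt ?posrE ?exprn_gt0// upper_nthrootP.
Qed.

(** The intervals with centre [x j] and radius [2 * C * 2 ^- j] are nested, and the supremum of
    their left ends lies in all of them. *)
Lemma geometric_limit (C : R) (x : nat -> R) :
  (forall j, `|x j.+1 - x j| <= C * 2 ^- j) ->
  exists l, forall j, `|l - x j| <= 2 * C * 2 ^- j.
Proof.
move=> H; pose y j := x j - 2 * C * 2 ^- j; pose z j := x j + 2 * C * 2 ^- j.
have half j : 2 ^- j = 2 * 2 ^- j.+1 :> R.
  by rewrite exprS invfM mulrA mulfV ?mul1r.
have C0 : 0 <= C.
  by have := H 0%N; rewrite expr0 invr1 mulr1; exact: le_trans.
have pj j : 0 <= 2 ^- j :> R by rewrite invr_ge0 exprn_ge0.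
have yS j : y j <= y j.+1.
  by have /ler_normlP[] := H j; rewrite /y half; lra.
have zS j : z j.+1 <= z j.
  by have /ler_normlP[] := H j; rewrite /z half; lra.
have ym i j : (i <= j)%N -> y i <= y j.
  by move=> /subnK <-; elim: (j - i)%N => // k; rewrite addSn => h; exact: le_trans (yS _).
have zm i j : (i <= j)%N -> z j <= z i.
  by move=> /subnK <-; elim: (j - i)%N => // k; rewrite addSn => h; exact: le_trans (zS _) _.
have yz i j : y i <= z j.
  apply: (le_trans (ym _ (maxn i j) (leq_maxl _ _))).
  apply: le_trans (zm _ _ (leq_maxr i j)).
  by rewrite /y /z; have := mulr_ge0 C0 (pj (maxn i j)); lra.
pose S := [set y j | j in setT].
have hS : has_sup S.
  by split; [exists (y 0%N); exists 0%N|exists (z 0%N) => _ [i _ <-]].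
exists (sup S) => j; rewrite ler_distl; apply/andP; split.
  by apply: sup_upper_bound => //; exists j.
by apply: ge_sup; [case: hS|move=> _ [i _ <-]; exact: yz].
Qed.

Lemma le_geometric_eq0 (C x : R) : (forall j : nat, `|x| <= C * 2 ^- j) -> x = 0.
Proof.
move=> H; apply/eqP; rewrite -normr_eq0 eq_le normr_ge0 andbT; apply/ler_addgt0Pr => e e0.
have C0 : 0 < `|C| + 1 by rewrite ltr_wpDl.
have [k Hk] := half_pow_small (divr_gt0 e0 C0).
rewrite add0r (le_trans (H k))//; have := Hk k (leqnn k).
rewrite ltr_pdivlMr// => h; apply: le_trans (ltW h); rewrite mulrC.
by rewrite ler_wpM2l ?invr_ge0 ?exprn_ge0// (le_trans (ler_norm _))// lerDl.
Qed.

Lemma geometric_limitc (C : R) (x : nat -> R[i]) :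
  (forall j, normc (x j.+1 - x j) <= C * 2 ^- j) ->
  exists l, forall j, normc (l - x j) <= 4 * C * 2 ^- j.
Proof.
move=> H.
have [l1 H1] : exists l, forall j, `|l - complex.Re (x j)| <= 2 * C * 2 ^- j.
  by apply: geometric_limit => j; rewrite -ReN -ReD (le_trans (Re_le_normc _)).
have [l2 H2] : exists l, forall j, `|l - complex.Im (x j)| <= 2 * C * 2 ^- j.
  by apply: geometric_limit => j; rewrite -ImN -ImD (le_trans (Im_le_normc _)).
exists (l1 +i* l2) => j; rewrite (le_trans (normc_le_ReIm _))// ReD ImD ReN ImN /=.
by have := H1 j; have := H2 j; lra.
Qed.

End GeometricLimit.

Section Picard.
Context {R : realType} (a b : R).
Context (hab : a < b).
Local Notation mu := (@lebesgue_measure R).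
Local Notation D := (`[a, b]%classic : set R).
Local Notation cmeas := (cmeas a b).
Local Notation MLp := (MLp a b).
Local Notation Ln := (Ln a b).
Local Notation J := (J a).
Local Notation V := (V a).

Let mD : measurable D. Proof. exact: measurable_itv. Qed.

(** Dominated convergence: for fixed x the factor vanishes as soon as N reaches [k x]. *)
Lemma integrable_tail (h k : R -> R) : (forall x, D x -> 0 <= h x) ->
  mu.-integrable D (EFin \o h) -> measurable_fun D k ->
  forall e, 0 < e -> exists N : nat,
    \int[mu]_(x in D) (h x * (N%:R < k x)%R%:R) <= e.
Proof.
move=> h0 ih mk e e0.
pose f_ (n : nat) x := (h x * (n%:R < k x)%R%:R)%:E.
have mh : measurable_fun D h by apply/measurable_EFinP; case/integrableP: ih.
have mb n : measurable_fun D (fun x => (n%:R < k x)%R%:R : R).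
  rewrite (_ : (fun x => _) = fun x => if n%:R < k x then 1 else 0).
    by apply: measurable_fun_if => //; exact: measurable_fun_ltr.
  by apply/funext => x; case: ifP.
have mf_ n : measurable_fun D (f_ n).
  by apply/measurable_EFinP; apply: measurable_funM.
have cv : (\int[mu]_(x in D) f_ n x @[n --> \oo] --> \int[mu]_(x in D) (cst 0) x)%E.
  apply: (@dominated_cvg _ _ _ mu D mD f_ (cst 0%E) (EFin \o h)) => //.
  - move=> x Dx; apply: (@cvg_near_cst).
    exists (Num.bound (k x)) => // n /= kn.
    have : k x < n%:R.
      have [k0|k0] := ltP (k x) 0; first exact: lt_le_trans k0 (ler0n _ _).
      by rewrite (lt_le_trans (archi_boundP k0))// ler_nat.
    by move=> /ltW; rewrite leNgt /f_ => /negbTE ->; rewrite mulr0.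
  - move=> n x Dx; rewrite /f_ /= lee_fin.
    have h0x := h0 x Dx; case: (n%:R < k x)%R; rewrite /= ?mulr1 ?mulr0 ?normr0//.
    by rewrite ger0_norm.
move: cv; rewrite integral0 => /fine_cvgP[_ /cvgrPdist_lt/(_ e e0)[n _ Hn]].
exists n; have := Hn n (leqnn n); rewrite /= sub0r normrN => h1.
by apply: ltW; exact: le_lt_trans (ler_norm _) h1.
Qed.

Lemma int_expR (lam t : R) : 0 < lam -> a <= t ->
  \int[mu]_(x in `[a, t]) expR (lam * (x - a)) = (expR (lam * (t - a)) - 1) / lam.
Proof.
move=> l0; rewrite le_eqVlt => /predU1P[<-|at_].
  by rewrite set_itv1 Rintegral_set1 subrr mulr0 expR0 subrr mul0r.
have dF (x : R) : is_derive x 1 (fun y => expR (lam * (y - a)) * lam^-1) (expR (lam * (x - a))).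
  apply: is_derive_eq.
  by rewrite /GRing.scale/= mulr0 add0r subr0 mulr1; field; rewrite gt_eqF.
have cF : continuous (fun y : R => expR (lam * (y - a)) * lam^-1).
  by move=> x; apply: differentiable_continuous; apply/derivable1_diffP; case: (dF x).
have cf : continuous (fun y : R => expR (lam * (y - a))).
  move=> x; apply: continuous_comp; last exact: continuous_expR.
  by apply: cvgM; [exact: cvg_cst|apply: cvgB; [exact: cvg_id|exact: cvg_cst]].
rewrite /Rintegral (@continuous_FTC2 _ _ (fun y => expR (lam * (y - a)) * lam^-1) _ _ at_).
- by rewrite -EFinB /= subrr mulr0 expR0 mulrBl.
- exact: continuous_subspaceT.
- split.
  + by move=> x _; case: (dF x).
  + exact/cvg_at_right_filter/cF.
  + exact/cvg_at_left_filter/cF.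
- by move=> x _; rewrite derive1E; apply: derive_val; exact: dF.
Qed.

Lemma expR_weight_cont (lam : R) : continuous (fun y : R => expR (lam * (y - a))).
Proof.
move=> x; apply: continuous_comp; last exact: continuous_expR.
by apply: cvgM; [exact: cvg_cst|apply: cvgB; [exact: cvg_id|exact: cvg_cst]].
Qed.

(* The weight makes Volterra operators with an integrable kernel contractive:
   the unbounded part of the kernel has small integral and the rest is
   dominated by the exponential growth. *)
Lemma volterra_weight (al : R -> R) (ka : R) : 0 < ka -> (forall x, D x -> 0 <= al x) ->
  mu.-integrable D (EFin \o al) ->
  exists w : R -> R, [/\ measurable_fun D w, (forall t, D t -> 1 <= w t <= w b) &
    forall t, a <= t <= b -> \int[mu]_(x in `[a, t]) (al x * w x) <= ka * w t].
Proof.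
move=> ka0 al0 ial.
have mal : measurable_fun D al by apply/measurable_EFinP; case/integrableP: ial.
have ka20 : 0 < ka / 2 by rewrite divr_gt0.
have [N HN] := integrable_tail al0 ial mal ka20.
(* With this exponent the part of [al] below [N] contributes at most N / lam, hence ka / 2, times
   [w t]; the tail of [al] contributes the other half. *)
pose lam := 2 * N.+1%:R / ka.
have lam0 : 0 < lam by rewrite divr_gt0// mulr_gt0// ltr0n.
pose w t := expR (lam * (t - a)).
have mw : measurable_fun D w.
  apply: measurable_funTS; apply: continuous_measurable_fun; exact: expR_weight_cont.
have wm s t : s <= t -> w s <= w t.
  by move=> st; rewrite ler_expR ler_pM2l// lerD2r.
exists w; split => //.
  move=> t /=; rewrite in_itv /= => /andP[at_ tb]; rewrite wm// andbT.
  by rewrite -expR0 ler_expR mulr_ge0 ?subr_ge0// ltW.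
move=> t /andP[at_ tb].
pose tail x := al x * (N%:R < al x)%R%:R.
have mt : measurable (`[a, t]%classic : set R) by exact: measurable_itv.
have wt0 x : 0 <= w x by exact: expR_ge0.
have tail0 x : D x -> 0 <= tail x by move=> Dx; rewrite mulr_ge0 ?al0.
have itail : mu.-integrable D (EFin \o tail).
  apply: (integrable_MR (M := 1) _ ial) => //; last by move=> x _; case: (_ < _)%R; rewrite ?normr1 ?normr0.
  rewrite (_ : (fun x => _) = fun x => if N%:R < al x then 1 else 0).
    by apply: measurable_fun_if => //; exact: measurable_fun_ltr.
  by apply/funext => x; case: ifP.
have iw : mu.-integrable `[a, t] (EFin \o w).
  apply: (@integrable_at _ a b) => //.
  rewrite (_ : EFin \o w = EFin \o (fun x => 1 * w x)).
    apply: (integrable_MR (M := w b) _ (integrable_cst_itv _ _ _ _ _)) => //.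
    by move=> x; rewrite /= in_itv /= => /andP[_ xb]; rewrite ger0_norm// wm.
  by apply/funext => x /=; rewrite mul1r.
have ialw : mu.-integrable `[a, t] (EFin \o (fun x => al x * w x)).
  apply: (@integrable_at _ a b) => //; apply: (integrable_MR (M := w b)) => //.
  by move=> x; rewrite /= in_itv /= => /andP[_ xb]; rewrite ger0_norm// wm.
have itailt : mu.-integrable `[a, t] (EFin \o tail) by exact: (@integrable_at _ a b).
have tail_le : \int[mu]_(x in `[a, t]) tail x <= ka / 2.
  apply: le_trans HN; rewrite -subr_ge0 (rJB itail)// ?lexx//.
  apply: Rintegral_ge0 => x /(sub_st at_ (lexx b)); exact: tail0.
apply: (@le_trans _ _ (\int[mu]_(x in `[a, t]) (N%:R * w x + w t * tail x))).
  apply: le_Rintegral => //; first by apply: rintD => //; exact: rintZ.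
  move=> x xat; have Dx : D x by apply: sub_at xat.
  have xt : x <= t by move: xat; rewrite /= in_itv /= => /andP[].
  have alx := al0 x Dx; rewrite /tail; case: ltP => h; rewrite ?mulr1 ?mulr0 ?addr0.
    have : al x * w x <= w t * al x by rewrite mulrC ler_wpM2r// wm.
    by have := mulr_ge0 (ler0n R N) (wt0 x); lra.
  by rewrite ler_wpM2r.
rewrite RintegralD//; [|exact: rintZ..].
rewrite !RintegralZl// int_expR// -/(w t).
have w1 := wt0 t.
have : w t * \int[mu]_(x in `[a, t]) tail x <= w t * (ka / 2) by rewrite ler_wpM2l.
have : N%:R * ((w t - 1) / lam) <= ka / 2 * w t.
  rewrite /lam !invfM invrK.
  have N0 : 0 < N.+1%:R :> R by rewrite ltr0n.
  have -> : N%:R * ((w t - 1) * (2^-1 * N.+1%:R^-1 * ka)) =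
     (N%:R / N.+1%:R) * (ka / 2 * (w t - 1)) by rewrite [2^-1 * _]mulrC; ring.
  have N1 : N%:R / N.+1%:R <= 1 :> R by rewrite ler_pdivrMr// mul1r ler_nat.
  have N2 : 0 <= N%:R / N.+1%:R :> R by rewrite divr_ge0.
  have h3 : ka / 2 * (w t - 1) <= ka / 2 * w t by rewrite ler_pM2l//; lra.
  have [h|h] := leP 0 (w t - 1).
    apply: le_trans h3; rewrite ler_piMl// mulr_ge0// ltW//.
  apply: (@le_trans _ _ 0); last by rewrite mulr_ge0// ltW.
  by apply: mulr_ge0_le0 => //; rewrite pmulr_rle0// ltW.
by lra.
Qed.

Lemma V_le_int (be : R -> R) f t : MLp 1 f -> mu.-integrable D (EFin \o be) ->
  (forall x, a <= x <= b -> normc (f x) <= be x) -> a <= t <= b ->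
  V f t <= \int[mu]_(x in `[a, t]) be x.
Proof.
move=> f1 ibe fbe /andP[at_ tb].
apply: le_Rintegral; first exact: measurable_itv.
- by apply: (@integrable_at _ a b) => //; exact: L1_normc.
- exact: (@integrable_at _ a b).
- by move=> x /(sub_at tb); rewrite /= in_itv; exact: fbe.
Qed.

Definition bounded_meas (T : Type) (u : T -> R -> R[i]) :=
  forall i, cmeas (u i) /\ exists M, forall t, a <= t <= b -> normc (u i t) <= M.

(** One step of a Volterra iteration in the norm weighted by [w]: the bound [d] turns into
    [2 * d * ka], the factor 2 being that of [J_normc]. *)
Lemma J_kernel (al w : R -> R) (ka : R) (h : R -> R[i]) (d t : R) :
  measurable_fun D w -> (forall t, D t -> 1 <= w t <= w b) ->
  mu.-integrable D (EFin \o al) -> (forall x, D x -> 0 <= al x) ->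
  (forall t, a <= t <= b -> \int[mu]_(x in `[a, t]) (al x * w x) <= ka * w t) ->
  MLp 1 h -> 0 <= d -> (forall x, a <= x <= b -> normc (h x) <= d * (al x * w x)) ->
  a <= t <= b -> normc (J h t) <= 2 * d * ka * w t.
Proof.
move=> mw wb ial al0 wV h1 d0 hb /[dup] tab /andP[at_ tb].
have ialw : mu.-integrable D (EFin \o (fun x => al x * w x)).
  apply: (integrable_MR (M := w b)) => // x /wb /andP[w1 wwb].
  by rewrite ger0_norm// (le_trans _ w1).
apply: (le_trans (J_normc h1 at_ tb)); rewrite -!mulrA ler_wpM2l//.
apply: (le_trans (V_le_int h1 (rintZ d mD ialw) hb tab)).
rewrite RintegralZl//; first by rewrite ler_wpM2l// wV.
exact: (@integrable_at _ a b).
Qed.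

Section PicardIteration.
Context (T : finType) (G : T -> R -> (T -> R[i]) -> R[i]) (al : R -> R).
Context (al0 : forall x, D x -> 0 <= al x) (ial : mu.-integrable D (EFin \o al)).
Context (lipG : forall tau t x y, a <= t <= b ->
  normc (G tau t x - G tau t y) <= al t * \sum_s normc (x s - y s)).
Context (intG : forall u : T -> R -> R[i], bounded_meas u ->
  forall tau, MLp 1 (fun t => G tau t (fun s => u s t))).

(** Banach's fixed point argument: in the weighted norm the Picard map halves distances, so its
    iterates starting from 0 converge geometrically. *)
Lemma picard (eta : T -> R[i]) : exists2 u : T -> R -> R[i], bounded_meas u &
  forall tau t, a <= t <= b -> u tau t = eta tau + J (fun s => G tau s (fun i => u i s)) t.
Proof.
(* [J] costs a factor 2 and the sum over the components a factor below [c]; the kernel constant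
   [(4 * c)^-1] therefore yields a contraction by 1/2. *)
pose c : R := #|T|.+1%:R.
have c0 : 0 < c by rewrite ltr0n.
have ka0 : 0 < (4 * c)^-1 by rewrite invr_gt0 mulr_gt0.
have [w [mw wb wV]] := volterra_weight ka0 al0 ial.
have wt t : a <= t <= b -> 1 <= w t <= w b by move=> tab; apply: wb; rewrite /= in_itv.
have wbb : 1 <= w b by have /andP[] := wt b (introT andP (conj (ltW hab) (lexx b))).
pose P (u : T -> R -> R[i]) : T -> R -> R[i] :=
  fun tau t => eta tau + J (fun s => G tau s (fun i => u i s)) t.
have PP u : bounded_meas u -> bounded_meas (P u).
  move=> bu tau; split; first by apply: cmeasD; [exact: cmeas_cst|apply: cmeas_J => //; exact: intG].
  exists (normc (eta tau) + 2 * Ln 1 (fun s => G tau s (fun i => u i s))) => t /andP[at_ tb].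
  by rewrite (le_trans (normc_triangle _ _))// lerD2l (J_bound (intG bu tau)).
have step u v d : bounded_meas u -> bounded_meas v -> 0 <= d ->
    (forall t, a <= t <= b -> \sum_s normc (u s t - v s t) <= d * w t) ->
    forall t, a <= t <= b -> \sum_s normc (P u s t - P v s t) <= d / 2 * w t.
  move=> bu bv d0 uv t /[dup] tab /andP[at_ tb].
  have w0 : 0 <= w t by have /andP[w1 _] := wt t tab; rewrite (le_trans _ w1).
  have H tau : normc (P u tau t - P v tau t) <= 2 * d * (4 * c)^-1 * w t.
    rewrite /P opprD addrACA subrr add0r -(JB (intG bu tau) (intG bv tau) tb).
    have [h1 _] := MLpB (lexx 1) (intG bu tau) (intG bv tau).
    apply: (J_kernel mw wb ial al0 wV h1 d0) => // x xab.
    apply: (le_trans (lipG _ _ _ xab)); rewrite mulrCA ler_wpM2l ?al0 ?uv//.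
  apply: (@le_trans _ _ (\sum_(s : T) 2 * d * (4 * c)^-1 * w t)).
    by apply: ler_sum => s _; exact: H.
  rewrite sumr_const -[X in X <= _]mulr_natr.
  have -> : 2 * d * (4 * c)^-1 * w t * #|T|%:R = (d / 2 * w t) * (#|T|%:R / c).
    by field; rewrite gt_eqF.
  rewrite ler_piMr//; first by rewrite mulr_ge0// divr_ge0.
  by rewrite ler_pdivrMr// mul1r ler_nat.
pose U := fix U j : T -> R -> R[i] := if j is j'.+1 then P (U j') else fun _ _ => 0.
have bU j : bounded_meas (U j).
  elim: j => [|j]; last exact: PP.
  by move=> tau; split; [exact: cmeas_cst|exists 0 => t _; rewrite ComplexField.Normc.normc0].
have [d0 d00 Hd0] : exists2 d0, 0 <= d0 & forall t, a <= t <= b ->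
    \sum_s normc (U 1%N s t - U 0%N s t) <= d0.
  have /choice[M HM] : forall s, exists M, forall t, a <= t <= b -> normc (U 1%N s t) <= M.
    by move=> s; have [] := bU 1%N s.
  exists (\sum_s `|M s|); first exact: sumr_ge0.
  move=> t tab; apply: ler_sum => s _; rewrite subr0 (le_trans (HM s t tab))//.
  exact: ler_norm.
have dj j t : a <= t <= b -> \sum_s normc (U j.+1 s t - U j s t) <= d0 * 2 ^- j * w t.
  elim: j t => [|j IH] t tab.
    rewrite expr0 invr1 mulr1 (le_trans (Hd0 t tab))// ler_peMr//.
    by have /andP[] := wt t tab.
  have -> : d0 * 2 ^- j.+1 = d0 * 2 ^- j / 2 by rewrite exprS invfM mulrA mulrAC.
  by apply: (step _ _ _ (bU j.+1) (bU j) _ IH) => //; rewrite mulr_ge0// invr_ge0 exprn_ge0.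
pose E := d0 * w b.
have E0 : 0 <= E by rewrite mulr_ge0// (le_trans _ wbb).
have dE j tau t : a <= t <= b -> normc (U j.+1 tau t - U j tau t) <= E * 2 ^- j.
  move=> tab; rewrite (@le_trans _ _ (\sum_s normc (U j.+1 s t - U j s t)))//.
    by rewrite (bigD1 tau)//= lerDl sumr_ge0// => s _; exact: normc_ge0.
  rewrite (le_trans (dj j t tab))// /E mulrAC ler_wpM2r ?invr_ge0 ?exprn_ge0//.
  by rewrite ler_wpM2l//; have /andP[] := wt t tab.
(* The limit is taken pointwise on [a, b]; the value 0 elsewhere is a convention. *)
have /choice[u Hu] : forall tau, exists u : R -> R[i], forall t, a <= t <= b ->
    forall j, normc (u t - U j tau t) <= 4 * E * 2 ^- j.
  move=> tau; have /choice[u Hu] : forall t, exists l, a <= t <= b ->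
      forall j, normc (l - U j tau t) <= 4 * E * 2 ^- j.
    move=> t; have [tab|ntab] := boolP (a <= t <= b); last by exists 0.
    have [l Hl] := geometric_limitc (fun j => dE j tau t tab).
    by exists l.
  by exists u.
have cvU tau t : a <= t <= b -> forall (F : R[i] -> R),
    (forall z w, `|F z - F w| <= normc (z - w)) ->
    (fun j => F (U j tau t)) @ \oo --> F (u tau t).
  move=> tab F FL; apply/cvgrPdist_lt => e e0.
  have EE0 : 0 < 4 * E + 1 by rewrite ltr_wpDl// mulr_ge0.
  have [k Hk] := half_pow_small (divr_gt0 e0 EE0).
  exists k => // j /= kj; have := Hk j kj; rewrite ltr_pdivlMr// => h.
  apply: le_lt_trans (FL _ _) _; apply: le_lt_trans (Hu tau t tab j) _.
  apply: le_lt_trans h; rewrite mulrC ler_wpM2l ?invr_ge0 ?exprn_ge0//.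
  by rewrite lerDl.
have bu : bounded_meas u.
  move=> tau; split.
    split.
      apply: (@measurable_fun_cvg _ _ _ _ (fun j t => complex.Re (U j tau t))) => [j|t].
        by have [[]] := bU j tau.
      by rewrite /= in_itv /= => tab; apply: cvU => // z v; rewrite -ReN -ReD Re_le_normc.
    apply: (@measurable_fun_cvg _ _ _ _ (fun j t => complex.Im (U j tau t))) => [j|t].
      by have [[]] := bU j tau.
    by rewrite /= in_itv /= => tab; apply: cvU => // z v; rewrite -ImN -ImD Im_le_normc.
  exists (4 * E) => t tab; have := Hu tau t tab 0%N.
  by rewrite /= subr0 expr0 invr1 mulr1.
exists u => // tau t tab; apply/eqP; rewrite -subr_eq0; apply/eqP.
apply: ComplexField.Normc.eq0_normc.
(* The defect of [u] in the fixed point equation splits into the distance to the iterate j + 1 and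
   the image under [P] of the distance to the iterate j; both are of order 2^-j. *)
apply: (@le_geometric_eq0 _ (4 * E + #|T|%:R * (4 * E) / 2 * w b)) => j.
rewrite ger0_norm ?normc_ge0//.
rewrite -/(P u tau t).
have -> : u tau t - P u tau t = (u tau t - U j.+1 tau t) + (P (U j) tau t - P u tau t).
  by rewrite /= addrA subrK.
have wt0 : 0 <= w b by rewrite (le_trans _ wbb).
have pj i : 0 <= 2 ^- i :> R by rewrite invr_ge0 exprn_ge0.
rewrite (le_trans (normc_triangle _ _))// mulrDl lerD//.
  rewrite (le_trans (Hu tau t tab j.+1))// ler_wpM2l ?mulr_ge0//.
  by rewrite exprS invfM ler_piMl// invf_le1// ler1n.
have K0 : 0 <= #|T|%:R * (4 * E) * 2 ^- j by rewrite !mulr_ge0.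
have := step (U j) u _ (bU j) bu K0 _ t tab.
have H x : a <= x <= b -> \sum_s normc (U j s x - u s x) <= #|T|%:R * (4 * E) * 2 ^- j * w x.
  move=> xab; apply: (@le_trans _ _ (\sum_(s : T) 4 * E * 2 ^- j)).
    by apply: ler_sum => s _; rewrite normcBC; exact: Hu.
  rewrite sumr_const -[X in X <= _]mulr_natl mulrA ler_peMr//.
  by have /andP[] := wt x xab.
move=> /(_ H) h.
rewrite (@le_trans _ _ (\sum_s normc (P (U j) s t - P u s t)))//.
  by rewrite (bigD1 tau)//= lerDl sumr_ge0// => s _; exact: normc_ge0.
rewrite (le_trans h)// -!mulrA [2 ^- j * _]mulrC !mulrA ler_wpM2r//.
rewrite ler_wpM2l ?mulr_ge0//.
by have /andP[] := wt t tab.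
Qed.

End PicardIteration.

(** Proved by iteration: a bound [d * w] improves to [(2 * K + d / 2) * w]. Starting from any bound
    for [u], this leads to the fixed point [4 * K] of the improvement. *)
Lemma gronwall (T : finType) (al : R -> R) : (forall x, D x -> 0 <= al x) ->
  mu.-integrable D (EFin \o al) -> exists2 C, 0 <= C &
  forall (u h F : T -> R -> R[i]) (eta : T -> R[i]), bounded_meas u ->
    (forall tau, MLp 1 (h tau)) -> (forall tau, MLp 1 (F tau)) ->
    (forall tau t, a <= t <= b -> u tau t = eta tau + J (h tau) t) ->
    (forall tau t, a <= t <= b ->
      normc (h tau t - F tau t) <= al t * \sum_s normc (u s t)) ->
    forall t, a <= t <= b ->
      \sum_s normc (u s t) <= C * \sum_s (normc (eta s) + Ln 1 (F s)).
Proof.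
move=> al0 ial.
pose c : R := #|T|.+1%:R.
have c0 : 0 < c by rewrite ltr0n.
have ka0 : 0 < (4 * c)^-1 by rewrite invr_gt0 mulr_gt0.
have [w [mw wb wV]] := volterra_weight ka0 al0 ial.
have wt t : a <= t <= b -> 1 <= w t <= w b by move=> tab; apply: wb; rewrite /= in_itv.
have wbb : 1 <= w b by have /andP[] := wt b (introT andP (conj (ltW hab) (lexx b))).
have wb0 : 0 <= w b by rewrite (le_trans _ wbb).
exists (4 * w b); first by rewrite mulr_ge0.
move=> u h F eta bu h1 F1 uE hF.
set K := \sum_s (normc (eta s) + Ln 1 (F s)).
have K0 : 0 <= K by apply: sumr_ge0 => s _; rewrite addr_ge0 ?normc_ge0 ?Ln_ge0.
have step d : 0 <= d -> (forall t, a <= t <= b -> \sum_s normc (u s t) <= d * w t) ->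
    forall t, a <= t <= b -> \sum_s normc (u s t) <= (2 * K + d / 2) * w t.
  move=> d0 ud t /[dup] tab /andP[at_ tb].
  have /andP[w1 _] := wt t tab.
  have w0 : 0 <= w t by rewrite (le_trans _ w1).
  have H tau : normc (u tau t) <= 2 * (normc (eta tau) + Ln 1 (F tau)) + 2 * d * (4 * c)^-1 * w t.
    rewrite uE//; have -> : J (h tau) t = J (F tau) t + J (fun x => h tau x - F tau x) t.
      by rewrite (JB (h1 tau) (F1 tau) tb) addrC subrK.
    have [hF1 _] := MLpB (lexx 1) (h1 tau) (F1 tau).
    rewrite addrA (le_trans (normc_triangle _ _))// lerD//.
      rewrite (le_trans (normc_triangle _ _))// mulrDr lerD//.
        by rewrite ler_peMl ?normc_ge0// ler1n.
      exact: (J_bound (F1 tau)).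
    apply: (J_kernel mw wb ial al0 wV hF1 d0) => // x xab.
    apply: (le_trans (hF _ _ xab)); rewrite mulrCA ler_wpM2l ?al0 ?ud//.
  apply: (@le_trans _ _ (\sum_(s : T) (2 * (normc (eta s) + Ln 1 (F s)) + 2 * d * (4 * c)^-1 * w t))).
    by apply: ler_sum => s _; exact: H.
  have -> : \sum_(s : T) (2 * (normc (eta s) + Ln 1 (F s)) + 2 * d * (4 * c)^-1 * w t) =
      2 * K + 2 * d * (4 * c)^-1 * w t * #|T|%:R.
    rewrite big_split /= -mulr_sumr; congr (_ + _).
    by rewrite sumr_const -[LHS]mulr_natr.
  rewrite [leRHS]mulrDl lerD//; first by rewrite ler_peMr// mulr_ge0.
  have -> : 2 * d * (4 * c)^-1 * w t * #|T|%:R = (d / 2 * w t) * (#|T|%:R / c).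
    by field; rewrite gt_eqF.
  rewrite ler_piMr//; first by rewrite mulr_ge0// divr_ge0.
  by rewrite ler_pdivrMr// mul1r ler_nat.
have [B B0 HB] : exists2 B, 0 <= B & forall t, a <= t <= b -> \sum_s normc (u s t) <= B.
  have /choice[M HM] : forall s, exists M, forall t, a <= t <= b -> normc (u s t) <= M.
    by move=> s; have [] := bu s.
  exists (\sum_s `|M s|); first exact: sumr_ge0.
  move=> t tab; apply: ler_sum => s _; rewrite (le_trans (HM s t tab))//.
  exact: ler_norm.
have iter j t : a <= t <= b -> \sum_s normc (u s t) <= (4 * K + B * 2 ^- j) * w t.
  elim: j t => [|j IH] t tab.
    have /andP[w1 _] := wt t tab.
    rewrite expr0 invr1 mulr1 (le_trans (HB t tab))// (@le_trans _ _ (B * w t))//.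
      by rewrite ler_peMr.
    by rewrite ler_wpM2r ?(le_trans _ w1)// lerDr mulr_ge0.
  have -> : 4 * K + B * 2 ^- j.+1 = 2 * K + (4 * K + B * 2 ^- j) / 2.
    by rewrite exprS invfM; field.
  by apply: step => //; rewrite addr_ge0 ?mulr_ge0 ?invr_ge0 ?exprn_ge0.
move=> t tab; apply/ler_addgt0Pr => e e0.
have B1 : 0 < B * w b + 1 by rewrite ltr_wpDl// mulr_ge0.
have [k Hk] := half_pow_small (divr_gt0 e0 B1).
have := Hk k (leqnn k); rewrite ltr_pdivlMr// => hk.
rewrite (le_trans (iter k t tab))//.
have /andP[w1 w2] := wt t tab.
have pk : 0 <= 2 ^- k :> R by rewrite invr_ge0 exprn_ge0.
apply: (@le_trans _ _ ((4 * K + B * 2 ^- k) * w b)).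
  by rewrite ler_wpM2l// addr_ge0 ?mulr_ge0.
have : 2 ^- k * (B * w b) <= 2 ^- k * (B * w b + 1) by rewrite ler_wpM2l// lerDl.
by lra.
Qed.

End Picard.

(** * Systems with L_p coefficients and abstract boundary conditions *)

Section SobolevEmbedding.
Context {R : realType} (a b p : R).
Context (hab : a < b) (hp : 1 <= p).
Local Notation mu := (@lebesgue_measure R).
Local Notation D := (`[a, b]%classic : set R).
Local Notation Ln := (Ln a b).
Local Notation J := (J a).
Local Notation jet := (jet a b p).

Definition jnorm k (Y : nat -> R -> R[i]) := \sum_(s < k.+1) Ln p (Y s).

Lemma jnorm_ge0 k Y : 0 <= jnorm k Y.
Proof. by apply: sumr_ge0 => s _; exact: Ln_ge0. Qed.

Lemma Ln_jnorm k Y s : (s <= k)%N -> Ln p (Y s) <= jnorm k Y.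
Proof.
move=> sk; rewrite /jnorm (bigD1 (Ordinal (sk : (s < k.+1)%N)))//= lerDl.
by apply: sumr_ge0 => i _; exact: Ln_ge0.
Qed.

Lemma jnormD k Y Z : jet k Y -> jet k Z ->
  jnorm k (fun s t => Y s t + Z s t) <= jnorm k Y + jnorm k Z.
Proof.
move=> jY jZ; rewrite /jnorm -big_split /=; apply: ler_sum => s _.
by have [] := MLpD hp (jet_MLp hab hp jY (ltn_ord s)) (jet_MLp hab hp jZ (ltn_ord s)).
Qed.

(** Sobolev embedding in dimension one: [Y s a] is compared with [Y s x], the comparison is averaged
    over x in [a, b], and [Y s t] is reached from [Y s a]. One constant serves all [k] and [Y]. *)
Lemma jet_sup : exists2 C : R, 0 <= C & forall k Y s t, jet k Y -> (s < k)%N ->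
  a <= t <= b -> normc (Y s t) <= C * (Ln p (Y s) + Ln p (Y s.+1)).
Proof.
have [C C0 HC] := MLp_L1 hab hp.
have ba : 0 < b - a by rewrite subr_gt0.
exists ((b - a)^-1 * C + 4 * C).
  by rewrite addr_ge0// mulr_ge0// invr_ge0 ltW.
move=> k Y s t jY sk /[dup] tab /andP[at_ tb].
have [Ys1 Ys] := HC _ (jet_MLp hab hp jY (ltnW sk)).
have [Yt1 Yt] := HC _ (jet_MLp hab hp jY sk).
have key x : a <= x <= b -> normc (Y s a) <= normc (Y s x) + 2 * Ln 1 (Y s.+1).
  move=> /[dup] xab /andP[ax xb].
  have -> : Y s a = Y s x - J (Y s.+1) x by rewrite (jet_eqJ jY sk xab) addrK.
  by rewrite (le_trans (normcB _ _))// lerD2l (J_bound Yt1).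
have Ha : normc (Y s a) <= (b - a)^-1 * Ln 1 (Y s) + 2 * Ln 1 (Y s.+1).
  rewrite -lerBlDr [_^-1 * _]mulrC ler_pdivlMr// [leRHS]Ln1E.
  have lm : fine (mu D) = b - a.
    by have := lebesgue_measure_itv (`[a, b] : interval R); rewrite /= lte_fin hab => ->.
  rewrite -[b - a]lm -Rintegral_cst; last exact: measurable_itv.
  apply: le_Rintegral; first exact: measurable_itv.
  - exact: integrable_cst_itv.
  - exact: L1_normc.
  - by move=> x; rewrite /= in_itv /= => xab; rewrite lerBlDr; exact: key.
rewrite (jet_eqJ jY sk tab) (le_trans (normc_triangle _ _))//.
have HJ : normc (J (Y s.+1) t) <= 2 * Ln 1 (Y s.+1) by exact: (J_bound Yt1).
have L1 := Ln_ge0 a b p (Y s); have L2 := Ln_ge0 a b p (Y s.+1).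
have h1 : (b - a)^-1 * Ln 1 (Y s) <= (b - a)^-1 * (C * Ln p (Y s)).
  by rewrite ler_wpM2l// invr_ge0 ltW.
have h2 : 0 <= (b - a)^-1 * (C * Ln p (Y s.+1)) by rewrite !mulr_ge0// invr_ge0 ltW.
have h3 : 0 <= C * Ln p (Y s) by rewrite mulr_ge0.
rewrite mulrDr !mulrDl -!mulrA; lra.
Qed.

Lemma jet_sup_jnorm : exists2 C : R, 0 <= C & forall k Y s t, jet k Y -> (s < k)%N ->
  a <= t <= b -> normc (Y s t) <= C * jnorm k Y.
Proof.
have [C C0 HC] := jet_sup; exists (C * 2); first by rewrite mulr_ge0.
move=> k Y s t jY sk tab; rewrite (le_trans (HC k Y s t jY sk tab))// -mulrA ler_wpM2l//.
by rewrite mulr_natl mulr2n lerD// Ln_jnorm// ltnW.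
Qed.

End SobolevEmbedding.

Section Core.
Context {R : realType} (a b p : R).
Context (hab : a < b) (hp : 1 <= p).
Local Notation mu := (@lebesgue_measure R).
Local Notation D := (`[a, b]%classic : set R).
Local Notation MLp := (MLp a b).
Local Notation Ln := (Ln a b).
Local Notation J := (J a).
Local Notation jet := (jet a b p).
Local Notation jnorm := (jnorm a b p).

Let p0 : 0 < p. Proof. by rewrite (lt_le_trans _ hp). Qed.

Context (m K : nat) (I : finType) (lI : I -> 'I_m) (sI : I -> nat).
Context (hsI : forall i, (sI i < K)%N).

(* [Y i s] is the s-th derivative of the i-th component. A term [ka : I] of the
   system multiplies the derivative of order [sI ka] < K of the component [lI ka]. *)
Definition fam := 'I_m -> nat -> R -> R[i].
Definition coefs := 'I_m -> I -> R -> R[i].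
Implicit Types (Y Z : fam) (c : coefs).

Definition inX Y := forall i, jet K (Y i).
Definition addX Y Z : fam := fun i s t => Y i s t + Z i s t.
Definition subX Y Z : fam := fun i s t => Y i s t - Z i s t.
Definition scaleX (z : R[i]) Y : fam := fun i s t => z * Y i s t.
Definition sumX (T : finType) (z : T -> R[i]) (Y : T -> fam) : fam :=
  fun i s t => \sum_tau z tau * Y tau i s t.

Definition cop c Y : 'I_m -> R -> R[i] :=
  fun i t => Y i K t + \sum_ka c i ka t * Y (lI ka) (sI ka) t.

Definition fnorm Y := \sum_i jnorm K (Y i).
Definition cLp c := forall i ka, MLp p (c i ka).
Definition cdist c c' := \sum_i \sum_ka Ln p (fun t => c i ka t - c' i ka t).
Definition data Y := \sum_(tau : 'I_m * 'I_K) normc (Y tau.1 tau.2 a).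

Lemma fnorm_ge0 Y : 0 <= fnorm Y.
Proof. by apply: sumr_ge0 => i _; exact: jnorm_ge0. Qed.

Lemma inXD Y Z : inX Y -> inX Z -> inX (addX Y Z).
Proof. by move=> hY hZ i; exact: jetD. Qed.
Lemma inXB Y Z : inX Y -> inX Z -> inX (subX Y Z).
Proof. by move=> hY hZ i; exact: jetB. Qed.
Lemma inXZ z Y : inX Y -> inX (scaleX z Y).
Proof. by move=> hY i; exact: jetZ. Qed.
Lemma inX_sum (T : finType) z (Y : T -> fam) : (forall tau, inX (Y tau)) -> inX (sumX z Y).
Proof. by move=> hY i; apply: jet_sum => // tau; apply: jetZ => //; exact: hY. Qed.

Lemma subXE Y Z : subX Y Z = addX Y (scaleX (-1) Z).
Proof. by do 3 apply/funext => ?; rewrite /subX /addX /scaleX mulN1r. Qed.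

Lemma fam_sup : exists2 C : R, 0 <= C & forall Y i s t, inX Y -> (s < K)%N ->
  a <= t <= b -> normc (Y i s t) <= C * fnorm Y.
Proof.
have [C C0 HC] := jet_sup_jnorm hab hp; exists C => // Y i s t hY sK tab.
rewrite (le_trans (HC _ _ _ _ (hY i) sK tab))// ler_wpM2l//.
rewrite /fnorm (bigD1 i)//= lerDl; apply: sumr_ge0 => j _; exact: jnorm_ge0.
Qed.

Lemma cmul_MLp (f : R -> R[i]) Y i s : MLp p f -> inX Y -> (s < K)%N ->
  MLp p (fun t => f t * Y i s t).
Proof.
move=> fp hY sK; have [mY [M HM] _] := jet_nice hab hp (hY i) sK.
have HM' t : D t -> normc (Y i s t) <= M by rewrite /= in_itv; exact: HM.
have [h _] := MLpM_bounded hab hp mY HM' fp.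
by apply: MLp_eq h => // t _; rewrite mulrC.
Qed.

Lemma cmul_Ln : exists2 C : R, 0 <= C & forall (f : R -> R[i]) Y i s, MLp p f -> inX Y ->
  (s < K)%N -> Ln p (fun t => f t * Y i s t) <= C * fnorm Y * Ln p f.
Proof.
have [C C0 HC] := fam_sup; exists C => // f Y i s fp hY sK.
have [mY _ _] := jet_nice hab hp (hY i) sK.
have HM' t : D t -> normc (Y i s t) <= C * fnorm Y by rewrite /= in_itv; exact: HC.
have [_ h] := MLpM_bounded hab hp mY HM' fp.
by rewrite (le_trans _ h)//; under eq_fun do rewrite mulrC.
Qed.

Lemma cop_MLp c Y i : cLp c -> inX Y -> MLp p (cop c Y i).
Proof.
move=> hc hY.
have hK : MLp p (Y i K) by apply: (jet_MLp hab hp (hY i)).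
have hm ka : MLp p (fun t => c i ka t * Y (lI ka) (sI ka) t).
  by apply: cmul_MLp => //; exact: hsI.
have [hs _] := MLp_sum hab hp (index_enum I) hm.
by have [] := MLpD hp hK hs.
Qed.

Lemma cop_diff : exists2 C : R, 0 <= C & forall c c' Y i, cLp c -> cLp c' -> inX Y ->
  Ln p (fun t => cop c Y i t - cop c' Y i t) <= C * fnorm Y * cdist c c'.
Proof.
have [C C0 HC] := cmul_Ln; exists C => // c c' Y i hc hc' hY.
have hd ka : MLp p (fun t => c i ka t - c' i ka t).
  by have [] := MLpB hp (hc i ka) (hc' i ka).
have -> : (fun t => cop c Y i t - cop c' Y i t) =
    (fun t => \sum_ka (c i ka t - c' i ka t) * Y (lI ka) (sI ka) t).
  apply/funext => t; rewrite /cop opprD addrACA subrr add0r -sumrB.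
  by apply: eq_bigr => ka _; rewrite mulrBl.
have [|_ h] := MLp_sum hab hp (index_enum I)
  (F := fun ka t => (c i ka t - c' i ka t) * Y (lI ka) (sI ka) t).
  by move=> ka; apply: cmul_MLp => //; exact: hsI.
rewrite (le_trans h)// /cdist (bigD1 i)//= mulrDr mulr_sumr.
rewrite -[leLHS]addr0 lerD//; first by apply: ler_sum => ka _; exact: HC.
apply: mulr_ge0; first by rewrite mulr_ge0// fnorm_ge0.
by apply: sumr_ge0 => j _; apply: sumr_ge0 => ka _; exact: Ln_ge0.
Qed.

(** A Lipschitz constant at time [t] for all rows of the first-order system: the summand 1 serves
    the rows that merely name the next derivative, the sum those that contain coefficients. *)
Definition alpha_of c t := 1 + \sum_i \sum_ka normc (c i ka t).

Lemma alpha_ge0 c t : 0 <= alpha_of c t.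
Proof.
by rewrite addr_ge0//; apply: sumr_ge0 => i _; apply: sumr_ge0 => ka _; exact: normc_ge0.
Qed.

Lemma integrable_rsum (T : finType) (F : T -> R -> R) :
  (forall i, mu.-integrable D (EFin \o F i)) ->
  mu.-integrable D (EFin \o (fun t => \sum_i F i t)).
Proof.
move=> hF; elim: (index_enum T) => [|x s IH].
  rewrite (_ : (fun t => _) = fun=> 0); first exact: integrable_cst_itv.
  by apply/funext => t; rewrite big_nil.
rewrite (_ : (fun t => _) = fun t => F x t + \sum_(i <- s) F i t).
  by apply: rintD; first exact: measurable_itv.
by apply/funext => t; rewrite big_cons.
Qed.

Lemma alpha_int c : cLp c -> mu.-integrable D (EFin \o alpha_of c).
Proof.
move=> hc; apply: rintD; [exact: measurable_itv|exact: integrable_cst_itv|].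
apply: integrable_rsum => i; apply: integrable_rsum => ka.
by apply: L1_normc; exact: (L1_Lp hab hp (hc i ka)).
Qed.

Lemma normc_sumM_le (T : finType) (x y : T -> R[i]) (S : R) :
  (forall i, normc (y i) <= S) ->
  normc (\sum_i x i * y i) <= (\sum_i normc (x i)) * S.
Proof.
move=> yS; rewrite (le_trans (normc_sum _ _ _))// mulr_suml; apply: ler_sum => i _.
by rewrite normcM ler_wpM2l ?normc_ge0.
Qed.

Lemma ler_sum_mem (T : finType) (F : T -> R) i : (forall j, 0 <= F j) -> F i <= \sum_j F j.
Proof. by move=> F0; rewrite (bigD1 i)//= lerDl; apply: sumr_ge0. Qed.

Lemma cof_le_alpha c i t : \sum_ka normc (c i ka t) <= alpha_of c t.
Proof.
rewrite (@le_trans _ _ (\sum_i \sum_ka normc (c i ka t)))//; last by rewrite /alpha_of lerDr.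
apply: (@ler_sum_mem _ (fun i => \sum_ka normc (c i ka t))) => j.
by apply: sumr_ge0 => ka _; exact: normc_ge0.
Qed.

Lemma alpha_ge1 c t : 1 <= alpha_of c t.
Proof.
by rewrite lerDl; apply: sumr_ge0 => i _; apply: sumr_ge0 => ka _; exact: normc_ge0.
Qed.

Local Notation T := ('I_m * 'I_K)%type.
Definition low (ka : I) : T := (lI ka, Ordinal (hsI ka)).

(* The derivative of order s <= K of the i-th component in terms of the state [x]
   of the first-order system equivalent to [cop c Y = f]. *)
Definition ext c (f : 'I_m -> R -> R[i]) i s t (x : T -> R[i]) : R[i] :=
  if insub s is Some s' then x (i, s') else f i t - \sum_ka c i ka t * x (low ka).

(** Picard's theorem for the first-order system whose unknowns are the derivatives of order below
    [K]. The right-hand side of row (i, s) is [ext] at order s + 1: the next unknown or, if s + 1 =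
    K, what the equation prescribes. *)
Lemma core_exists c (f : 'I_m -> R -> R[i]) (eta : 'I_m -> nat -> R[i]) :
  cLp c -> (forall i, MLp p (f i)) ->
  exists2 Y, inX Y & (forall i s, (s < K)%N -> Y i s a = eta i s) /\
    (forall i t, a <= t <= b -> cop c Y i t = f i t).
Proof.
move=> hc hf.
pose G (tau : T) t x := ext c f tau.1 tau.2.+1 t x.
have lipG tau t x y : a <= t <= b ->
    normc (G tau t x - G tau t y) <= alpha_of c t * \sum_s normc (x s - y s).
  move=> _; rewrite /G /ext.
  have S0 : 0 <= \sum_s normc (x s - y s) by apply: sumr_ge0 => s _; exact: normc_ge0.
  have xS s : normc (x s - y s) <= \sum_s normc (x s - y s).
    by apply: (@ler_sum_mem _ (fun s => normc (x s - y s))) => j; exact: normc_ge0.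
  case: insubP => [s' _ _|_].
    by rewrite (le_trans (xS _))// ler_peMl// alpha_ge1.
  rewrite opprD addrACA subrr add0r opprK addrC -sumrB.
  under eq_bigr do rewrite -mulrBr.
  apply: (le_trans (@normc_sumM_le _ _ _ _ _)).
    by move=> ka; rewrite normcBC; exact: xS.
  by rewrite ler_wpM2r// cof_le_alpha.
have intG0 u : bounded_meas a b u -> forall i s, MLp p (fun t => ext c f i s t (fun s => u s t)).
  move=> bu i s; rewrite /ext; case: insubP => [s' _ _|_].
    have [mu_ [M uM]] := bu (i, s').
    by have [|] := MLp_bounded hab hp mu_ (M := M) => // t; rewrite /= in_itv; exact: uM.
  have h ka : MLp p (fun t => c i ka t * u (low ka) t).
    have [mu_ [M uM]] := bu (low ka).
    have uM' t : D t -> normc (u (low ka) t) <= M by rewrite /= in_itv; exact: uM.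
    have [h _] := MLpM_bounded hab hp mu_ uM' (hc i ka).
    by apply: MLp_eq h => // t _; rewrite mulrC.
  have [hs _] := MLp_sum hab hp (index_enum I) h.
  by have [] := MLpB hp (hf i) hs.
have intG u : bounded_meas a b u -> forall tau, MLp 1 (fun t => G tau t (fun s => u s t)).
  by move=> bu tau; apply: (L1_Lp hab hp); exact: intG0.
have [u bu uE] := picard hab (fun x _ => alpha_ge0 c x) (alpha_int hc) lipG intG
   (fun tau => eta tau.1 tau.2).
pose Y : fam := fun i s t => ext c f i s t (fun s => u s t).
have Ylt i s (sK : (s < K)%N) t : Y i s t = u (i, Ordinal sK) t.
  by rewrite /Y /ext insubT.
have YE i s (sK : (s < K)%N) t : a <= t <= b -> Y i s t = eta i s + J (Y i s.+1) t.
  by move=> tab; rewrite Ylt uE.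
have aab : a <= a <= b by rewrite lexx ltW.
have Ya i s : (s < K)%N -> Y i s a = eta i s.
  by move=> sK; rewrite YE// J_a addr0.
exists Y.
  move=> i; split; last exact: intG0.
  by move=> s sK t tab; rewrite Ya// YE.
split=> // i t tab; rewrite /cop {1}/Y {1}/ext insubF ?ltnn//.
rewrite [X in _ - X](eq_bigr (fun ka => c i ka t * Y (lI ka) (sI ka) t)) ?subrK//.
by move=> ka _; rewrite (Ylt _ _ (hsI ka)).
Qed.

Lemma Ln0 q : 1 <= q -> Ln q (fun=> 0 : R[i]) = 0.
Proof.
move=> q1; have [_] := MLpZ q1 0 (MLp_cst hab q1 0).
by under eq_fun do rewrite mul0r; rewrite ComplexField.Normc.normc0 mul0r.
Qed.

Lemma jet_bounded_meas Y : inX Y -> bounded_meas a b (fun (tau : T) => Y tau.1 tau.2).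
Proof. by move=> hY tau; have [] := jet_nice hab hp (hY tau.1) (ltn_ord tau.2). Qed.

Lemma copE c Y i t : Y i K t - cop c Y i t = - \sum_ka c i ka t * Y (lI ka) (sI ka) t.
Proof. by rewrite /cop opprD addrA subrr add0r. Qed.

(** Gronwall's inequality for the first-order system; the inhomogeneity [F] is [cop c Y] in the rows
    of top order and 0 in the others. *)
Lemma core_sup c : cLp c -> exists2 C : R, 0 <= C & forall Y, inX Y ->
  forall i s t, (s < K)%N -> a <= t <= b ->
  normc (Y i s t) <= C * (data Y + \sum_i Ln p (cop c Y i)).
Proof.
move=> hc.
have [C1 C10 HC1] := MLp_L1 hab hp.
have [C C0 HC] := gronwall hab T (fun x _ => alpha_ge0 c x) (alpha_int hc).
exists (C * (1 + K%:R * C1)); first by rewrite mulr_ge0// addr_ge0// mulr_ge0.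
move=> Y hY i s t sK tab.
have cY j := cop_MLp j hc hY.
pose F (tau : T) := if (tau.2.+1 < K)%N then fun=> 0 else cop c Y tau.1.
have F1 tau : MLp 1 (F tau).
  by rewrite /F; case: ifP => _; [exact: MLp_cst|exact: (L1_Lp hab hp)].
have FL tau : Ln 1 (F tau) <= C1 * Ln p (cop c Y tau.1).
  rewrite /F; case: ifP => _; last by have [] := HC1 _ (cY tau.1).
  by rewrite (Ln0 (lexx 1)) mulr_ge0// Ln_ge0.
have uE (tau : T) x : a <= x <= b -> Y tau.1 tau.2 x = Y tau.1 tau.2 a + J (Y tau.1 tau.2.+1) x.
  exact: jet_eqJ (hY tau.1) (ltn_ord tau.2).
have hF (tau : T) x : a <= x <= b -> normc (Y tau.1 tau.2.+1 x - F tau x) <=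
    alpha_of c x * \sum_(s : T) normc (Y s.1 s.2 x).
  move=> xab.
  have S0 : 0 <= \sum_(s : T) normc (Y s.1 s.2 x) by apply: sumr_ge0 => j _; exact: normc_ge0.
  have mem (s' : T) : normc (Y s'.1 s'.2 x) <= \sum_(s : T) normc (Y s.1 s.2 x).
    by apply: (@ler_sum_mem _ (fun s : T => normc (Y s.1 s.2 x))) => j; exact: normc_ge0.
  rewrite /F; case: ifPn => [lt|]; first rewrite subr0.
    by rewrite (le_trans (mem (tau.1, Ordinal lt)))// ler_peMl// alpha_ge1.
  rewrite -leqNgt => ge; have -> : tau.2.+1 = K by apply/eqP; rewrite eqn_leq ge ltn_ord.
  rewrite copE normc_opp (le_trans (@normc_sumM_le _ _ _ _ (fun ka => mem (low ka))))//.
  by rewrite ler_wpM2r// cof_le_alpha.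
have h1 (tau : T) : MLp 1 (Y tau.1 tau.2.+1) by exact: (jet_L1 hab hp (hY tau.1) (ltn_ord tau.2)).
have Hg := HC _ (fun tau : T => Y tau.1 tau.2.+1) F (fun tau : T => Y tau.1 tau.2 a)
   (jet_bounded_meas hY) h1 F1 uE hF t tab.
have mem (s' : T) : normc (Y s'.1 s'.2 t) <= \sum_(s : T) normc (Y s.1 s.2 t).
  by apply: (@ler_sum_mem _ (fun s : T => normc (Y s.1 s.2 t))) => j; exact: normc_ge0.
apply: (le_trans (le_trans (mem (i, Ordinal sK)) Hg)).
have S0 : 0 <= \sum_i Ln p (cop c Y i) by apply: sumr_ge0 => j _; exact: Ln_ge0.
have d0 : 0 <= data Y by apply: sumr_ge0 => j _; exact: normc_ge0.
rewrite -mulrA ler_wpM2l// big_split /= mulrDl mul1r.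
rewrite -addrA lerD2l (le_trans (ler_sum _ (fun tau _ => FL tau)))//.
rewrite -(pair_bigA _ (fun (i : 'I_m) (s : 'I_K) => C1 * Ln p (cop c Y i))) /=.
rewrite (eq_bigr (fun i => K%:R * (C1 * Ln p (cop c Y i)))); last first.
  by move=> j _; rewrite sumr_const card_ord -[LHS]mulr_natl.
rewrite -mulr_sumr -mulr_sumr -!mulrA mulrDr mulrDr -[leLHS]add0r.
by rewrite add0r addrA lerDr addr_ge0// !mulr_ge0.
Qed.

(** Orders below [K] are bounded by their suprema, and order [K] is read off from the equation. *)
Lemma core_bound c : cLp c -> exists2 C : R, 0 <= C & forall Y, inX Y ->
  fnorm Y <= C * (data Y + \sum_i Ln p (cop c Y i)).
Proof.
move=> hc; have [C C0 HC] := core_sup hc.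
pose S := \sum_i \sum_ka Ln p (c i ka).
have S0 : 0 <= S by apply: sumr_ge0 => i _; apply: sumr_ge0 => ka _; exact: Ln_ge0.
have one0 : 0 <= Ln p (fun=> 1 : R[i]) by exact: Ln_ge0.
exists (\sum_(i < m) (\sum_(s < K) C * Ln p (fun=> 1 : R[i]) + (1 + C * S))).
  apply: sumr_ge0 => i _; apply: addr_ge0; last by rewrite addr_ge0// mulr_ge0.
  by apply: sumr_ge0 => s _; rewrite mulr_ge0.
move=> Y hY; set E := data Y + _.
have L0 : 0 <= \sum_i Ln p (cop c Y i) by apply: sumr_ge0 => j _; exact: Ln_ge0.
have d0 : 0 <= data Y by apply: sumr_ge0 => j _; exact: normc_ge0.
have E0 : 0 <= E by rewrite addr_ge0.
rewrite /fnorm mulr_suml; apply: ler_sum => i _.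
rewrite /jnorm big_ord_recr /= mulrDl; apply: lerD.
  rewrite mulr_suml; apply: ler_sum => s _.
  have [mY _ _] := jet_nice hab hp (hY i) (ltn_ord s).
  have YM t : D t -> normc (Y i s t) <= C * E by rewrite /= in_itv => tab; exact: HC.
  by have [_ h] := MLp_bounded hab hp mY YM; rewrite (le_trans h)// mulrAC.
have hM ka : MLp p (fun t => c i ka t * Y (lI ka) (sI ka) t) by apply: cmul_MLp => //; exact: hsI.
have [hs hsl] := MLp_sum hab hp (index_enum I) hM.
have -> : Y i K = (fun t => cop c Y i t - \sum_ka c i ka t * Y (lI ka) (sI ka) t).
  by apply/funext => t; rewrite /cop addrK.
have [_ h] := MLpB hp (cop_MLp i hc hY) hs.
rewrite (le_trans h)// mulrDl mul1r lerD//.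
  rewrite (@le_trans _ _ (\sum_i Ln p (cop c Y i)))//; last by rewrite lerDr.
  by apply: (@ler_sum_mem _ (fun i => Ln p (cop c Y i))) => j; exact: Ln_ge0.
apply: (le_trans hsl); rewrite mulrAC.
apply: (@le_trans _ _ (C * E * \sum_ka Ln p (c i ka))); last first.
  rewrite ler_wpM2l ?mulr_ge0//.
  apply: (@ler_sum_mem _ (fun i => \sum_ka Ln p (c i ka))) => j.
  by apply: sumr_ge0 => ka _; exact: Ln_ge0.
rewrite mulr_sumr; apply: ler_sum => ka _.
have [mY _ _] := jet_nice hab hp (hY (lI ka)) (hsI ka).
have YM t : D t -> normc (Y (lI ka) (sI ka) t) <= C * E.
  by rewrite /= in_itv => tab; exact: HC.
have [_ h'] := MLpM_bounded hab hp mY YM (hc i ka).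
by under eq_fun do rewrite mulrC.
Qed.

Lemma copD c Y Z i t : cop c (addX Y Z) i t = cop c Y i t + cop c Z i t.
Proof.
rewrite /cop /addX addrACA -big_split /=; congr (_ + _).
by apply: eq_bigr => ka _; rewrite mulrDr.
Qed.

Lemma copZ c z Y i t : cop c (scaleX z Y) i t = z * cop c Y i t.
Proof.
rewrite /cop /scaleX mulrDr mulr_sumr; congr (_ + _).
by apply: eq_bigr => ka _; rewrite mulrCA.
Qed.

Lemma copB c Y Z i t : cop c (subX Y Z) i t = cop c Y i t - cop c Z i t.
Proof. by rewrite subXE copD copZ mulN1r. Qed.

Lemma cop_sum c (T' : finType) z (Y : T' -> fam) i t :
  cop c (sumX z Y) i t = \sum_tau z tau * cop c (Y tau) i t.
Proof.
rewrite /cop /sumX; under [RHS]eq_bigr do rewrite mulrDr mulr_sumr.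
rewrite big_split /= exchange_big /=; congr (_ + _).
apply: eq_bigr => ka _; rewrite mulr_sumr; apply: eq_bigr => tau _.
by rewrite mulrCA.
Qed.

Context (Q : finType).
Implicit Types B : fam -> Q -> R[i].

(** Linearity and continuity are asked for on [inX] only, since [fam] contains families that are no
    jets. The bound is explicit because a whole sequence has to share it. *)
Definition blin (beta : R) B := [/\
  forall Y Z q, inX Y -> inX Z -> B (addX Y Z) q = B Y q + B Z q,
  forall z Y q, inX Y -> B (scaleX z Y) q = z * B Y q &
  forall Y q, inX Y -> normc (B Y q) <= beta * fnorm Y].

Lemma blinB beta B Y Z q : blin beta B -> inX Y -> inX Z -> B (subX Y Z) q = B Y q - B Z q.
Proof.
move=> [bD bZ _] hY hZ; rewrite subXE bD ?bZ ?mulN1r//; exact: inXZ.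
Qed.

Lemma blin_sum beta B (T' : finType) z (Y : T' -> fam) q : blin beta B ->
  (forall tau, inX (Y tau)) -> B (sumX z Y) q = \sum_tau z tau * B (Y tau) q.
Proof.
move=> [bD bZ _] hY.
pose S r : fam := fun i s t => \sum_(tau <- r) z tau * Y tau i s t.
have jS r : inX (S r) by move=> i; apply: jet_sum => // tau; apply: jetZ => //; exact: hY.
suff H r : B (S r) q = \sum_(tau <- r) z tau * B (Y tau) q by exact: H.
elim: r => [|x r IH].
  have -> : S [::] = scaleX 0 (S [::]).
    by do 3 apply/funext => ?; rewrite /S /scaleX big_nil mulr0.
  by rewrite bZ// mul0r big_nil.
have -> : S (x :: r) = addX (scaleX (z x) (Y x)) (S r).
  by do 3 apply/funext => ?; rewrite /S /addX /scaleX big_cons.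
by rewrite bD ?bZ ?IH ?big_cons//; exact: inXZ.
Qed.

(** Vanishing Cauchy data stand for Y = 0: together with [cop c Y = 0] they make [fnorm Y] zero by
    [core_bound]. *)
Definition unique_core c B := forall Y, inX Y ->
  (forall i t, a <= t <= b -> cop c Y i t = 0) -> (forall q, B Y q = 0) ->
  forall i s, (s < K)%N -> Y i s a = 0.

Lemma fundamental c : cLp c -> exists W : T -> fam, forall tau, [/\ inX (W tau),
  (forall i (s : 'I_K), W tau i s a = ((i, s) == tau)%:R) &
  (forall i t, a <= t <= b -> cop c (W tau) i t = 0)].
Proof.
move=> hc.
have /choice[W HW] : forall tau : T, exists W : fam, [/\ inX W,
  (forall i (s : 'I_K), W i s a = ((i, s) == tau)%:R) &
  (forall i t, a <= t <= b -> cop c W i t = 0)].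
  move=> tau.
  have [W hW [Wa Wc]] := core_exists (f := fun _ _ => 0)
    (fun i s => ((i == tau.1) && (s == tau.2 :> nat))%:R) hc (fun=> MLp_cst hab hp 0).
  by exists W; split => // i s; rewrite Wa.
by exists W.
Qed.

Lemma data_eq0 Y : (forall i s, (s < K)%N -> Y i s a = 0) -> data Y = 0.
Proof.
by move=> H; apply: big1 => tau _; rewrite H// ComplexField.Normc.normc0.
Qed.

(** For a fundamental system [W] this is the characteristic matrix of the problem. Rows are
    solutions, so coefficient vectors multiply it from the left. *)
Definition bmx B (W : T -> fam) : 'M[R[i]]_(#|{: T}|, #|Q|) :=
  \matrix_(x, q) B (W (enum_val x)) (enum_val q).

Lemma sum_enum_val (V : nmodType) (T' : finType) (F : T' -> V) :
  \sum_(x < #|{: T'}|) F (enum_val x) = \sum_x F x.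
Proof. by rewrite -big_enum_val /=; apply: eq_bigl => x. Qed.

Lemma sumX_data (z : T -> R[i]) (W : T -> fam) i (s : 'I_K) :
  (forall tau i (s : 'I_K), W tau i s a = ((i, s) == tau)%:R) ->
  sumX z W i s a = z (i, s).
Proof.
move=> Wa; rewrite /sumX (bigD1 (i, s))//= Wa eqxx mulr1 big1 ?addr0// => tau tn.
by rewrite Wa eq_sym (negbTE tn) mulr0.
Qed.

(** A row vector in the kernel gives a solution of the homogeneous problem whose Cauchy data are the
    entries of the vector; uniqueness makes them zero. *)
Lemma bmx_free beta c B W : cLp c -> blin beta B -> unique_core c B ->
  (forall tau, [/\ inX (W tau),
    (forall i (s : 'I_K), W tau i s a = ((i, s) == tau)%:R) &
    (forall i t, a <= t <= b -> cop c (W tau) i t = 0)]) ->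
  row_free (bmx B W).
Proof.
move=> hc hB uB HW; apply: inj_row_free => v v0.
have hW tau : inX (W tau) by have [] := HW tau.
have Wa tau : forall i (s : 'I_K), W tau i s a = ((i, s) == tau)%:R by have [] := HW tau.
pose z (tau : T) := v 0 (enum_rank tau).
have zc i t : a <= t <= b -> cop c (sumX z W) i t = 0.
  move=> tab; rewrite cop_sum big1// => tau _.
  by have [_ _ ->] := HW tau; rewrite ?mulr0.
have zB q : B (sumX z W) q = 0.
  rewrite (blin_sum z q hB hW).
  move/matrixP: v0 => /(_ 0 (enum_rank q)); rewrite !mxE => h.
  rewrite -[RHS]h -(@sum_enum_val _ T (fun tau => z tau * B (W tau) q)).
  by apply: eq_bigr => x _; rewrite !mxE enum_rankK /z enum_valK.
apply/rowP => x; rewrite mxE.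
case E : (enum_val x) => [i s].
have := uB _ (inX_sum z hW) zc zB i s (ltn_ord s).
by rewrite sumX_data// /z -E enum_valK.
Qed.

(** With as many conditions as Cauchy data the matrix is square, so uniqueness makes it invertible;
    a particular solution is then corrected by a combination of fundamental solutions. *)
Lemma fredholm beta c B : cLp c -> blin beta B -> unique_core c B ->
  #|Q| = (m * K)%N -> forall f (g : Q -> R[i]), (forall i, MLp p (f i)) ->
  exists2 Y, inX Y & (forall i t, a <= t <= b -> cop c Y i t = f i t) /\ forall q, B Y q = g q.
Proof.
move=> hc hB uB cQ f g hf.
have [W HW] := fundamental hc.
have hW tau : inX (W tau) by have [] := HW tau.
have fr := bmx_free hc hB uB HW.
have full : row_full (bmx B W).
  by move: fr; rewrite /row_free /row_full => /eqP ->; rewrite card_prod !card_ord cQ.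
have [Z hZ [_ Zc]] := core_exists (fun _ _ => 0) hc hf.
have /submxP[v vE] := submx_full (\row_q (g (enum_val q) - B Z (enum_val q))) full.
pose z (tau : T) := v 0 (enum_rank tau).
exists (addX Z (sumX z W)); first by apply: inXD => //; exact: inX_sum.
split.
  move=> i t tab; rewrite copD Zc// cop_sum big1 ?addr0// => tau _.
  by have [_ _ ->] := HW tau; rewrite ?mulr0.
move=> q; have [bD _ _] := hB; rewrite bD//; last exact: inX_sum.
rewrite (blin_sum z q hB hW).
move/matrixP: vE => /(_ 0 (enum_rank q)); rewrite !mxE enum_rankK => h.
rewrite -(@sum_enum_val _ T (fun tau => z tau * B (W tau) q)).
rewrite (eq_bigr (fun x => v 0 x * bmx B W x (enum_rank q))).
  by rewrite -h addrC subrK.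
by move=> x _; rewrite !mxE enum_rankK /z enum_valK.
Qed.

(** * Estimates uniform along a convergent sequence of problems *)

Section Uniform.
Context (c0 : coefs) (c : nat -> coefs) (B0 : fam -> Q -> R[i]) (B : nat -> fam -> Q -> R[i]).
Context (beta : R) (beta0 : 0 <= beta).
Context (hc0 : cLp c0) (hc : forall k, cLp (c k)) (hB0 : blin beta B0)
  (hB : forall k, blin beta (B k)) (uB0 : unique_core c0 B0).
Context (cc : forall e, 0 < e -> \forall k \near \oo, cdist (c k) c0 <= e).
Context (BB : forall Y q e, inX Y -> 0 < e -> \forall k \near \oo, normc (B k Y q - B0 Y q) <= e).

Lemma cdist_ge0 c1 c2 : 0 <= cdist c1 c2.
Proof. by apply: sumr_ge0 => i _; apply: sumr_ge0 => ka _; exact: Ln_ge0. Qed.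

(** The Cauchy data of [Y] are the coefficients of its fundamental part, and [N], a right inverse of
    the matrix of [B0], recovers them from the values of [B0] on that part. These values differ from
    [B k Y] by [B k] on the part with zero data, which [beta] and the equation control, and by
    [B k - B0] on the fundamental part, which is at most [dl * data Y] for large [k] and is
    absorbed. *)
Lemma data_estimate : exists2 C : R, 0 <= C & \forall k \near \oo, forall Y, inX Y ->
  data Y <= C * (\sum_i Ln p (cop c0 Y i) + \sum_q normc (B k Y q)).
Proof.
have [W HW] := fundamental hc0.
have hW tau : inX (W tau) by have [] := HW tau.
have Wa tau : forall i (s : 'I_K), W tau i s a = ((i, s) == tau)%:R by have [] := HW tau.
have Wc tau : forall i t, a <= t <= b -> cop c0 (W tau) i t = 0 by have [] := HW tau.
have /row_freeP[N MN] := bmx_free hc0 hB0 uB0 HW.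
pose nu := \sum_x \sum_y normc (N x y).
have nu0 : 0 <= nu by apply: sumr_ge0 => x _; apply: sumr_ge0 => y _; exact: normc_ge0.
have [C1 C10 HC1] := core_bound hc0.
(* Chosen so that the absorbed term is at most half of [data Y]; adding 1 avoids zero
   denominators. *)
pose dl := (2 * (nu + 1) * (#|Q|%:R + 1))^-1.
have dl0 : 0 < dl by rewrite invr_gt0 !mulr_gt0// ltr_wpDl.
exists (2 * nu * (1 + #|Q|%:R * beta * C1)).
  by rewrite mulr_ge0// ?mulr_ge0// addr_ge0// !mulr_ge0.
have : \forall k \near \oo, forall tau q, normc (B k (W tau) q - B0 (W tau) q) <= dl.
  by apply: filter_forall => tau; apply: filter_forall => q; exact: BB.
apply: filterS => k Hk Y hY.
pose z (tau : T) := Y tau.1 tau.2 a.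
pose Z := subX Y (sumX z W).
have hS : inX (sumX z W) by exact: inX_sum.
have hZ : inX Z by exact: inXB.
have dZ : data Z = 0.
  apply: data_eq0 => i s sK; rewrite /Z /subX (@sumX_data z W i (Ordinal sK) Wa).
  by rewrite subrr.
have Zc i t : a <= t <= b -> cop c0 Z i t = cop c0 Y i t.
  move=> tab; rewrite copB cop_sum big1 ?subr0// => tau _.
  by rewrite Wc// mulr0.
set L := \sum_i Ln p (cop c0 Y i).
have L0 : 0 <= L by apply: sumr_ge0 => j _; exact: Ln_ge0.
have fZ : fnorm Z <= C1 * L.
  have := HC1 _ hZ; rewrite dZ add0r.
  congr (_ <= C1 * _); apply: eq_bigr => i _; apply: Ln_eq => // t.
  by rewrite /= in_itv => tab; exact: Zc.
have dE : data Y = \sum_tau normc (z tau) by [].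
have key : data Y <= nu * \sum_q normc (B0 (sumX z W) q).
  pose v : 'rV[R[i]]_#|{: T}| := \row_x z (enum_val x).
  have vE : v = (\row_q B0 (sumX z W) (enum_val q)) *m N.
    have -> : (\row_q B0 (sumX z W) (enum_val q)) = v *m bmx B0 W.
      apply/rowP => q; rewrite !mxE (blin_sum z _ hB0 hW).
      rewrite -(@sum_enum_val _ T (fun tau => z tau * B0 (W tau) (enum_val q))).
      by apply: eq_bigr => x _; rewrite !mxE.
    by rewrite -mulmxA MN mulmx1.
  have -> : data Y = \sum_x normc (v 0 x).
    rewrite dE -(@sum_enum_val _ T (fun tau => normc (z tau))).
    by apply: eq_bigr => x _; rewrite mxE.
  rewrite vE -(@sum_enum_val _ Q (fun q => normc (B0 (sumX z W) q))).
  rewrite (@le_trans _ _ (\sum_x \sum_y normc (N y x) * normc (B0 (sumX z W) (enum_val y))))//.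
    apply: ler_sum => x _; rewrite mxE (le_trans (normc_sum _ _ _))//.
    by apply: ler_sum => y _; rewrite mxE normcM mulrC.
  rewrite exchange_big /= mulr_sumr; apply: ler_sum => y _.
  rewrite -mulr_suml ler_wpM2r ?normc_ge0//.
  rewrite /nu (bigD1 y)//= lerDl; apply: sumr_ge0 => i _; apply: sumr_ge0 => j _.
  exact: normc_ge0.
have dd0 : 0 <= data Y by rewrite dE; apply: sumr_ge0 => tau _; exact: normc_ge0.
have step q : normc (B0 (sumX z W) q) <= normc (B k Y q) + beta * (C1 * L) + dl * data Y.
  have -> : B0 (sumX z W) q = (B k Y q - B k Z q) - (B k (sumX z W) q - B0 (sumX z W) q).
    by rewrite (blinB q (hB k) hY hS); ring.
  rewrite (le_trans (normcB _ _))// lerD//.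
    rewrite (le_trans (normcB _ _))// lerD2l.
    have [_ _ h] := hB k; rewrite (le_trans (h _ q hZ))// ler_wpM2l//.
  rewrite (blin_sum z q (hB k) hW) (blin_sum z q hB0 hW) -sumrB dE mulr_sumr.
  rewrite (le_trans (normc_sum _ _ _))//; apply: ler_sum => tau _.
  by rewrite -mulrBr normcM mulrC ler_wpM2r ?normc_ge0.
set S := \sum_q normc (B k Y q).
have S0 : 0 <= S by apply: sumr_ge0 => q _; exact: normc_ge0.
have key2 : data Y <= nu * (S + #|Q|%:R * (beta * (C1 * L)) + #|Q|%:R * (dl * data Y)).
  apply: (le_trans key); rewrite ler_wpM2l//.
  rewrite (le_trans (ler_sum _ (fun q _ => step q)))// !big_split /= !sumr_const.
  by rewrite -[_ *+ #|_|]mulr_natl -[(dl * _) *+ #|_|]mulr_natl.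
have hdl : nu * (#|Q|%:R * (dl * data Y)) <= data Y / 2.
  have -> : nu * (#|Q|%:R * (dl * data Y)) =
      data Y / 2 * ((nu / (nu + 1)) * (#|Q|%:R / (#|Q|%:R + 1))).
    rewrite /dl; field; apply/andP; split; rewrite gt_eqF// ltr_wpDl//.
  rewrite ler_piMr//; first by rewrite divr_ge0.
  by apply: mulr_ile1; rewrite ?divr_ge0 ?addr_ge0 ?ler_pdivrMr ?mul1r ?ltr_wpDl ?lerDl.
have h2 : data Y <= 2 * (nu * S) + 2 * (nu * (#|Q|%:R * (beta * (C1 * L)))).
  by move: key2 hdl; rewrite !mulrDr; lra.
apply: (le_trans h2).
rewrite (_ : 2 * nu * _ * _ = 2 * (nu * S) + 2 * (nu * (#|Q|%:R * (beta * (C1 * L)))) +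
   (2 * (nu * L) + 2 * (nu * (#|Q|%:R * (beta * (C1 * S)))))); last by ring.
by rewrite lerDl addr_ge0// !mulr_ge0.
Qed.

(** Replacing [cop c0] by [cop (c k)] produces an error that is a small multiple of [fnorm Y]; [dl]
    makes it at most half of [fnorm Y], to be absorbed on the left. *)
Lemma uniform_estimate : exists2 C : R, 0 <= C & \forall k \near \oo, forall Y, inX Y ->
  fnorm Y <= C * (\sum_i Ln p (cop (c k) Y i) + \sum_q normc (B k Y q)).
Proof.
have [C1 C10 HC1] := core_bound hc0.
have [C2 C20 HC2] := data_estimate.
have [C3 C30 HC3] := cop_diff.
pose C4 := C1 * (C2 + 1).
have C40 : 0 <= C4 by rewrite mulr_ge0// addr_ge0.
exists (2 * C4); first by rewrite mulr_ge0.
pose dl := (2 * (C4 * (m%:R * C3) + 1))^-1.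
have pos : 0 < C4 * (m%:R * C3) + 1.
  by apply: ltr_wpDl => //; exact: (mulr_ge0 C40 (mulr_ge0 (ler0n _ _) C30)).
have dl0 : 0 < dl by rewrite invr_gt0 !mulr_gt0.
have := cc dl0; apply: filterS2 HC2 => k H2 Hd Y hY.
set L := \sum_i Ln p (cop (c k) Y i); set S := \sum_q _.
have S0 : 0 <= S by apply: sumr_ge0 => q _; exact: normc_ge0.
have F0 := fnorm_ge0 Y.
have LL : \sum_i Ln p (cop c0 Y i) <= L + m%:R * (C3 * fnorm Y * dl).
  rewrite -[m in m%:R]card_ord mulr_natl -sumr_const -big_split /=; apply: ler_sum => i _.
  have -> : cop c0 Y i = (fun t => cop (c k) Y i t - (cop (c k) Y i t - cop c0 Y i t)).
    by apply/funext => t; rewrite opprB addrC subrK.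
  have [hd _] := MLpB hp (cop_MLp i (hc k) hY) (cop_MLp i hc0 hY).
  have [_ h] := MLpB hp (cop_MLp i (hc k) hY) hd.
  rewrite (le_trans h)// lerD2l (le_trans (HC3 _ _ _ _ (hc k) hc0 hY))//.
  by rewrite ler_wpM2l// mulr_ge0.
set L0 := \sum_i Ln p (cop c0 Y i) in LL.
have L00 : 0 <= L0 by apply: sumr_ge0 => j _; exact: Ln_ge0.
have h1 : fnorm Y <= C4 * (L0 + S).
  apply: (le_trans (HC1 _ hY)); rewrite /C4 -mulrA ler_wpM2l//.
  by have := H2 _ hY; rewrite -/L0 -/S !mulrDr !mulrDl; lra.
have h2 : C4 * (m%:R * (C3 * fnorm Y * dl)) <= fnorm Y / 2.
  have -> : C4 * (m%:R * (C3 * fnorm Y * dl)) =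
      fnorm Y / 2 * ((C4 * (m%:R * C3)) / (C4 * (m%:R * C3) + 1)).
    by rewrite /dl; field; rewrite gt_eqF.
  rewrite ler_piMr//; first by rewrite divr_ge0.
  by rewrite ler_pdivrMr// mul1r lerDl.
have h3 : C4 * L0 <= C4 * L + C4 * (m%:R * (C3 * fnorm Y * dl)).
  by rewrite -mulrDr ler_wpM2l.
by move: h1 h2 h3; rewrite !mulrDr; lra.
Qed.

(** For [Y] a solution of the k-th problem and [Z] one of the limit problem, the first two terms
    compare the right-hand sides and the last two bound the defect of [Z] in the k-th problem. The
    defect does not involve [Y], so for fixed [Z] strong convergence makes it small. *)
Lemma difference_estimate : exists2 C : R, 0 <= C & \forall k \near \oo, forall Y Z,
  inX Y -> inX Z -> fnorm (subX Y Z) <=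
    C * (\sum_i Ln p (fun t => cop (c k) Y i t - cop c0 Z i t) +
         \sum_q normc (B k Y q - B0 Z q) + cdist (c k) c0 * fnorm Z +
         \sum_q normc (B k Z q - B0 Z q)).
Proof.
have [C1 C10 HC1] := uniform_estimate.
have [C3 C30 HC3] := cop_diff.
exists (C1 * (1 + m%:R * C3)); first by rewrite mulr_ge0// addr_ge0// mulr_ge0.
apply: filterS HC1 => k H1 Y Z hY hZ.
apply: (le_trans (H1 _ (inXB hY hZ))); rewrite -mulrA ler_wpM2l//.
set L := \sum_i Ln p (fun t => cop (c k) Y i t - cop c0 Z i t).
set S1 := \sum_q normc (B k Y q - B0 Z q); set S2 := \sum_q normc (B k Z q - B0 Z q).
have L0 : 0 <= L by apply: sumr_ge0 => q _; exact: Ln_ge0.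
have S10 : 0 <= S1 by apply: sumr_ge0 => q _; exact: normc_ge0.
have S20 : 0 <= S2 by apply: sumr_ge0 => q _; exact: normc_ge0.
have c0' : 0 <= cdist (c k) c0 * fnorm Z by rewrite mulr_ge0 ?cdist_ge0 ?fnorm_ge0.
have hL : \sum_i Ln p (cop (c k) (subX Y Z) i) <= L + m%:R * C3 * (cdist (c k) c0 * fnorm Z).
  rewrite -mulrA -[m in m%:R]card_ord mulr_natl -sumr_const -big_split /=; apply: ler_sum => i _.
  have -> : cop (c k) (subX Y Z) i = (fun t => (cop (c k) Y i t - cop c0 Z i t)
       - (cop (c k) Z i t - cop c0 Z i t)).
    by apply/funext => t; rewrite copB; ring.
  have [hd _] := MLpB hp (cop_MLp i (hc k) hZ) (cop_MLp i hc0 hZ).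
  have [hd' _] := MLpB hp (cop_MLp i (hc k) hY) (cop_MLp i hc0 hZ).
  have [_ h] := MLpB hp hd' hd.
  rewrite (le_trans h)// lerD2l (le_trans (HC3 _ _ _ _ (hc k) hc0 hZ))//.
  by rewrite -mulrA [fnorm Z * _]mulrC.
have hS : \sum_q normc (B k (subX Y Z) q) <= S1 + S2.
  rewrite -big_split /=; apply: ler_sum => q _.
  have -> : B k (subX Y Z) q = (B k Y q - B0 Z q) - (B k Z q - B0 Z q).
    by rewrite (blinB q (hB k) hY hZ); ring.
  exact: normcB.
have h0 : 0 <= m%:R * C3 * (L + S1 + S2) by rewrite !mulr_ge0// !addr_ge0.
move: hL hS h0; rewrite !mulrDl !mulrDr mul1r; lra.
Qed.

(** A homogeneous solution has norm 0 by the uniform estimate, and the embedding passes from the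
    norm to the values at [a]. *)
Lemma eventually_unique : \forall k \near \oo, unique_core (c k) (B k).
Proof.
have [C C0 HC] := uniform_estimate; apply: filterS HC => k H Y hY Y0 B0' i s sK.
have [C1 C10 HC1] := fam_sup.
have aab : a <= a <= b by rewrite lexx ltW.
have := HC1 Y i s a hY sK aab.
have -> : fnorm Y = 0.
  apply/eqP; rewrite eq_le fnorm_ge0 andbT (le_trans (H _ hY))//.
  rewrite [\sum_q _]big1 ?addr0; last by move=> q _; rewrite B0' ComplexField.Normc.normc0.
  rewrite big1 ?mulr0// => j _; rewrite -[RHS](Ln0 hp); apply: Ln_eq => // t; rewrite /= in_itv /= => tab.
  exact: Y0.
by rewrite mulr0 => h; apply/ComplexField.Normc.eq0_normc/eqP; rewrite eq_le h normc_ge0.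
Qed.

End Uniform.

End Core.

(** * Approximation by polynomials and step functions *)

Section Bernstein.
Context {R : realType}.

(* The Bernstein polynomial of f 0, ..., f n by de Casteljau's recursion, which
   turns the moment identities into inductions without binomial sums. *)
Fixpoint bern (n : nat) (f : nat -> R) : {poly R} :=
  if n is n'.+1 then (1 - 'X) * bern n' f + 'X * bern n' (fun k => f k.+1) else (f 0%N)%:P.

Lemma bernS n f x : (bern n.+1 f).[x] =
  (1 - x) * (bern n f).[x] + x * (bern n (fun k => f k.+1)).[x].
Proof. by rewrite /= !hornerE. Qed.

Lemma bern_le n f g x : 0 <= x <= 1 -> (forall k, (k <= n)%N -> f k <= g k) ->
  (bern n f).[x] <= (bern n g).[x].
Proof.
move=> /andP[x0 x1]; elim: n f g => [|n IH] f g fg; first by rewrite !hornerC fg.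
rewrite !bernS lerD// ler_wpM2l ?subr_ge0//; apply: IH => k kn; apply: fg => //.
exact: leqW.
Qed.

Lemma bern_cst n c x : (bern n (fun=> c)).[x] = c.
Proof. by elim: n => [|n IH]; rewrite ?hornerC// bernS IH; ring. Qed.

Lemma bern_lin n f g (c : R) x : (bern n (fun k => f k + c * g k)).[x] =
  (bern n f).[x] + c * (bern n g).[x].
Proof. by elim: n f g => [|n IH] f g; rewrite ?hornerC// !bernS !IH; ring. Qed.

(** At y = n x this is the variance n x (1 - x) of the binomial distribution. A general [y] lets the
    induction run, since the shift of the nodes by 1 turns [y] into [y - 1]. *)
Lemma bern_variance n y x : (bern n (fun k => (k%:R - y) ^+ 2)).[x] =
  (n%:R * x - y) ^+ 2 + n%:R * x * (1 - x).
Proof.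
elim: n y => [|n IH] y; first by rewrite hornerC; ring.
rewrite bernS IH; have -> : (fun k => (k.+1%:R - y) ^+ 2) = (fun k => (k%:R - (y - 1)) ^+ 2).
  by apply/funext => k; rewrite -natr1; ring.
by rewrite IH -natr1; ring.
Qed.

Lemma bern_approx (h : R -> R) (M : R) : 0 <= M ->
  (forall x, 0 <= x <= 1 -> `|h x| <= M) ->
  (forall e, 0 < e -> exists2 d, 0 < d & forall u v, 0 <= u <= 1 -> 0 <= v <= 1 ->
     `|u - v| < d -> `|h u - h v| <= e) ->
  forall e, 0 < e -> exists q : {poly R}, forall x, 0 <= x <= 1 -> `|h x - q.[x]| <= e.
Proof.
move=> M0 hM uc e e0.
have [d d0 Hd] := uc (e / 2) (divr_gt0 e0 (ltr0Sn _ _)).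
(* Large enough for the Bernstein value of the quadratic part of [E] at x to be at most e / 2. *)
pose n := (Num.bound (4 * M / (e * d ^+ 2))).+1.
have n0 : 0 < n%:R :> R by rewrite ltr0n.
have hn : 2 * M / (d ^+ 2 * n%:R) <= e / 2.
  have : 4 * M / (e * d ^+ 2) <= n%:R.
    have A0 : 0 <= 4 * M / (e * d ^+ 2) by rewrite divr_ge0 ?mulr_ge0 ?exprn_ge0 ?(ltW e0) ?(ltW d0).
    by rewrite (le_trans (ltW (archi_boundP A0)))// ler_nat.
  rewrite ler_pdivrMr ?mulr_gt0 ?exprn_gt0// => h1.
  rewrite ler_pdivrMr ?mulr_gt0 ?exprn_gt0//; lra.
exists (bern n (fun k => h (k%:R / n%:R))) => x x01.
(* Chebyshev's device, one quadratic bound for all nodes: within distance [d] of x the constant e /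
   2 suffices by uniform continuity, beyond it the square outweighs 2 M. *)
pose E k : R := e / 2 + 2 * M / (d ^+ 2 * n%:R ^+ 2) * (k%:R - n%:R * x) ^+ 2.
have pt k : (k <= n)%N -> `|h x - h (k%:R / n%:R)| <= E k.
  move=> kn; have k01 : 0 <= (k%:R / n%:R : R) <= 1.
    by rewrite divr_ge0//= ler_pdivrMr// mul1r ler_nat.
  have c0 : 0 <= 2 * M / (d ^+ 2 * n%:R ^+ 2).
    by rewrite divr_ge0 ?mulr_ge0 ?exprn_ge0 ?(ltW d0).
  have [lt|ge] := ltP `|x - k%:R / n%:R| d.
    by rewrite (le_trans (Hd _ _ x01 k01 lt))// lerDl mulr_ge0// sqr_ge0.
  rewrite (@le_trans _ _ (2 * M))//.
    have := hM x x01; have := hM _ k01; have := ler_normB (h x) (h (k%:R / n%:R)); lra.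
  rewrite /E -[leLHS]add0r lerD//; first by rewrite divr_ge0// ltW.
  have -> : 2 * M / (d ^+ 2 * n%:R ^+ 2) * (k%:R - n%:R * x) ^+ 2 =
      2 * M * (`|x - k%:R / n%:R| / d) ^+ 2.
    rewrite expr_div_n real_normK ?num_real//; field.
    by rewrite !gt_eqF.
  rewrite ler_peMr ?mulr_ge0// exprn_ege1// ler_pdivlMr// mul1r.
  exact: ge.
have hE : (bern n E).[x] <= e.
  rewrite /E (bern_lin n (fun=> e / 2)) bern_cst bern_variance subrr expr0n /= add0r.
  have /andP[x0 x1] := x01.
  have -> : 2 * M / (d ^+ 2 * n%:R ^+ 2) * (n%:R * x * (1 - x)) =
     2 * M / (d ^+ 2 * n%:R) * (x * (1 - x)) by field; rewrite !gt_eqF.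
  have : 2 * M / (d ^+ 2 * n%:R) * (x * (1 - x)) <= 2 * M / (d ^+ 2 * n%:R).
    rewrite ler_piMr//; first by rewrite divr_ge0 ?mulr_ge0 ?exprn_ge0 ?(ltW d0).
    by rewrite mulr_ile1 ?subr_ge0// lerBlDr lerDl.
  by lra.
have hx : h x = (bern n (fun=> h x)).[x] by rewrite bern_cst.
rewrite ler_norml; apply/andP; split.
  rewrite lerBrDl -lerBrDr opprK (@le_trans _ _ ((bern n (fun k => h x + 1 * E k)).[x]))//.
    apply: bern_le => // k kn; have := pt k kn; rewrite ler_norml => /andP[]; lra.
  by rewrite bern_lin bern_cst; lra.
rewrite lerBlDr -lerBlDl (@le_trans _ _ ((bern n (fun k => h x + (-1) * E k)).[x]))//.
  by rewrite bern_lin bern_cst; lra.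
by apply: bern_le => // k kn; have := pt k kn; rewrite ler_norml => /andP[]; lra.
Qed.

End Bernstein.

Section Weierstrass.
Context {R : realType} (a b : R) (hab : a < b).

Lemma continuous_contAt (f : R -> R) t : continuous f -> contAt a b f t.
Proof.
move=> cf e e0; have /cvgrPdist_lt/(_ e e0)[d /= d0 Hd] := cf t.
by exists d => // u _ ud; rewrite distrC; apply: Hd; rewrite /= distrC.
Qed.

(** Heine-Cantor: compactness of [a, b] turns a radius valid near each point into a common one. *)
Lemma uniform_contAt (f : R -> R) : (forall t, a <= t <= b -> contAt a b f t) ->
  forall e, 0 < e -> exists2 d, 0 < d & forall u v, a <= u <= b -> a <= v <= b ->
    `|u - v| < d -> `|f u - f v| <= e.
Proof.
move=> cf e e0.
have /compact_near_coveringP/near_covering_withinP cov := @segment_compact R a b.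
have := cov _ (0 : R)^'+ (fun d u => forall v, a <= v <= b -> `|u - v| < d -> `|f u - f v| <= e) _.
case.
  move=> x; rewrite /= in_itv /= => xab.
  have [d d0 Hd] := cf x xab (e / 2) (divr_gt0 e0 (ltr0Sn _ _)).
  have d20 : 0 < d / 2 by rewrite divr_gt0.
  exists (ball x (d / 2), [set r | r < d / 2]) => /=.
    split; first exact: nbhsx_ballx.
    by apply: nbhs_right_lt.
  move=> [u r] /= [xu rd]; rewrite in_itv /= => uab v vab uv.
  have xu' : `|u - x| < d / 2 by rewrite distrC.
  have h1 : `|f u - f x| < e / 2 by apply: Hd => //; lra.
  have h2 : `|f v - f x| < e / 2.
    apply: Hd => //; have := ler_distD u v x; rewrite [`|v - u|]distrC; lra.
  have := ler_distD (f x) (f u) (f v); rewrite [`|f x - f v|]distrC; lra.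
move=> d /= d0 Hd; exists (d / 2); first by rewrite divr_gt0.
move=> u v uab; apply: (Hd (d / 2)).
- by rewrite /ball_ /= sub0r normrN gtr0_norm ?divr_gt0// ltr_pdivrMr// ltr_pMr// ltr1n.
- by rewrite divr_gt0.
- by rewrite /= in_itv.
Qed.

Lemma weierstrass (f : R -> R) (M : R) : 0 <= M -> (forall t, a <= t <= b -> `|f t| <= M) ->
  (forall t, a <= t <= b -> contAt a b f t) ->
  forall e, 0 < e -> exists q : {poly R}, forall t, a <= t <= b -> `|f t - q.[t]| <= e.
Proof.
move=> M0 fM cf e e0; have ba : 0 < b - a by rewrite subr_gt0.
pose h x := f (a + (b - a) * x).
have mem x : 0 <= x <= 1 -> a <= a + (b - a) * x <= b.
  move=> /andP[x0 x1]; rewrite lerDl mulr_ge0 ?(ltW ba)//= -lerBrDl.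
  by rewrite ler_piMr// ltW.
have [x x01|e' e'0||q Hq] := @bern_approx R h M M0 _ _ e; last 1 first.
- exists (q \Po ((b - a)^-1 *: ('X - a%:P))) => t /andP[at_ tb].
  have ba1 : b - a != 0 by rewrite gt_eqF.
  have := Hq ((t - a) / (b - a)); rewrite /h mulrCA mulfV// mulr1 addrCA subrr addr0.
  rewrite horner_comp !hornerE [_^-1 * _]mulrC; apply.
  by rewrite divr_ge0 ?subr_ge0 ?(ltW hab)//= ler_pdivrMr// mul1r lerD2r.
- exact/fM/mem.
- have [d d0 Hd] := uniform_contAt cf e'0; exists (d / (b - a)); first by rewrite divr_gt0.
  move=> u v u01 v01; rewrite ltr_pdivlMr// => uv; apply: Hd; rewrite ?mem//.
  by rewrite opprD addrACA subrr add0r -mulrBr normrM gtr0_norm// mulrC.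
- by [].
Qed.

End Weierstrass.

(** * Density of continuous functions in L_q *)

Section Approximation.
Context {R : realType} (a b : R) (hab : a < b).
Local Notation mu := (@lebesgue_measure R).
Local Notation D := (`[a, b]%classic : set R).
Local Notation cmeas := (cmeas a b).
Local Notation MLp := (MLp a b).
Local Notation Ln := (Ln a b).

Let mD : measurable D. Proof. exact: measurable_itv. Qed.

Definition clip (M x : R) := Num.max (- M) (Num.min M x).

Lemma clip_bound M x : 0 <= M -> `|clip M x| <= M.
Proof.
by move=> M0; rewrite /clip; case: (leP M x) => h1; case: (leP (- M)) => h2; rewrite ler_norml; lra.
Qed.

Lemma clip_lip M x y : 0 <= M -> `|clip M x - clip M y| <= `|x - y|.
Proof.
move=> M0; rewrite /clip; case: (leP M x) => h1; case: (leP (- M)) => h2;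
  case: (leP M y) => h3; case: (leP (- M)) => h4;
  rewrite ?subrr ?normr0//; case: (lerP 0 (x - y)) => h5;
  rewrite ?(ger0_norm h5) ?(ltr0_norm h5) ler_norml; lra.
Qed.

Lemma clip_id M x : `|x| <= M -> clip M x = x.
Proof.
by rewrite ler_norml /clip => /andP[h1 h2]; case: (leP M x) => h3; case: (leP (- M)) => h4; lra.
Qed.

Lemma bounded_integrable (h : R -> R) (M : R) : measurable_fun D h ->
  (forall t, D t -> `|h t| <= M) -> mu.-integrable D (EFin \o h).
Proof.
move=> mh hM.
apply: (@le_integrable _ _ _ mu D mD _ (EFin \o cst M)) => //.
- exact/measurable_EFinP.
- by move=> x Dx; rewrite /= lee_fin (le_trans (hM x Dx))// ler_norm.
- exact: integrable_cst_itv.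
Qed.

(** Clipping at [M] is 1-Lipschitz and leaves [h] unchanged, so it bounds the continuous
    approximations without increasing their distance to [h]. *)
Lemma continuous_approx_L1 (h : R -> R) (M : R) : 0 <= M -> measurable_fun D h ->
  (forall t, D t -> `|h t| <= M) -> forall e, 0 < e ->
  exists g : R -> R, [/\ continuous g, (forall t, `|g t| <= M) &
    \int[mu]_(t in D) `|h t - g t| <= e].
Proof.
move=> M0 mh hM e e0; have ih := bounded_integrable mh hM.
have muD : (mu D < +oo)%E.
  by have := lebesgue_measure_itv (`[a, b] : interval R); rewrite /= => ->; case: ifP; rewrite ?ltry.
have [g [cg ig]] := approximation_continuous_integrable mD muD ih.
move=> /fine_cvgP[_ /cvgrPdist_lt/(_ e e0)[n _ Hn]].
have cc : continuous (fun t => clip M (g n t)).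
  move=> t; apply/cvgrPdist_lt => e' e'0; have /cvgrPdist_lt/(_ e' e'0) := cg n t.
  by apply: filterS => x; apply: le_lt_trans; exact: clip_lip.
exists (fun t => clip M (g n t)); split => //; first by move=> t; exact: clip_bound.
have := Hn n (leqnn n); rewrite /= sub0r normrN => h1.
apply: (le_trans _ (ltW (le_lt_trans (ler_norm _) h1))).
have mg : measurable_fun D (g n) by apply/measurable_EFinP; case/integrableP: (ig n).
have mc : measurable_fun D (fun t => clip M (g n t)).
  by apply: measurable_funTS; exact: continuous_measurable_fun.
apply: le_Rintegral => //.
- apply: (bounded_integrable (M := M + M)).
    by apply: measurableT_comp => //; exact: measurable_funB.
  move=> t Dt; rewrite normr_id (le_trans (ler_normB _ _))// lerD ?hM//.
  exact: clip_bound.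
- by apply: integrable_norm; exact: (rintB mD ih (ig n)).
- by move=> t Dt; rewrite -{1}(clip_id (hM t Dt)); exact: clip_lip.
Qed.

Lemma MLp_pow q f : 0 < q -> MLp q f -> mu.-integrable D (EFin \o (fun t => normc (f t) `^ q)).
Proof.
move=> q0 [mf]; rewrite Lp_normE ?gt_eqF// => fq.
have I0 : (0 <= \int[mu]_(x in D) ((normc (f x)) `^ q)%:E)%E.
  by apply: integral_ge0 => x _; rewrite lee_fin powR_ge0.
apply/integrableP; split.
  apply/measurable_EFinP; apply: (measurableT_comp (measurable_powR _)).
  exact: cmeas_normc.
have -> : (\int[mu]_(x in D) `|(EFin \o (fun t => (normc (f t) `^ q)%R)) x|)%E =
    (\int[mu]_(x in D) ((normc (f x)) `^ q)%:E)%E.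
  by apply: eq_integral => x _; rewrite /= ger0_norm ?powR_ge0.
rewrite ltey; apply/eqP => E; move: fq; rewrite E.
by rewrite poweRyr ?ltxx// invr_eq0 gt_eqF.
Qed.

Lemma Ln_le_pow q f e : 0 < q -> MLp q f -> 0 <= e ->
  \int[mu]_(t in D) (normc (f t) `^ q) <= e `^ q -> Ln q f <= e.
Proof.
move=> q0 fq e0 h; have [_ fqy] := fq.
rewrite -lee_fin LnE// Lp_normE ?gt_eqF//.
have -> : (\int[mu]_(x in D) ((normc (f x)) `^ q)%:E)%E =
    (\int[mu]_(t in D) (normc (f t) `^ q))%:E.
  by rewrite /Rintegral fineK//; apply: integrable_fin_num => //; exact: MLp_pow.
have -> : e%:E = ((e `^ q)%:E `^ q^-1)%E.
  by rewrite poweR_EFin -powRrM mulfV ?gt_eqF// powRr1.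
apply: le_poweR; rewrite ?lee_fin ?invr_ge0 ?(ltW q0)//.
by apply: Rintegral_ge0 => x _; exact: powR_ge0.
Qed.

(** Since |u|^q <= M^(q-1) |u|, smallness in L_1 becomes smallness in L_q for functions with a
    common bound. *)
Lemma Ln_interp q M u e : 1 <= q -> cmeas u -> 0 <= M -> (forall t, D t -> normc (u t) <= M) ->
  0 <= e -> M `^ (q - 1) * Ln 1 u <= e `^ q -> Ln q u <= e.
Proof.
move=> q1 mu_ M0 uM e0 h; have q0 : 0 < q by rewrite (lt_le_trans _ q1).
have [uq _] := MLp_bounded hab q1 mu_ uM.
have [u1 _] := MLp_bounded hab (lexx 1) mu_ uM.
apply: (Ln_le_pow q0 uq e0); apply: le_trans h.
rewrite Ln1E -RintegralZl//; last exact: L1_normc.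
apply: le_Rintegral => //; first exact: MLp_pow.
  by apply: rintZ => //; exact: L1_normc.
move=> t Dt; have [->|n0] := eqVneq (normc (u t)) 0.
  by rewrite powR0 ?mulr0// gt_eqF.
rewrite -[X in _ `^ X](subrK 1) powRD; last by rewrite n0 implybT.
rewrite powRr1 ?normc_ge0// ler_wpM2r ?normc_ge0//.
by rewrite ge0_ler_powR ?subr_ge0 ?nnegrE ?normc_ge0 ?uM.
Qed.

(** [h] is [f] where |f| <= N and 0 elsewhere; the error is a tail of the integrable function
    |f|^q. *)
Lemma trunc_approx q f e : 1 <= q -> MLp q f -> 0 < e ->
  exists (N : nat) (h : R -> R[i]), [/\ cmeas h, (forall t, normc (h t) <= N%:R) &
    Ln q (fun t => f t - h t) <= e].
Proof.
move=> q1 fq e0; have q0 : 0 < q by rewrite (lt_le_trans _ q1).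
have [mf _] := fq.
have mn := cmeas_normc mf.
have [N HN] := integrable_tail (fun x _ => powR_ge0 (normc (f x)) q) (MLp_pow q0 fq) mn
   (powR_gt0 q e0).
pose w t : R[i] := (if normc (f t) <= N%:R then 1 else 0).
have mw : cmeas w.
  have mb : measurable_fun D (fun t => normc (f t) <= N%:R).
    by apply: measurable_fun_ler => //; exact: measurable_cst.
  split; rewrite /w.
    rewrite (_ : (fun t => _) = fun t => if normc (f t) <= N%:R then 1 else 0 : R).
      by apply: measurable_fun_if => //; exact: measurable_cst.
    by apply/funext => t; case: ifP.
  rewrite (_ : (fun t => _) = fun t => 0 : R); first exact: measurable_cst.
  by apply/funext => t; case: ifP.
have mh : cmeas (fun t => w t * f t) by exact: cmeasM.
have dE t : f t - w t * f t = if normc (f t) <= N%:R then 0 else f t.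
  by rewrite /w; case: ifP; rewrite ?mul1r ?subrr// mul0r subr0.
exists N, (fun t => w t * f t); split => //.
  move=> t; rewrite /w; case: ifP; rewrite ?mul1r ?mul0r//.
  by rewrite ComplexField.Normc.normc0.
have [dq _] : MLp q (fun t => f t - w t * f t) /\ Ln q (fun t => f t - w t * f t) <= 1 * Ln q f.
  apply: MLp_le => //; first exact: cmeasB.
  move=> t _; rewrite mul1r dE; case: ifP => // _.
  by rewrite ComplexField.Normc.normc0 normc_ge0.
apply: (Ln_le_pow q0 dq (ltW e0)); apply: le_trans HN.
rewrite le_eqVlt; apply/orP; left; apply/eqP; apply: eq_Rintegral => t _.
rewrite dE; case: leP; rewrite ?mulr1// mulr0 ComplexField.Normc.normc0 powR0//.
by rewrite gt_eqF.
Qed.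

Definition ccontinuous (g : R -> R[i]) :=
  continuous (fun t => complex.Re (g t)) /\ continuous (fun t => complex.Im (g t)).

Lemma ccontinuous_cmeas g : ccontinuous g -> cmeas g.
Proof.
by move=> [c1 c2]; split; apply: measurable_funTS; exact: continuous_measurable_fun.
Qed.

Lemma continuous_approx_cL1 h M e : 0 <= M -> cmeas h -> (forall t, D t -> normc (h t) <= M) ->
  0 < e -> exists g, [/\ ccontinuous g, (forall t, normc (g t) <= 2 * M) &
    Ln 1 (fun t => h t - g t) <= e].
Proof.
move=> M0 mh hM e0; have e20 : 0 < e / 2 by rewrite divr_gt0.
have [m1 m2] := mh.
have [t Dt|g1 [c1 b1 H1]] := continuous_approx_L1 M0 m1 _ e20.
  by rewrite (le_trans (Re_le_normc _))// hM.
have [t Dt|g2 [c2 b2 H2]] := continuous_approx_L1 M0 m2 _ e20.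
  by rewrite (le_trans (Im_le_normc _))// hM.
pose g t := g1 t +i* g2 t.
have cg : ccontinuous g by [].
have mg := ccontinuous_cmeas cg.
have gM t : normc (g t) <= 2 * M.
  by rewrite (le_trans (normc_le_ReIm _))//= mulr_natl mulr2n lerD.
exists g; split => //.
rewrite Ln1E (splitr e).
have [hg1 _] := MLp_bounded hab (lexx 1) mh hM.
have [gg1 _] := MLp_bounded hab (lexx 1) mg (fun t _ => gM t).
have [d1 _] := MLpB (lexx 1) hg1 gg1.
have i1 : mu.-integrable D (EFin \o (fun t => `|complex.Re (h t) - g1 t|)).
  apply: integrable_norm; apply: rintB => //; first exact: L1_Re.
  exact: (L1_Re gg1).
have i2 : mu.-integrable D (EFin \o (fun t => `|complex.Im (h t) - g2 t|)).
  apply: integrable_norm; apply: rintB => //; first exact: L1_Im.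
  exact: (L1_Im gg1).
apply: (le_trans _ (lerD H1 H2)); rewrite -RintegralD//.
apply: le_Rintegral => //; first exact: L1_normc.
  exact: rintD.
by move=> t _; rewrite (le_trans (normc_le_ReIm _))// ReD ImD ReN ImN.
Qed.

Lemma continuous_dense q f e : 1 <= q -> MLp q f -> 0 < e ->
  exists (g : R -> R[i]) (M : R), [/\ ccontinuous g, 0 <= M, (forall t, normc (g t) <= M) &
    Ln q (fun t => f t - g t) <= e].
Proof.
move=> q1 fq e0; have e20 : 0 < e / 2 by rewrite divr_gt0.
have [N [h [mh hN Hh]]] := trunc_approx q1 fq e20.
pose M : R := N%:R + 2 * N%:R.
have M0 : 0 <= M by rewrite addr_ge0// mulr_ge0.
(* The accuracy in L_1 that [Ln_interp] turns into e / 2 in L_q, as [M] bounds the difference of the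
   truncation and its continuous approximation. *)
pose e' := (e / 2) `^ q / (M `^ (q - 1) + 1).
have e'0 : 0 < e' by rewrite divr_gt0 ?powR_gt0// ltr_wpDl ?powR_ge0.
have [g [cg gN Hg]] := continuous_approx_cL1 (ler0n _ N) mh (fun t _ => hN t) e'0.
have mg := ccontinuous_cmeas cg.
have [hq _] := MLp_bounded hab q1 mh (fun t _ => hN t).
have [gq _] := MLp_bounded hab q1 mg (fun t _ => gN t).
have [fhq _] := MLpB q1 fq hq.
have [hgq _] := MLpB q1 hq gq.
exists g, (2 * N%:R); split => //.
have -> : (fun t => f t - g t) = (fun t => (f t - h t) + (h t - g t)).
  by apply/funext => t; rewrite addrA subrK.
have [_ h1] := MLpD q1 fhq hgq.
rewrite (le_trans h1)// [leRHS]splitr lerD//.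
apply: (Ln_interp (M := M) q1) => //; first exact: cmeasB.
- by move=> t _; rewrite (le_trans (normcB _ _))// lerD.
- exact: ltW.
rewrite (@le_trans _ _ (M `^ (q - 1) * e'))//; first by rewrite ler_wpM2l ?powR_ge0.
rewrite /e' mulrCA ler_piMr ?powR_ge0// ler_pdivrMr ?ltr_wpDl ?powR_ge0//.
by rewrite mul1r lerDl.
Qed.

End Approximation.

(** * Density of polynomials in Sobolev spaces *)

Section PolynomialJets.
Context {R : realType} (a b p : R).
Context (hab : a < b) (hp : 1 <= p).
Local Notation D := (`[a, b]%classic : set R).
Local Notation MLp := (MLp a b).
Local Notation Ln := (Ln a b).
Local Notation J := (J a).
Local Notation jet := (jet a b p).
Local Notation jnorm := (jnorm a b p).

Definition pev (q : {poly R[i]}) (t : R) : R[i] := q.[t%:C].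

Lemma dq_cst c t : dq a b (fun=> c) t 0.
Proof. by move=> e e0; exists 1 => // u _ _ _; rewrite subrr mul0r subr0 normr0. Qed.

Lemma dq_id t : dq a b id t 1.
Proof.
by move=> e e0; exists 1 => // u _ ut _; rewrite mulfV ?subr_eq0// subrr normr0.
Qed.

Lemma poly_cdq q t : cdq a b (pev q) t (pev q^`() t).
Proof.
elim/poly_ind: q => [|q c IH].
  rewrite deriv0 /pev; rewrite (_ : (fun t => _) = fun=> 0).
    by rewrite horner0; split; exact: dq_cst.
  by apply/funext => x; rewrite horner0.
rewrite derivD derivM derivX derivC addr0 mulr1.
have -> : pev (q * 'X + c%:P) = fun t => c + pev q t * t%:C.
  by apply/funext => x; rewrite /pev !hornerE addrC.
have -> : pev (q^`() * 'X + q) t = pev q^`() t * t%:C + pev q t * 1.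
  by rewrite /pev !hornerE.
apply: cdq_addc; apply: cdqM => //; split; [exact: dq_id|exact: dq_cst].
Qed.

Lemma poly_nice q : nice a b (pev q).
Proof.
split; last by move=> t _; exact: cdq_ccont (poly_cdq q t).
  elim/poly_ind: q => [|q c IH].
    by apply: cmeas_eq (cmeas_cst a b 0) => t _; rewrite /pev horner0.
  apply: (@cmeas_eq _ _ _ (fun t => pev q t * t%:C + c)).
    by move=> t _; rewrite /pev !hornerE.
  apply: cmeasD; last exact: cmeas_cst.
  apply: cmeasM => //; split; last exact: measurable_cst.
  exact: measurable_id.
elim/poly_ind: q => [|q c [M HM]].
  by exists 0 => t _; rewrite /pev horner0 ComplexField.Normc.normc0.
exists (M * (`|a| + `|b|) + normc c) => t /[dup] tab /andP[at_ tb].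
have -> : pev (q * 'X + c%:P) t = pev q t * t%:C + c by rewrite /pev !hornerE.
rewrite (le_trans (normc_triangle _ _))// lerD2r normcM ler_pM ?normc_ge0 ?HM//.
rewrite normc_real ler_norml; have := ler_norm b; have := ler_norm (- a); rewrite normrN.
have := normr_ge0 a; have := normr_ge0 b; lra.
Qed.

Lemma poly_J q t : a <= t <= b -> pev q t = pev q a + J (pev q^`()) t.
Proof. by move=> tab; apply: (cdq_J hab (poly_nice _) _ tab) => x _; exact: poly_cdq. Qed.

Definition pjet (q : {poly R[i]}) (s : nat) : R -> R[i] := pev q^`(s).

Lemma poly_jet k q : jet k (pjet q).
Proof.
split; last by apply: nice_MLp => //; exact: poly_nice.
by move=> s _ t tab; rewrite /pjet derivnS; exact: poly_J.
Qed.

Lemma poly_antideriv (q : {poly R[i]}) : exists Q : {poly R[i]}, Q^`() = q.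
Proof.
exists (\poly_(i < (size q).+1) (q`_(i.-1) / i%:R)).
apply/polyP => i; rewrite coef_deriv coef_poly ltnS.
case: ltnP => iq.
  by rewrite -[LHS]mulr_natr divfK// pnatr_eq0.
by rewrite mul0rn nth_default.
Qed.

Lemma poly_dense f e : MLp p f -> 0 < e -> exists q, Ln p (fun t => f t - pev q t) <= e.
Proof.
move=> fp e0; have e20 : 0 < e / 2 by rewrite divr_gt0.
have [g [M [cg M0 gM Hg]]] := continuous_dense hab hp fp e20.
have one0 : 0 <= Ln p (fun=> 1 : R[i]) by exact: Ln_ge0.
pose e' := e / (4 * (Ln p (fun=> 1 : R[i]) + 1)).
have den0 : 0 < 4 * (Ln p (fun=> 1 : R[i]) + 1) by rewrite mulr_gt0// ltr_wpDl.
have e'0 : 0 < e' by rewrite divr_gt0.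
have [c1 c2] := cg.
have [t _|q1 H1] := weierstrass hab M0 _ (fun t _ => continuous_contAt a b t c1) e'0.
  by rewrite (le_trans (Re_le_normc _)).
have [t _|q2 H2] := weierstrass hab M0 _ (fun t _ => continuous_contAt a b t c2) e'0.
  by rewrite (le_trans (Im_le_normc _)).
pose q : {poly R[i]} := map_poly (real_complex R) q1 + 'i%C *: map_poly (real_complex R) q2.
have qE t : pev q t = q1.[t] +i* q2.[t].
  rewrite /pev /q hornerD hornerZ !horner_map /=.
  by apply: complex_eqP; rewrite /= ?mul0r ?mul1r ?subr0 ?addr0 ?add0r ?subrr ?oppr0; ring.
have mg := ccontinuous_cmeas a b cg.
have [gp _] := MLp_bounded hab hp mg (fun t _ => gM t).
have qp : MLp p (pev q) by apply: nice_MLp => //; exact: poly_nice.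
have [fg _] := MLpB hp fp gp.
have [gq _] := MLpB hp gp qp.
exists q.
have -> : (fun t => f t - pev q t) = (fun t => (f t - g t) + (g t - pev q t)).
  by apply/funext => t; rewrite addrA subrK.
have [_ h1] := MLpD hp fg gq.
rewrite (le_trans h1)// [leRHS]splitr lerD//.
have bd t : D t -> normc (g t - pev q t) <= 2 * e'.
  rewrite /= in_itv /= => tab; rewrite (le_trans (normc_le_ReIm _))// ReD ImD ReN ImN qE /=.
  by rewrite mulr_natl mulr2n lerD ?H1 ?H2.
have [_ h2] := MLp_bounded hab hp (proj1 gq) bd.
rewrite (le_trans h2)// /e'.
have -> : 2 * (e / (4 * (Ln p (fun=> 1 : R[i]) + 1))) * Ln p (fun=> 1 : R[i]) =
   e / 2 * (Ln p (fun=> 1 : R[i]) / (Ln p (fun=> 1 : R[i]) + 1)).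
  by field; rewrite gt_eqF// ltr_wpDl.
by rewrite ler_piMr ?(ltW e20)// ler_pdivrMr ?mul1r ?lerDl// ltr_wpDl.
Qed.

Lemma jnormS k Y : jnorm k.+1 Y = Ln p (Y 0%N) + jnorm k (fun s => Y s.+1).
Proof. by rewrite /jnorm big_ord_recl. Qed.

(** The derivative is approximated by induction on the order, and the approximating polynomial is
    integrated. *)
Lemma poly_jet_dense n Y e : jet n Y -> 0 < e ->
  exists q, jnorm n (fun s t => Y s t - pjet q s t) <= e.
Proof.
have [C1 C10 HC1] := MLp_L1 hab hp.
have one0 : 0 <= Ln p (fun=> 1 : R[i]) by exact: Ln_ge0.
elim: n Y e => [|n IH] Y e jY e0.
  have [q Hq] := poly_dense (jet_MLp hab hp jY (leqnn _)) e0.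
  by exists q; rewrite /jnorm big_ord_recl big_ord0 addr0.
(* The 1 counts the error of the derivatives; the rest bounds the error at order 0, which is the
   primitive of an error small in L_p and hence in L_1. *)
pose C := 1 + 2 * C1 * Ln p (fun=> 1 : R[i]).
have C0 : 0 < C by rewrite ltr_pwDl// !mulr_ge0.
have jS : jet n (fun s => Y s.+1) by exact: (@jet_shift _ _ _ _ hab hp n 1).
have [q' Hq'] := IH _ _ jS (divr_gt0 e0 C0).
have [Q QE] := poly_antideriv q'.
(* The constant makes [q] agree with [Y 0] at [a], so that the error at order 0 is a primitive
   vanishing at [a]. *)
pose q := Q + (Y 0%N a - Q.[a%:C])%:P.
have q1 s : q^`(s.+1) = q'^`(s).
  by rewrite derivSn /q derivD derivC addr0 QE.
exists q; rewrite jnormS.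
have -> : (fun s t => Y s.+1 t - pjet q s.+1 t) = (fun s t => Y s.+1 t - pjet q' s t).
  by do 2 apply/funext => ?; rewrite /pjet q1.
set X := jnorm n _ in Hq' *.
have X0 : 0 <= X by exact: jnorm_ge0.
have jd := jetB hab hp jS (poly_jet n q').
have j0 := jetB hab hp jY (poly_jet n.+1 q).
have d1 := jet_MLp hab hp jd (leq0n n).
have [d11 h1] := HC1 _ d1.
have bd t : D t -> normc (Y 0%N t - pjet q 0 t) <= 2 * C1 * X.
  rewrite /= in_itv /= => /[dup] tab /andP[at_ tb].
  rewrite (jet_eqJ j0 (ltn0Sn n) tab).
  have -> : Y 0%N a - pjet q 0 a = 0.
    by rewrite /pjet /pev /q /= hornerD hornerC [X in _ - X]addrC subrK subrr.
  rewrite add0r (@J_eq _ a b _ (fun x => Y 1%N x - pjet q' 0 x) _ tb); last first.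
    by move=> x _; rewrite /pjet q1.
  rewrite (le_trans (J_bound d11 at_ tb))// -mulrA ler_wpM2l//.
  by rewrite (le_trans h1)// ler_wpM2l//; exact: (@Ln_jnorm _ _ _ _ n (fun s t => Y s.+1 t - pjet q' s t) 0).
have [m0 _] := jet_MLp hab hp j0 (leq0n _).
have [_ h2] := MLp_bounded hab hp m0 bd.
rewrite (@le_trans _ _ (C * X))//; last by rewrite mulrC -ler_pdivlMr.
by rewrite /C mulrDl mul1r addrC lerD2l (le_trans h2)// mulrAC.
Qed.

End PolynomialJets.

(** * Step functions with jumps in a dense set *)

Section StepFunctions.
Context {R : realType} (a b : R) (hab : a < b).
Local Notation mu := (@lebesgue_measure R).
Local Notation D := (`[a, b]%classic : set R).
Local Notation cmeas := (cmeas a b).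
Local Notation MLp := (MLp a b).
Local Notation Ln := (Ln a b).
Local Notation J := (J a).
Context (P : set R).

(* The extreme points only approach [a] and [b], which need not belong to [P]. *)
Definition grid (d : R) (N : nat) (tau : nat -> R) := [/\
  forall j, (j <= N)%N -> P (tau j) /\ a <= tau j <= b,
  forall j, (j < N)%N -> tau j <= tau j.+1 <= tau j + d,
  tau 0%N <= a + d & b <= tau N + d].

(** [a, b] is cut into N + 1 cells of length [h]; by density the interior of each cell contains a
    point of [P]. Neighbouring points are less than 2 h <= d apart. *)
Lemma grid_exists d : P `<=` `[a, b] -> `[a, b] `<=` closure P -> 0 < d ->
  exists N tau, grid d N tau.
Proof.
move=> PD Pd d0; have ba : 0 < b - a by rewrite subr_gt0.
pose N := Num.bound (2 * (b - a) / d); pose h := (b - a) / N.+1%:R.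
have h0 : 0 < h by rewrite divr_gt0.
have hd : 2 * h <= d.
  have A0 : 0 <= 2 * (b - a) / d by rewrite divr_ge0 ?mulr_ge0 ?(ltW ba) ?(ltW d0).
  have : 2 * (b - a) / d <= N.+1%:R.
    by rewrite (le_trans (ltW (archi_boundP A0)))// ler_nat.
  by rewrite ler_pdivrMr// => H1; rewrite /h mulrA ler_pdivrMr// [leRHS]mulrC.
have hN : a + N.+1%:R * h = b by rewrite /h mulrC divfK ?pnatr_eq0// addrC subrK.
have /choice[tau Htau] : forall j : nat, exists x, (j <= N)%N ->
    [/\ P x, a + j%:R * h < x & x < a + j.+1%:R * h].
  move=> j; have [jN|] := leqP j N; last by exists 0.
  pose c := a + (j%:R + 2^-1) * h.
  have jh : j.+1%:R * h <= N.+1%:R * h by rewrite ler_wpM2r ?ler_nat// ltW.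
  have h20 : 0 < h / 2 by rewrite divr_gt0.
  have jh0 : 0 <= j%:R * h by rewrite mulr_ge0// ltW.
  have jS : j.+1%:R * h = j%:R * h + h by rewrite -natr1 mulrDl mul1r.
  have cE : c = a + (j%:R * h) + h / 2 by rewrite /c mulrDl addrA [2^-1 * h]mulrC.
  have cD : `[a, b]%classic c by rewrite /= in_itv /= -hN; lra.
  have [x [Px /=]] := Pd c cD _ (nbhsx_ballx c (h / 2) h20).
  rewrite /ball /= ltr_norml => /andP[h1 h2].
  by exists x => _; split => //; rewrite ?jS; lra.
have tauD j : (j <= N)%N -> a <= tau j <= b.
  by move=> /Htau[/PD]; rewrite /= in_itv.
exists N, tau; split.
- by move=> j jN; split; [case: (Htau j jN)|exact: tauD].
- move=> j jN; have [_ h1 h2] := Htau j (ltnW jN); have [_ h3 h4] := Htau j.+1 jN.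
  move: h1 h2 h3 h4; rewrite -!natr1 !mulrDl !mul1r => h1 h2 h3 h4; lra.
- by have [_ h1] := Htau 0%N (leq0n N); rewrite mul1r; lra.
- have [_ h1 h2] := Htau N (leqnn N); move: h1 h2 hN.
  by rewrite -natr1 mulrDl mul1r => h1 h2 h3; lra.
Qed.

Definition cut (x t : R) : R[i] := (t <= x)%R%:R.

(** The value is [v j] on ]tau j, tau (j + 1)] and 0 off the grid. Differences of cuts are
    convenient because multiplication by [cut x] truncates an integral at [x], which produces values
    of the primitive at grid points. *)
Definition stepf (N : nat) (tau : nat -> R) (v : nat -> R[i]) t : R[i] :=
  \sum_(j < N) v j * (cut (tau j.+1) t - cut (tau j) t).

Lemma grid_le d N tau i k : grid d N tau -> (i <= k <= N)%N -> tau i <= tau k.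
Proof.
move=> [_ H _ _] /andP[ik kN]; rewrite -(subnK ik) in kN *.
elim: (k - i)%N kN => [//|l IH] lN; apply: (le_trans (IH _)); first exact: ltnW.
by rewrite addSn; have /andP[] := H (l + i)%N lN.
Qed.

Lemma stepf_val d N tau v j t : grid d N tau -> (j < N)%N -> tau j < t -> t <= tau j.+1 ->
  stepf N tau v t = v j.
Proof.
move=> gr jN jt tj; rewrite /stepf (bigD1 (Ordinal jN))//= big1 ?addr0.
  by rewrite /cut tj leNgt jt subr0 mulr1.
move=> i /= ij; rewrite /cut; have [lt|gt|eq] := ltngtP i j; last by case/eqP: ij; apply: val_inj.
  have h1 : tau i.+1 <= tau j by apply: (grid_le gr); rewrite lt ltnW.
  have h2 : tau i <= tau j by apply: (grid_le gr); rewrite (ltnW lt) (ltnW jN).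
  by rewrite !leNgt (le_lt_trans h1 jt) (le_lt_trans h2 jt) subrr mulr0.
have h1 : tau j.+1 <= tau i by apply: (grid_le gr); rewrite gt ltnW.
have h2 : tau j.+1 <= tau i.+1 by apply: (grid_le gr); rewrite ltnW//= ltn_ord.
by rewrite (le_trans tj h1) (le_trans tj h2) subrr mulr0.
Qed.

Lemma grid_locate (N : nat) (tau : nat -> R) t : tau 0%N < t -> t <= tau N ->
  exists j, [/\ (j < N)%N, tau j < t & t <= tau j.+1].
Proof.
move=> t0; elim: N => [|N IH] tN; first by move: (lt_le_trans t0 tN); rewrite ltxx.
have [/IH[j [h1 h2 h3]]|lt] := leP t (tau N); last by exists N.
by exists j; split => //; exact: ltnW.
Qed.

Lemma stepf_out d N tau v t : grid d N tau -> (t <= tau 0%N) || (tau N < t) ->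
  stepf N tau v t = 0.
Proof.
move=> gr h; apply: big1 => j _; rewrite /cut.
have h1 : tau 0%N <= tau j by apply: (grid_le gr); rewrite leq0n ltnW.
have h2 : tau 0%N <= tau j.+1 by apply: (grid_le gr); rewrite leq0n /=.
have h3 : tau j <= tau N by apply: (grid_le gr); rewrite leqnn ltnW.
have h4 : tau j.+1 <= tau N by apply: (grid_le gr); rewrite leqnn andbT.
case/orP: h => h.
  by rewrite (le_trans h h1) (le_trans h h2) subrr mulr0.
by rewrite !leNgt (le_lt_trans h3 h) (le_lt_trans h4 h) subrr mulr0.
Qed.

Lemma stepf_bound d N tau v M t : grid d N tau -> 0 <= M -> (forall j, normc (v j) <= M) ->
  normc (stepf N tau v t) <= M.
Proof.
move=> gr M0 vM; have [out|] := boolP ((t <= tau 0%N) || (tau N < t)).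
  by rewrite (stepf_out _ gr out) ComplexField.Normc.normc0.
rewrite negb_or -ltNge -leNgt => /andP[t0 tN].
by have [j [jN h1 h2]] := grid_locate t0 tN; rewrite (stepf_val _ gr jN h1 h2).
Qed.

Lemma cmeas_cut x : cmeas (cut x).
Proof.
split; rewrite /cut.
  rewrite (_ : (fun t => _) = fun t => if t <= x then 1 else 0 : R).
    by apply: measurable_fun_if => //; apply: measurable_fun_ler => //; exact: measurable_id.
  by apply/funext => t; case: (t <= x).
rewrite (_ : (fun t => _) = fun t => 0 : R); first exact: measurable_cst.
by apply/funext => t; case: (t <= x).
Qed.

Lemma cmeas_stepf N tau v : cmeas (stepf N tau v).
Proof.
by apply: cmeas_sum => j; apply: cmeasZ; apply: cmeasB; exact: cmeas_cut.
Qed.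

Lemma rint_cut (h : R -> R) x : a <= x <= b ->
  \int[mu]_(t in D) ((t <= x)%R%:R * h t) = rJ a h x.
Proof.
move=> /andP[ax xb]; rewrite /rJ /Rintegral; congr fine.
rewrite integral_mkcond [RHS]integral_mkcond; apply: eq_integral => t _; rewrite /patch.
have -> : (t \in D) = (a <= t <= b) by apply/idP/idP; rewrite inE /= in_itv.
have -> : (t \in `[a, x]%classic) = (a <= t <= x) by apply/idP/idP; rewrite inE /= in_itv.
case: (leP a t) => //= _; have [tx|xt] := leP t x; first by rewrite (le_trans tx xb) mul1r.
by rewrite mul0r; case: ifP.
Qed.

Lemma J_cut (h : R -> R[i]) x : a <= x <= b -> J (fun t => cut x t * h t) b = J h x.
Proof.
move=> xab; rewrite !JE; congr (_ +i* _); rewrite -[RHS](rint_cut _ xab) /rJ /Rintegral; congr fine;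
  apply: eq_integral => t _; rewrite /cut; case: (t <= x) => /=;
  by rewrite ?mul1r ?mul0r.
Qed.

Lemma MLp_cut q h x : 1 <= q -> MLp q h -> MLp q (fun t => cut x t * h t).
Proof.
move=> q1 hq; have [] // := MLpM_bounded hab q1 (M := 1) (cmeas_cut x) _ hq => t _.
by rewrite /cut; case: (t <= x); rewrite ?ComplexField.Normc.normc1 ?ComplexField.Normc.normc0.
Qed.

Lemma J_stepf d N tau v h : grid d N tau -> MLp 1 h ->
  J (fun t => stepf N tau v t * h t) b = \sum_(j < N) v j * (J h (tau j.+1) - J h (tau j)).
Proof.
move=> gr h1; have [tauD _ _ _] := gr.
have mc x : MLp 1 (fun t => cut x t * h t) by exact: MLp_cut.
have mB x y : MLp 1 (fun t => cut x t * h t - cut y t * h t).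
  by have [] := MLpB (lexx 1) (mc x) (mc y).
have mZ j : MLp 1 (fun t => v j * (cut (tau j.+1) t * h t - cut (tau j) t * h t)).
  by have [] := MLpZ (lexx 1) (v j) (mB (tau j.+1) (tau j)).
have -> : (fun t => stepf N tau v t * h t) =
    (fun t => \sum_(j < N) v j * (cut (tau j.+1) t * h t - cut (tau j) t * h t)).
  by apply/funext => t; rewrite mulr_suml; apply: eq_bigr => j _; rewrite -mulrA mulrBl.
rewrite (J_sum hab _ (F := fun (j : 'I_N) t => v j * (cut (tau j.+1) t * h t - cut (tau j) t * h t)))//.
apply: eq_bigr => j _; rewrite (JZ (v j) (mB _ _) (lexx b)) (JB (mc _) (mc _) (lexx b)) !J_cut//.
  by have [] := tauD j (ltnW (ltn_ord j)).
by have [] := tauD j.+1 (ltn_ord j).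
Qed.

(** Between grid points uniform continuity applies; before the first and after the last one, on two
    pieces of length at most [d], only the bound [M] is available. The constants [e1] and [d3] allot
    e / 2 to the former and e / 4 to each of the latter. *)
Lemma stepf_near g M e : ccontinuous g -> 0 <= M -> (forall t, normc (g t) <= M) -> 0 < e ->
  exists2 d, 0 < d & forall N tau, grid d N tau ->
    Ln 1 (fun t => g t - stepf N tau (fun j => g (tau j)) t) <= e.
Proof.
move=> cg M0 gM e0; have [c1 c2] := cg; have ba : 0 < b - a by rewrite subr_gt0.
pose e1 := e / (4 * (b - a)).
have e10 : 0 < e1 by rewrite divr_gt0// mulr_gt0.
have [d1 d10 H1] := uniform_contAt (fun t _ => continuous_contAt a b t c1) e10.
have [d2 d20 H2] := uniform_contAt (fun t _ => continuous_contAt a b t c2) e10.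
pose d3 := e / (4 * (M + 1)).
have d30 : 0 < d3 by rewrite divr_gt0// mulr_gt0// ltr_wpDl.
pose d := Num.min (Num.min (d1 / 2) (d2 / 2)) d3.
have d0 : 0 < d by rewrite !lt_min d30 !divr_gt0.
have [dd1 dd2 dd3] : [/\ d < d1, d < d2 & d <= d3].
  split; rewrite /d ?ge_min ?lexx ?orbT// gt_min; apply/orP; left; rewrite gt_min.
    by rewrite ltr_pdivrMr// ltr_pMr// ltr1n.
  by rewrite [d2 / 2 < _]ltr_pdivrMr// ltr_pMr// ltr1n orbT.
exists d => // N tau gr; have [tauD gap ga gb] := gr.
pose w t := 2 * e1 + M * (t <= tau 0%N)%R%:R + M * (1 - (t <= tau N)%R%:R).
have pt t : D t -> normc (g t - stepf N tau (fun j => g (tau j)) t) <= w t.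
  rewrite /= in_itv /= => tab; rewrite /w.
  have [out|] := boolP ((t <= tau 0%N) || (tau N < t)).
    rewrite (stepf_out _ gr out) subr0; have gt := gM t.
    have b1 : 0 <= M * (t <= tau 0%N)%R%:R by rewrite mulr_ge0.
    have b2 : 0 <= M * (1 - (t <= tau N)%R%:R).
      by rewrite mulr_ge0// subr_ge0; case: (t <= tau N).
    case/orP: out => h; first by move: b1 b2; rewrite h mulr1; lra.
    by move: b1 b2; rewrite [t <= tau N]leNgt h subr0 mulr1; lra.
  rewrite negb_or -ltNge -leNgt => /andP[t0 tN].
  have [j [jN h1 h2]] := grid_locate t0 tN; rewrite (stepf_val _ gr jN h1 h2).
  rewrite [t <= tau 0%N]leNgt t0 tN mulr0 subrr mulr0 !addr0.
  have [_ jab] := tauD j (ltnW jN).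
  have /andP[_ gj] := gap j jN.
  have dt : `|t - tau j| <= d by rewrite ger0_norm; lra.
  rewrite (le_trans (normc_le_ReIm _))// ReD ImD ReN ImN mulr_natl mulr2n lerD//.
    by apply: H1 => //; exact: le_lt_trans dt dd1.
  by apply: H2 => //; exact: le_lt_trans dt dd2.
have [_ t0ab] := tauD 0%N (leq0n _); have [_ tNab] := tauD N (leqnn _).
have lenJ x : a <= x <= b -> \int[mu]_(t in D) (t <= x)%R%:R = x - a.
  move=> xab; rewrite (_ : \int[mu]_(t in D) _ = \int[mu]_(t in D) ((t <= x)%R%:R * 1)).
    rewrite (rint_cut (fun=> 1) xab) /rJ Rintegral_cst; last exact: measurable_itv.
    have := lebesgue_measure_itv (`[a, x] : interval R); rewrite /= => ->.
    rewrite lte_fin mul1r; case: ltP => //= h; have /andP[ax _] := xab.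
    by apply/esym/eqP; rewrite subr_eq0 eq_le h.
  by apply: eq_Rintegral => t _; rewrite mulr1.
have icut (x : R) : mu.-integrable D (EFin \o (fun t : R => (t <= x)%R%:R)).
  apply: (bounded_integrable (M := 1)).
    have [m1 _] := cmeas_cut x.
    by apply: eq_measurable_fun m1 => t _; rewrite /cut; case: (t <= x).
  by move=> t _; case: (t <= x); rewrite ?normr1 ?normr0.
have i1 : mu.-integrable D (EFin \o (fun t => 2 * e1 + M * (t <= tau 0%N)%R%:R)).
  by apply: rintD => //; [exact: integrable_cst_itv|apply: rintZ].
have i2 : mu.-integrable D (EFin \o (fun t => M * (1 - (t <= tau N)%R%:R))).
  by apply: rintZ => //; apply: rintB => //; exact: integrable_cst_itv.
rewrite Ln1E; apply: (@le_trans _ _ (\int[mu]_(t in D) w t)).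
  have mg := ccontinuous_cmeas a b cg.
  have [gg _] := MLp_bounded hab (lexx 1) mg (fun t _ => gM t).
  have [ss _] := MLp_bounded hab (lexx 1) (cmeas_stepf N tau (fun j => g (tau j)))
     (fun t _ => stepf_bound t gr M0 (fun j => gM (tau j))).
  have [gs _] := MLpB (lexx 1) gg ss.
  by apply: le_Rintegral => //; [exact: L1_normc|exact: rintD].
have lm : fine (mu D) = b - a.
  by have := lebesgue_measure_itv (`[a, b] : interval R); rewrite /= lte_fin hab => ->.
rewrite RintegralD// RintegralD//; [|exact: integrable_cst_itv|exact: rintZ].
rewrite Rintegral_cst// lm RintegralZl// RintegralZl//; last by apply: rintB => //; exact: integrable_cst_itv.
rewrite RintegralB//; last exact: integrable_cst_itv.
rewrite Rintegral_cst// lm !lenJ// mul1r.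
have -> : 2 * e1 * (b - a) = e / 2 by rewrite /e1; field; rewrite gt_eqF.
have Md : M * d3 <= e / 4.
  have -> : M * d3 = e / 4 * (M / (M + 1)) by rewrite /d3; field; rewrite gt_eqF// ltr_wpDl.
  by rewrite ler_piMr ?divr_ge0 ?(ltW e0)// ler_pdivrMr ?ltr_wpDl// mul1r lerDl.
have u1 : M * (tau 0%N - a) <= M * d3 by rewrite ler_wpM2l//; lra.
have u2 : M * (b - a - (tau N - a)) <= M * d3 by rewrite ler_wpM2l//; lra.
lra.
Qed.

End StepFunctions.

(** * Reduction to L_p coefficients *)

Section Leibniz.
Context {R : realType} (a b p : R).
Context (hab : a < b) (hp : 1 <= p).
Local Notation D := (`[a, b]%classic : set R).
Local Notation MLp := (MLp a b).
Local Notation J := (J a).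
Local Notation jet := (jet a b p).

(** The step from s to s + 1 in Leibniz's rule, with [G q w] in the role of the product of the q-th
    and the w-th derivatives of the two factors. *)
Lemma pascal_sum (V : comPzRingType) (G : nat -> nat -> V) s :
  \sum_(q < s.+1) 'C(s, q)%:R * (G q.+1 (s - q)%N + G q (s - q).+1) =
  \sum_(q < s.+2) 'C(s.+1, q)%:R * G q (s.+1 - q)%N.
Proof.
rewrite [RHS]big_ord_recl /= bin0 mul1r subn0.
rewrite [X in _ = _ + X](eq_bigr (fun q : 'I_s.+1 => 'C(s, q)%:R * G q.+1 (s - q)%N +
   'C(s, q.+1)%:R * G q.+1 (s - q)%N)); last first.
  by move=> q _; rewrite /= subSS binS natrD addrC mulrDl.
rewrite big_split /= addrCA.
rewrite [X in _ = _ + X](_ : _ = \sum_(q < s.+1) 'C(s, q)%:R * G q (s - q).+1).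
  by rewrite -big_split /=; apply: eq_bigr => q _; rewrite mulrDr.
have -> : G 0%N s.+1 + \sum_(q < s.+1) 'C(s, q.+1)%:R * G q.+1 (s - q)%N =
    \sum_(q < s.+2) 'C(s, q)%:R * G q (s.+1 - q)%N.
  by rewrite [RHS]big_ord_recl /= bin0 mul1r subn0; congr (_ + _).
rewrite big_ord_recr /= bin_small// mul0r addr0; apply: eq_bigr => q _.
by rewrite subSn// -ltnS.
Qed.

Definition leib (A Z : nat -> R -> R[i]) s t : R[i] :=
  \sum_(q < s.+1) 'C(s, q)%:R * (A q t * Z (s - q)%N t).

Lemma nice_mul f g : MLp p f -> nice a b g -> MLp p (fun t => f t * g t).
Proof.
move=> fp [mg [M gM] _].
have gM' t : D t -> normc (g t) <= M by rewrite /= in_itv; exact: gM.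
have [h _] := MLpM_bounded hab hp mg gM' fp.
by apply: MLp_eq h => [|t _]; [rewrite (lt_le_trans _ hp)|rewrite mulrC].
Qed.

(** [Z] has one order more than [A]: all orders of [Z] up to n are then nice and may multiply the
    top order of [A], which is merely in L_p. *)
Lemma leib_jet n A Z : jet n A -> jet n.+1 Z -> jet n (leib A Z).
Proof.
move=> jA jZ.
have hm q w : (q <= n)%N -> (w < n.+1)%N -> MLp p (fun t => A q t * Z w t).
  by move=> qn wn; apply: nice_mul; [exact: jet_MLp jA qn|exact: jet_nice jZ wn].
split; last first.
  have h (q : 'I_n.+1) : MLp p (fun t => 'C(n, q)%:R * (A q t * Z (n - q)%N t)).
    have [h _] := MLpZ hp 'C(n, q)%:R (hm q (n - q)%N (ltn_ord q) (leq_ltn_trans (leq_subr q n) (ltnSn n))).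
    exact: h.
  by have [] := MLp_sum hab hp (index_enum 'I_n.+1) h.
move=> s sn t /[dup] tab /andP[at_ tb].
have hm1 q w : (q <= n)%N -> (w < n.+1)%N -> MLp 1 (fun t => A q t * Z w t).
  by move=> qn wn; apply: (L1_Lp hab hp); exact: hm.
have qs (q : 'I_s.+1) : [/\ (q < n)%N, (q <= n)%N, (s - q < n.+1)%N & (s - q < n)%N].
  have := ltn_ord q; rewrite ltnS => qs.
  have h1 : (q < n)%N by exact: leq_ltn_trans sn.
  have h2 : (s - q < n)%N by exact: leq_ltn_trans (leq_subr _ _) sn.
  by split => //; [exact: ltnW|exact: ltnW].
have h (q : 'I_s.+1) : MLp 1 (fun t => A q.+1 t * Z (s - q)%N t + A q t * Z (s - q).+1 t).
  have [h1 h2 h3 h4] := qs q.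
  by have [] := MLpD (lexx 1) (hm1 q.+1 (s - q)%N h1 h3) (hm1 q (s - q).+1 h2 h4).
have -> : J (leib A Z s.+1) t = \sum_(q < s.+1) 'C(s, q)%:R *
    J (fun x => A q.+1 x * Z (s - q)%N x + A q x * Z (s - q).+1 x) t.
  rewrite (@J_eq _ a b _ (fun x => \sum_(q < s.+1) 'C(s, q)%:R *
     (A q.+1 x * Z (s - q)%N x + A q x * Z (s - q).+1 x)) _ tb); last first.
    by move=> x _; rewrite /leib -(pascal_sum (fun q w => A q x * Z w x)).
  have hZ (q : 'I_s.+1) : MLp 1 (fun x => 'C(s, q)%:R *
      (A q.+1 x * Z (s - q)%N x + A q x * Z (s - q).+1 x)).
    by have [] := MLpZ (lexx 1) 'C(s, q)%:R (h q).
  rewrite (J_sum hab _ hZ tb); apply: eq_bigr => q _.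
  by rewrite (JZ _ (h q) tb).
rewrite /leib -big_split /=; apply: eq_bigr => q _; rewrite -mulrDr; congr (_ * _).
have [h1 h2 h3 h4] := qs q.
apply: (J_prod hab (jet_L1 hab hp jA h1) (jet_L1 hab hp jZ h3)) tab.
- by move=> x xab; exact: jet_eqJ jA h1 xab.
- by move=> x xab; exact: jet_eqJ jZ h3 xab.
Qed.

(** Otherwise a nondegenerate subinterval of [a, b] next to [t] would be a null set. *)
Lemma ae_on_dense (Pr : R -> Prop) t d : ae_on a b Pr -> a <= t <= b -> 0 < d ->
  exists u, [/\ a <= u <= b, `|u - t| < d & Pr u].
Proof.
move=> H tab d0; apply: contrapT => nex.
pose x := Num.max a (t - d / 2); pose y := Num.min b (t + d / 2).
have d20 : 0 < d / 2 by rewrite divr_gt0.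
have /andP[at_ tb] := tab.
have xy : x < y.
  rewrite /x /y gt_max !lt_min hab /=; apply/andP; split; first lra.
  by apply/andP; split; lra.
case: H => N [mN N0 sN].
have sub : `]x, y[%classic `<=` N.
  move=> u /=; rewrite in_itv /= => /andP[]; rewrite /x /y gt_max lt_min => /andP[h1 h2] /andP[h3 h4].
  apply: sN => /= Pu; apply: nex; exists u.
  have uab : a <= u <= b by rewrite !ltW.
  split => //; last by apply: Pu; rewrite in_itv.
  by rewrite ltr_norml; apply/andP; split; lra.
have mI : measurable (`]x, y[%classic : set R) by exact: measurable_itv.
have : (@lebesgue_measure R `]x, y[%classic <= 0)%E.
  rewrite -[leRHS]N0; apply: (@le_measure _ _ _ (@lebesgue_measure R)); [exact: (mem_set mI)|exact: (mem_set mN)|exact: sub].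
have := lebesgue_measure_itv (`]x, y[ : interval R); rewrite /= lte_fin xy => ->.
by rewrite -EFinB lee_fin leNgt subr_gt0 xy.
Qed.

Lemma ccont_ae0 f : (forall t, a <= t <= b -> ccont a b f t) -> ae_on a b (fun t => f t = 0) ->
  forall t, a <= t <= b -> f t = 0.
Proof.
move=> cf f0 t tab; have [c1 c2] := cf t tab.
have key (h : R -> R) : contAt a b h t -> ae_on a b (fun t => h t = 0) -> h t = 0.
  move=> ch h0; apply: contrapT => /eqP hn.
  have hn0 : 0 < `|h t| by rewrite normr_gt0.
  have [d d0 Hd] := ch `|h t| hn0.
  have [u [uab ut hu]] := ae_on_dense h0 tab d0.
  by have := Hd u uab ut; rewrite hu sub0r normrN ltxx.
apply: complex_eqP; [apply: (key _ c1)|apply: (key _ c2)];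
  by apply: ae_onS f0 => x _ ->.
Qed.

(** This lets the equation, an identity almost everywhere, be differentiated. Below the top order
    continuity turns it into an identity everywhere, and the derivatives of the zero function are
    zero. *)
Lemma jet_ae_eq0 n Z : jet n Z -> ae_on a b (fun t => Z 0%N t = 0) ->
  (forall s t, (s < n)%N -> a <= t <= b -> Z s t = 0) /\ ae_on a b (fun t => Z n t = 0).
Proof.
move=> jZ Z0.
have cst0 t : cdq a b (fun=> 0) t 0 by split; exact: dq_cst.
have H s : (s < n)%N -> forall t, a <= t <= b -> Z s t = 0.
  elim: s => [|s IH] sn t tab.
    by apply: (ccont_ae0 _ Z0 tab) => x xab; have [_ _] := jet_nice hab hp jZ sn; apply.
  have h := jet_cdq hab hp jZ sn tab.
  rewrite -(cdq_derive hab tab h); apply: (cdq_derive hab tab).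
  by apply: cdq_eq (cst0 t) => // x xab; rewrite (IH (ltnW sn)).
split; first by move=> s t sn; exact: H.
case: n jZ H => [//|n] jZ H.
have := jet_cdq_ae hab hp jZ (ltnSn n); apply: ae_onS => t; rewrite in_itv /= => tab h.
rewrite -(cdq_derive hab tab h); apply: (cdq_derive hab tab).
by apply: cdq_eq (cst0 t) => // x xab; rewrite H.
Qed.

End Leibniz.

Section Reduction.
Context {R : realType} (a b p : R).
Context (hab : a < b) (hp : 1 <= p).
Context (n m r : nat) (hr : (0 < r)%N).
Local Notation jet := (jet a b p).
Local Notation rep := (rep a b).
Local Notation K := (n + r)%N.
Local Notation I := ('I_r * 'I_m * 'I_n.+1)%type.
Local Notation inX := (@inX _ a b p m K).
Local Notation fam := (@fam R m).

(** The index [(j, l, q)] stands for the term of Leibniz's rule for (A_j y^(j))^(n) in which the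
    q-th derivative of A_j multiplies y_l^(j + n - q). *)
Definition lI (ka : I) : 'I_m := ka.1.2.
Definition sI (ka : I) : nat := (ka.1.1 + (n - ka.2))%N.

Lemma sI_lt ka : (sI ka < K)%N.
Proof.
rewrite /sI [X in (_ < X)%N]addnC; case: ka => [[j l] q] /=.
by rewrite -addSn leq_add// leq_subr.
Qed.


Definition cjets := 'I_r -> 'I_m -> 'I_m -> nat -> R -> R[i].
Implicit Types (A : cjets) (Y Z : fam).

Definition inA A := forall j i l, jet n (A j i l).

Definition cA A : @coefs R m I := fun i ka t => 'C(n, ka.2)%:R * A ka.1.1 i ka.1.2 ka.2 t.

(* The s-th derivative of L y. *)
Definition lop A Y i s t : R[i] :=
  Y i (r + s)%N t + \sum_j \sum_l leib (A j i l) (fun s => Y l (j + s)%N) s t.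

Local Notation cop := (@cop R m K I lI sI).

Lemma lop_top A Y i t : lop A Y i n t = cop (cA A) Y i t.
Proof.
have -> : cop (cA A) Y i t = Y i K t + \sum_ka cA A i ka t * Y (lI ka) (sI ka) t by [].
rewrite /lop addnC; congr (_ + _); rewrite /leib !pair_bigA /=.
by apply: eq_bigr => [[[j l] q]] _; rewrite /cA /= mulrA.
Qed.

Lemma cA_Lp A : inA A -> cLp a b p (cA A).
Proof.
move=> hA i [[j l] q].
have [h _] := MLpZ hp 'C(n, q)%:R (jet_MLp hab hp (hA j i l) (ltn_ord q)).
exact: h.
Qed.

Lemma shift_jet Y l (j : 'I_r) : inX Y -> jet n.+1 (fun s => Y l (j + s)%N).
Proof.
move=> hY; apply: (jet_shift hab hp); apply: (jet_le hab hp _ (hY l)).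
by rewrite addnS [X in (_ < X)%N]addnC ltn_add2r.
Qed.

Lemma lop_jet A Y i : inA A -> inX Y -> jet n (lop A Y i).
Proof.
move=> hA hY; apply: (jetD hab hp).
  by apply: (jet_shift hab hp); apply: (jet_le hab hp _ (hY i)); rewrite addnC.
apply: (jet_sum hab hp) => j; apply: (jet_sum hab hp) => l.
by apply: leib_jet => //; exact: shift_jet.
Qed.

Lemma lop_linear A (z : R[i]) Y Z i s t :
  lop A (addX Y (scaleX z Z)) i s t = lop A Y i s t + z * lop A Z i s t.
Proof.
rewrite /lop /addX /scaleX mulrDr mulr_sumr addrACA; congr (_ + _).
rewrite -big_split /=; apply: eq_bigr => j _; rewrite mulr_sumr -big_split /=.
apply: eq_bigr => l _; rewrite /leib mulr_sumr -big_split /=; apply: eq_bigr => q _.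
by ring.
Qed.

Definition repX Y (y : R -> 'cV[R[i]]_m) := forall i, rep K (fun t => y t i 0) (Y i).

Definition repA A (Am : 'I_r -> R -> 'M[R[i]]_m) :=
  forall j i l, rep n (fun t => Am j t i l) (A j i l).

Definition repF (F : 'I_m -> nat -> R -> R[i]) (f : R -> 'cV[R[i]]_m) :=
  forall i, rep n (fun t => f t i 0) (F i).

Lemma rep_lt k f (Y : nat -> R -> R[i]) s : (s < k)%N -> rep k f Y ->
  forall t, a <= t <= b -> derive_in_n a b s f t = Y s t.
Proof. by move=> sk [H _] t; exact: H. Qed.

Lemma rep_ae k f (Y : nat -> R -> R[i]) s : (s <= k)%N -> rep k f Y ->
  ae_on a b (fun t => derive_in_n a b s f t = Y s t).
Proof.
rewrite leq_eqVlt => /predU1P[->|sk] [h1 h2] //.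
by apply: ae_onT => t; rewrite in_itv; exact: h1.
Qed.

Lemma ae_on_forall (T : finType) (Pr : T -> R -> Prop) :
  (forall x, ae_on a b (Pr x)) -> ae_on a b (fun t => forall x, Pr x t).
Proof.
move=> H; suff h (s : seq T) : ae_on a b (fun t => forall x, x \in s -> Pr x t).
  by apply: ae_onS (h (enum T)) => t _ H' x; apply: H'; rewrite mem_enum.
elim: s => [|y s IH]; first by apply: ae_onT.
apply: ae_onS (ae_onI (H y) IH) => t _ [h1 h2] x; rewrite inE => /predU1P[->//|].
exact: h2.
Qed.

Lemma diff_op_lop A Am Y y : repA A Am -> repX Y y ->
  ae_on a b (fun t => forall i, diff_op a b Am y t i 0 = lop A Y i 0%N t).
Proof.
move=> rA rY.
have h1 : ae_on a b (fun t => forall i, derive_in_n a b r (fun u => y u i 0) t = Y i r t).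
  by apply: ae_on_forall => i; apply: rep_ae (rY i); exact: leq_addl.
have h2 : ae_on a b (fun t => forall x : 'I_r * 'I_m * 'I_m,
    Am x.1.1 t x.1.2 x.2 = A x.1.1 x.1.2 x.2 0%N t).
  by apply: ae_on_forall => [[[j i] l]]; apply: (rep_ae (leq0n n) (rA j i l)).
move: (ae_onI h1 h2); apply: ae_onS => t; rewrite in_itv /= => tab [g1 g2] i.
rewrite /diff_op !mxE /lop addn0 g1; congr (_ + _); rewrite summxE; apply: eq_bigr => j _.
rewrite mxE; apply: eq_bigr => l _.
rewrite /leib big_ord_recl big_ord0 addr0 /= bin0 mul1r addn0 (g2 (j, i, l)); congr (_ * _).
rewrite mxE (rep_lt _ (rY l))//.
by rewrite (leq_trans (ltn_ord j))// leq_addl.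
Qed.

Lemma diff_op_top A Am Y y F f : inA A -> repA A Am -> inX Y -> repX Y y ->
  (forall i, jet n (F i)) -> repF F f ->
  ae_on a b (fun t => diff_op a b Am y t = f t) ->
  (forall i s t, (s < n)%N -> a <= t <= b -> lop A Y i s t = F i s t) /\
  (forall i, ae_on a b (fun t => cop (cA A) Y i t = F i n t)).
Proof.
move=> hA rA hY rY hF rF H.
have h i : ae_on a b (fun t => lop A Y i 0%N t - F i 0%N t = 0).
  move: (ae_onI H (ae_onI (diff_op_lop rA rY) (rep_ae (leq0n n) (rF i)))).
  by apply: ae_onS => t _ [h1 [/(_ i) h2 h3]]; rewrite -h2 h1 -h3 subrr.
have k i := jet_ae_eq0 hab hp (jetB hab hp (lop_jet i hA hY) (hF i)) (h i).
split=> i.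
  by move=> s t sn tab; have [/(_ s t sn tab) /eqP + _] := k i; rewrite subr_eq0 => /eqP.
have [_] := k i; apply: ae_onS => t _ /eqP; rewrite subr_eq0 => /eqP.
by rewrite lop_top.
Qed.

Definition colX Y (t : R) : 'cV[R[i]]_m := \col_i Y i 0%N t.

Lemma colX_rep Y : inX Y -> repX Y (colX Y).
Proof.
move=> hY i; apply: (jet_rep hab hp (hY i)).
  by move=> t _ _; rewrite mxE.
by apply: ae_onT => t _; rewrite mxE.
Qed.

Lemma repX_sobolev Y y : inX Y -> repX Y y -> min_sobolev a b K p y.
Proof.
by move=> hY rY i j; rewrite (ord1 j); apply: (rep_sobolev hab hp (hY i)); exact: rY.
Qed.

Lemma sobolev_repX y : min_sobolev a b K p y -> exists2 Y, inX Y & repX Y y.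
Proof.
move=> hy; have /choice[Y HY] : forall i, exists Z : nat -> R -> R[i], jet K Z /\ rep K (fun t => y t i 0) Z.
  by move=> i; have [Z h1 h2] := sobolev_rep hab hp (hy i 0); exists Z.
by exists Y => i; have [] := HY i.
Qed.

(** Converse of [diff_op_top]: the equation of order n + r is integrated n times, and the values at
    [a] fix the constants of integration. *)
Lemma lop_solve A Am Y F f : inA A -> repA A Am -> inX Y ->
  (forall i, jet n (F i)) -> repF F f ->
  (forall i t, a <= t <= b -> cop (cA A) Y i t = F i n t) ->
  (forall i s, (s < n)%N -> lop A Y i s a = F i s a) ->
  ae_on a b (fun t => diff_op a b Am (colX Y) t = f t).
Proof.
move=> hA rA hY hF rF top low.
have H i s : (s <= n)%N -> forall t, a <= t <= b -> lop A Y i (n - s)%N t = F i (n - s)%N t.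
  elim: s => [|s IH] sn t /[dup] tab /andP[at_ tb]; first by rewrite subn0 lop_top top.
  have e : (n - s)%N = (n - s.+1).+1 by rewrite subnSK.
  have lt : (n - s.+1 < n)%N by rewrite -subSn// subSS leq_subr.
  rewrite (jet_eqJ (lop_jet i hA hY) lt tab) (jet_eqJ (hF i) lt tab) low//; congr (_ + _).
  by apply: J_eq tb _ => x xab; rewrite -e IH// ltnW.
have h0 i t : a <= t <= b -> lop A Y i 0%N t = F i 0%N t.
  by move=> tab; have := H i n (leqnn n) t tab; rewrite subnn.
have hf : ae_on a b (fun t => forall i, f t i 0 = F i 0%N t).
  by apply: ae_on_forall => i; exact: (rep_ae (leq0n n) (rF i)).
move: (ae_onI (diff_op_lop rA (colX_rep hY)) hf); apply: ae_onS => t; rewrite in_itv /= => tab [h1 h2].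
by apply/matrixP => i j; rewrite (ord1 j) h1 h2 h0.
Qed.

End Reduction.

Section Boundary.
Context {R : realType} (a b p : R).
Context (hab : a < b) (hp : 1 <= p).
Context (n m r : nat) (hr : (0 < r)%N).
Local Notation MLp := (MLp a b).
Local Notation Ln := (Ln a b).
Local Notation J := (J a).
Local Notation jet := (jet a b p).
Local Notation jnorm := (jnorm a b p).
Local Notation rep := (rep a b).
Local Notation K := (n + r)%N.
Local Notation inX := (@inX _ a b p m K).
Local Notation fam := (@fam R m).
Local Notation inA := (@inA _ a b p n m r).
Local Notation cjets := (@cjets R m r).
Local Notation lop := (@lop R m r).
Local Notation fnorm := (@fnorm _ a b p m K).
Local Notation cop := (@cop R m K _ (@lI n m r) (@sI n m r)).
Local Notation repX := (@repX _ a b n m r).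
Implicit Types (A : cjets) (Y Z : fam).

Let p0 : 0 < p. Proof. by rewrite (lt_le_trans _ hp). Qed.

Definition adist A A' := \sum_i \sum_j \sum_l jnorm n (fun s t => A j i l s t - A' j i l s t).

Lemma adist_ge0 A A' : 0 <= adist A A'.
Proof. by do 3 (apply: sumr_ge0 => ? _); exact: jnorm_ge0. Qed.

Lemma jnorm_adist A A' j i l : jnorm n (fun s t => A j i l s t - A' j i l s t) <= adist A A'.
Proof.
apply: (le_trans (@ler_sum_mem _ _ (fun l => jnorm n (fun s t => A j i l s t - A' j i l s t)) l _)).
  by move=> k; exact: jnorm_ge0.
apply: (le_trans (@ler_sum_mem _ _ (fun j => \sum_l jnorm n (fun s t => A j i l s t - A' j i l s t)) j _)).
  by move=> k; apply: sumr_ge0 => ? _; exact: jnorm_ge0.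
apply: (@ler_sum_mem _ _ (fun i => \sum_j \sum_l jnorm n (fun s t => A j i l s t - A' j i l s t))) => k.
by do 2 (apply: sumr_ge0 => ? _); exact: jnorm_ge0.
Qed.

Lemma normc_nat k : normc (k%:R : R[i]) = k%:R.
Proof. by rewrite -(rmorph_nat (real_complex R)) normc_real normr_nat. Qed.

Lemma adist_triangle A A' A'' : inA A -> inA A' -> inA A'' ->
  adist A A'' <= adist A A' + adist A' A''.
Proof.
move=> hA hA' hA''; rewrite /adist -big_split /=; apply: ler_sum => i _.
rewrite -big_split /=; apply: ler_sum => j _; rewrite -big_split /=; apply: ler_sum => l _.
have := jnormD hab hp (jetB hab hp (hA j i l) (hA' j i l)) (jetB hab hp (hA' j i l) (hA'' j i l)).
by congr (jnorm n _ <= _); do 2 (apply/funext => ?); rewrite addrA subrK.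
Qed.

Lemma cdist_adist : exists2 C : R, 0 <= C & forall A A', inA A -> inA A' ->
  cdist a b p (cA A) (cA A' : @coefs R m ('I_r * 'I_m * 'I_n.+1)%type) <= C * adist A A'.
Proof.
pose W : R := \sum_(q < n.+1) 'C(n, q)%:R.
have W0 : 0 <= W by apply: sumr_ge0 => q _.
exists W => // A A' hA hA'; rewrite /cdist /adist mulr_sumr; apply: ler_sum => i _.
rewrite pair_bigA /= -(pair_bigA _ (fun (x : 'I_r * 'I_m) (q : 'I_n.+1) =>
  Ln p (fun t => cA A i (x, q) t - cA A' i (x, q) t))) /= mulr_sumr.
apply: ler_sum => -[j l] _ /=; rewrite mulr_suml; apply: ler_sum => q _.
have [d _] := MLpB hp (jet_MLp hab hp (hA j i l) (ltn_ord q)) (jet_MLp hab hp (hA' j i l) (ltn_ord q)).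
have [_ h] := MLpZ hp 'C(n, q)%:R d.
rewrite (_ : (fun t => _) = (fun t => 'C(n, q)%:R * (A j i l q t - A' j i l q t))).
  rewrite h normc_nat ler_wpM2l//.
  by rewrite (@Ln_jnorm _ _ _ p n (fun s t => A j i l s t - A' j i l s t))// -ltnS.
by apply/funext => t; rewrite /cA /= mulrBr.
Qed.

Lemma leibB (A A' Z : nat -> R -> R[i]) s t : leib A Z s t - leib A' Z s t =
  leib (fun s t => A s t - A' s t) Z s t.
Proof. by rewrite /leib -sumrB; apply: eq_bigr => q _; ring. Qed.

(** At the point [a] and for [s < n] only derivatives below the top orders of [A] and [Y] occur, and
    their values are controlled by the norms. *)
Lemma lop_diff : exists2 C : R, 0 <= C & forall A A' Y i s, inA A -> inA A' -> inX Y ->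
  (s < n)%N -> normc (lop A Y i s a - lop A' Y i s a) <= C * adist A A' * fnorm Y.
Proof.
have [C1 C10 HC1] := jet_sup_jnorm hab hp.
have [C2 C20 HC2] := @fam_sup _ a b p hab hp m K.
have aab : a <= a <= b by rewrite lexx ltW.
pose W : R := \sum_(s < n) \sum_(q < s.+1) 'C(s, q)%:R.
have W0 : 0 <= W by apply: sumr_ge0 => s _; apply: sumr_ge0.
exists (\sum_(j < r) \sum_(l < m) (W * C1 * C2)).
  by apply: sumr_ge0 => j _; apply: sumr_ge0 => l _; rewrite !mulr_ge0.
move=> A A' Y i s hA hA' hY sn.
have -> : lop A Y i s a - lop A' Y i s a = \sum_j \sum_l
    leib (fun s t => A j i l s t - A' j i l s t) (fun s => Y l (j + s)%N) s a.
  rewrite /lop opprD addrACA subrr add0r -sumrB; apply: eq_bigr => j _.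
  by rewrite -sumrB; apply: eq_bigr => l _; rewrite leibB.
rewrite (le_trans (normc_sum _ _ _))// 2!mulr_suml; apply: ler_sum => j _.
rewrite (le_trans (normc_sum _ _ _))// 2!mulr_suml; apply: ler_sum => l _.
rewrite /leib (le_trans (normc_sum _ _ _))//.
have sW : \sum_(q < s.+1) 'C(s, q)%:R <= W.
  apply: (@ler_sum_mem _ _ (fun s : 'I_n => \sum_(q < s.+1) 'C(s, q)%:R) (Ordinal sn)) => k.
  by apply: sumr_ge0.
have b0 : 0 <= C1 * adist A A' * (C2 * fnorm Y).
  by rewrite !mulr_ge0 ?adist_ge0 ?fnorm_ge0.
rewrite (@le_trans _ _ ((\sum_(q < s.+1) 'C(s, q)%:R) * (C1 * adist A A' * (C2 * fnorm Y))))//; last first.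
  by rewrite (le_trans (ler_wpM2r b0 sW))// le_eqVlt; apply/orP; left; apply/eqP; ring.
rewrite mulr_suml; apply: ler_sum => q _; rewrite !normcM normc_nat ler_wpM2l//.
have qn : (q < n)%N by apply: leq_trans sn; exact: ltn_ord.
have jK : (j + (s - q) < K)%N.
  by rewrite [X in (_ < X)%N]addnC -addSn leq_add// (leq_trans (leq_subr _ _))// ltnW.
rewrite ler_pM ?normc_ge0//; last exact: HC2.
rewrite (le_trans (HC1 _ _ _ _ (jetB hab hp (hA j i l) (hA' j i l)) qn aab))// ler_wpM2l//.
exact: jnorm_adist.
Qed.

Context (t0 : R) (ht0 : a <= t0 <= b).
Local Notation row := 'I_(r * m).

Definition bform (al : 'I_K -> 'M[R[i]]_(r * m, m)) (phi : row -> 'I_m -> R -> R[i]) Y q : R[i] :=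
  \sum_(s < K) \sum_i al s q i * Y i s t0 + \sum_i J (fun t => phi q i t * Y i K t) b.

(* [f] acts as a functional of norm at most [ka] on L_p; this covers both the
   Hoelder pairing for p > 1 and bounded kernels for p = 1. *)
Definition dualp (ka : R) (f : R -> R[i]) := forall h, MLp p h ->
  MLp 1 (fun t => f t * h t) /\ Ln 1 (fun t => f t * h t) <= ka * Ln p h.

Lemma bform_linear ka al phi Y z Z q : (forall q i, dualp ka (phi q i)) -> inX Y -> inX Z ->
  bform al phi (addX Y (scaleX z Z)) q = bform al phi Y q + z * bform al phi Z q.
Proof.
move=> hphi hY hZ; rewrite /bform mulrDr !mulr_sumr addrACA -!big_split /=; congr (_ + _).
  apply: eq_bigr => s _; rewrite mulr_sumr -big_split /=; apply: eq_bigr => i _.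
  by rewrite /addX /scaleX; ring.
apply: eq_bigr => i _.
have [h1 _] := hphi q i _ (jet_MLp hab hp (hY i) (leqnn _)).
have [h2 _] := hphi q i _ (jet_MLp hab hp (hZ i) (leqnn _)).
have [h3 _] := MLpZ (lexx 1) z h2.
rewrite -(JZ z h2 (lexx b)) -(JD h1 h3 (lexx b)).
by congr J; apply/funext => t; rewrite /addX /scaleX; ring.
Qed.

Lemma Ln_fnorm Y i : Ln p (Y i K) <= fnorm Y.
Proof.
rewrite (le_trans (@Ln_jnorm _ a b p K (Y i) K (leqnn _)))//.
by apply: (@ler_sum_mem _ _ (fun i => jnorm K (Y i))) => j; exact: jnorm_ge0.
Qed.

(** The constant depends on [al] alone, so that all kernels with the same [ka] share one bound. *)
Lemma bform_bound al : exists2 C : R, 0 <= C & forall ka phi Y q, 0 <= ka ->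
  (forall q i, dualp ka (phi q i)) -> inX Y ->
  normc (bform al phi Y q) <= (C + m%:R * (2 * ka)) * fnorm Y.
Proof.
have [C2 C20 HC2] := @fam_sup _ a b p hab hp m K.
exists (\sum_q \sum_(s < K) \sum_i (normc (al s q i) * C2)).
  by do 3 (apply: sumr_ge0 => ? _); rewrite mulr_ge0 ?normc_ge0.
move=> ka phi Y q ka0 hphi hY; rewrite mulrDl (le_trans (normc_triangle _ _))// lerD//.
  rewrite (@le_trans _ _ ((\sum_(s < K) \sum_i (normc (al s q i) * C2)) * fnorm Y))//.
    rewrite mulr_suml (le_trans (normc_sum _ _ _))//; apply: ler_sum => s _.
    rewrite mulr_suml (le_trans (normc_sum _ _ _))//; apply: ler_sum => i _.
    by rewrite normcM -mulrA ler_wpM2l ?normc_ge0// HC2.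
  rewrite ler_wpM2r ?fnorm_ge0//.
  apply: (@ler_sum_mem _ _ (fun q => \sum_(s < K) \sum_i (normc (al s q i) * C2))) => k.
  by do 2 (apply: sumr_ge0 => ? _); rewrite mulr_ge0 ?normc_ge0.
rewrite (le_trans (normc_sum _ _ _))// -mulrA -[m in m%:R]card_ord [leRHS]mulr_natl -sumr_const.
apply: ler_sum => i _; have [h1 h2] := hphi q i _ (jet_MLp hab hp (hY i) (leqnn _)).
rewrite (le_trans (J_bound h1 (ltW hab) (lexx b)))// -mulrA ler_wpM2l//.
by rewrite (le_trans h2)// ler_wpM2l// Ln_fnorm.
Qed.

(* Differentiating L y = f n times loses (L y)^(s)(a) = f^(s)(a) for s < n; these
   conditions are appended to the boundary conditions. *)
Definition bform_ext A al phi Y (q : row + 'I_n * 'I_m) : R[i] :=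
  match q with inl q => bform al phi Y q | inr si => lop A Y si.2 si.1 a end.

(** One identity yields additivity, at z = 1, and homogeneity, by writing z Y as Y + (z - 1) Y. *)
Lemma blin_of_linear (Q : finType) (be : R) (B : fam -> Q -> R[i]) :
  (forall Y z Z q, inX Y -> inX Z -> B (addX Y (scaleX z Z)) q = B Y q + z * B Z q) ->
  (forall Y q, inX Y -> normc (B Y q) <= be * fnorm Y) -> blin a b p K be B.
Proof.
move=> lin bound; split => //.
  move=> Y Z q hY hZ; rewrite -[B Z q]mul1r -lin//; congr B.
  by do 3 apply/funext => ?; rewrite /addX /scaleX mul1r.
move=> z Y q hY.
have -> : scaleX z Y = addX Y (scaleX (z - 1) Y).
  by do 3 apply/funext => ?; rewrite /addX /scaleX; ring.
by rewrite lin//; ring.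
Qed.

Lemma inA0 : inA (fun _ _ _ _ _ => 0).
Proof. by move=> j i l; exact: jet0. Qed.

Lemma bform_ext_blin al : exists2 C : R, 0 <= C & forall ka A phi, 0 <= ka -> inA A ->
  (forall q i, dualp ka (phi q i)) ->
  blin a b p K (C * (1 + ka + adist A (fun _ _ _ _ _ => 0))) (bform_ext A al phi).
Proof.
have [C1 C10 HC1] := bform_bound al.
have [C2 C20 HC2] := @fam_sup _ a b p hab hp m K.
have [C3 C30 HC3] := lop_diff.
have aab : a <= a <= b by rewrite lexx ltW.
exists (C1 + 2 * m%:R + C2 + C3); first by rewrite !addr_ge0// mulr_ge0.
move=> ka A phi ka0 hA hphi; apply: blin_of_linear.
  move=> Y z Z [q|[s i]] hY hZ /=; first exact: bform_linear.
  exact: lop_linear.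
move=> Y q hY; have F0 := @fnorm_ge0 _ a b p m K Y.
have d0 := adist_ge0 A (fun _ _ _ _ _ => 0).
have m0 : 0 <= m%:R :> R by [].
case: q => [q|[s i]] /=.
  rewrite (le_trans (HC1 ka phi Y q ka0 hphi hY))// ler_wpM2r// -subr_ge0; set d := adist _ _.
  have -> : (C1 + 2 * m%:R + C2 + C3) * (1 + ka + d) - (C1 + m%:R * (2 * ka)) =
    (2 * m%:R + C2 + C3) + (C1 + C2 + C3) * ka + (C1 + 2 * m%:R + C2 + C3) * d by ring.
  by rewrite !addr_ge0 ?mulr_ge0 ?addr_ge0 ?mulr_ge0.
have -> : lop A Y i s a = Y i (r + s)%N a +
    (lop A Y i s a - lop (fun _ _ _ _ _ => 0) Y i s a).
  rewrite {3}/lop big1; first by rewrite addr0 addrC subrK.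
  by move=> j _; apply: big1 => l _; apply: big1 => k _; rewrite mul0r mulr0.
have rs : (r + s < K)%N by rewrite [X in (_ < X)%N]addnC ltn_add2l.
rewrite (le_trans (normc_triangle _ _))//.
have h1 := HC2 Y i (r + s)%N a hY rs aab.
have h2 := HC3 A _ Y i s hA inA0 hY (ltn_ord s).
rewrite (le_trans (lerD h1 h2))// -mulrDl ler_wpM2r// -subr_ge0; set d := adist _ _.
have -> : (C1 + 2 * m%:R + C2 + C3) * (1 + ka + d) - (C2 + C3 * d) =
  (C1 + 2 * m%:R + C3) + (C1 + 2 * m%:R + C2 + C3) * ka + (C1 + 2 * m%:R + C2) * d by ring.
by rewrite !addr_ge0 ?mulr_ge0 ?addr_ge0 ?mulr_ge0.
Qed.

(** The kernel of the statement enters only through an almost everywhere equal [phi], whose products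
    with L_p functions are integrable. *)
Lemma boundary_opE ka (al : 'I_K -> 'M[R[i]]_(r * m, m)) (Phi : R -> 'M[R[i]]_(r * m, m))
    (phi : row -> 'I_m -> R -> R[i]) Y y q : inX Y -> repX Y y ->
  (forall q i, ae_on a b (fun t => Phi t q i = phi q i t)) -> (forall q i, dualp ka (phi q i)) ->
  boundary_op a b t0 al Phi y q 0 = bform al phi Y q.
Proof.
move=> hY rY hae hphi; rewrite /boundary_op mxE summxE /bform; congr (_ + _).
  apply: eq_bigr => s _; rewrite mxE; apply: eq_bigr => i _.
  by rewrite mxE (rep_lt (ltn_ord s) (rY i) ht0).
rewrite mxE -[LHS]/(J (fun t => (Phi t *m mderive_n a b K y t) q 0) b).
have hm i : MLp 1 (fun t => phi q i t * Y i K t).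
  by have [] := hphi q i _ (jet_MLp hab hp (hY i) (leqnn _)).
rewrite -(J_sum hab _ hm (lexx b)); apply: (@J_eq_ae _ a b) => //.
have h1 : ae_on a b (fun t => forall i, Phi t q i = phi q i t).
  exact: ae_on_forall.
have h2 : ae_on a b (fun t => forall i, derive_in_n a b K (fun u => y u i 0) t = Y i K t).
  by apply: ae_on_forall => i; apply: rep_ae (rY i).
move: (ae_onI h1 h2); apply: ae_onS => t _ [g1 g2].
by rewrite mxE; apply: eq_bigr => i _; rewrite g1 mxE g2.
Qed.

(* Summation by parts of the integral of a step function against a derivative. *)
Definition beta_of (N : nat) (v : row -> 'I_m -> nat -> R[i]) (j : nat) : 'M[R[i]]_(r * m, m) :=
  \matrix_(q, i) ((if j is j'.+1 then v q i j' else 0) - (if (j < N)%N then v q i j else 0)).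

Lemma abel_sum (V : comPzRingType) (N : nat) (v y : nat -> V) :
  \sum_(j < N.+1) ((if (j : nat) is j'.+1 then v j' else 0) - (if (j < N)%N then v j else 0)) * y j =
  \sum_(j < N) v j * (y j.+1 - y j).
Proof.
rewrite (eq_bigr (fun j : 'I_N.+1 => (if (j : nat) is j'.+1 then v j' else 0) * y j -
   (if (j < N)%N then v j else 0) * y j)); last by move=> j _; rewrite mulrBl.
rewrite sumrB big_ord_recl /= mul0r add0r [X in _ - X]big_ord_recr /= ltnn mul0r addr0.
by rewrite -sumrB; apply: eq_bigr => j _; rewrite ltn_ord mulrBr.
Qed.

Lemma multipoint_opE P d al N tau v Y y q : grid a b P d N tau -> inX Y -> repX Y y ->
  multipoint_op a b t0 al N (beta_of N v) tau y q 0 = bform al (fun q i => stepf N tau (v q i)) Y q.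
Proof.
move=> gr hY rY; rewrite /multipoint_op mxE summxE /bform; congr (_ + _).
  apply: eq_bigr => s _; rewrite mxE; apply: eq_bigr => i _.
  by rewrite mxE (rep_lt (ltn_ord s) (rY i) ht0).
have [tauD _ _ _] := gr.
have KK : K.-1.+1 = K by rewrite prednK// addn_gt0 hr orbT.
have K1 : (K.-1 < K)%N by rewrite -[X in (_ < X)%N]KK.
rewrite summxE.
rewrite (eq_bigr (fun j : 'I_N.+1 => \sum_i beta_of N v j q i * Y i K.-1 (tau j))); last first.
  move=> j _; rewrite mxE; apply: eq_bigr => i _.
  have [_ jab] := tauD j (ltn_ord j).
  by rewrite [X in _ * X]mxE (rep_lt K1 (rY i) jab).
rewrite exchange_big /=; apply: eq_bigr => i _.
rewrite (J_stepf hab _ gr (jet_L1 hab hp (hY i) (leqnn _))).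
rewrite (eq_bigr (fun j : 'I_N.+1 => ((if (j : nat) is j'.+1 then v q i j' else 0) -
   (if (j < N)%N then v q i j else 0)) * Y i K.-1 (tau j))); last first.
  by move=> j _; rewrite mxE.
rewrite (abel_sum N (v q i) (fun j => Y i K.-1 (tau j))); apply: eq_bigr => j _.
have [_ jab] := tauD j (ltnW (ltn_ord j)); have [_ jab'] := tauD j.+1 (ltn_ord j).
rewrite (jet_eqJ (hY i) K1 jab) (jet_eqJ (hY i) K1 jab') KK.
by rewrite opprD addrACA subrr add0r.
Qed.

Lemma rep_sub k (f g : R -> R[i]) (F G : nat -> R -> R[i]) : jet k F -> jet k G ->
  rep k f F -> rep k g G -> rep k (fun t => f t - g t) (fun s t => F s t - G s t).
Proof.
move=> jF jG rF rG; apply: (jet_rep hab hp (jetB hab hp jF jG)).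
  by move=> t k0 tab; rewrite -(rep_lt k0 rF tab) -(rep_lt k0 rG tab).
move: (ae_onI (rep_ae (leq0n k) rF) (rep_ae (leq0n k) rG)).
by apply: ae_onS => t _ [<- <-].
Qed.

Lemma msobolev_rep k (y : R -> 'cV[R[i]]_m) (Y : fam) : (forall i, jet k (Y i)) ->
  (forall i, rep k (fun t => y t i 0) (Y i)) ->
  msobolev_norm a b k p y = (\sum_i jnorm k (Y i))%:E.
Proof.
move=> jY rY; rewrite /msobolev_norm -sumEFin; apply: eq_bigr => i _.
have -> : jnorm k (Y i) = \sum_(s < k.+1) Ln p (Y i s) by [].
rewrite big_ord1 /sobolev_norm -sumEFin; apply: eq_bigr => s _.
have h := rep_ae (k := k) (s := s) (ltn_ord s) (rY i).
have [_ hL] := jet_MLp hab hp (jY i) (ltn_ord s).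
by rewrite (Lp_norm_ae_eq p0 h) LnE.
Qed.

Definition rhs_data (F : fam) (c : 'cV[R[i]]_(r * m)) (q : row + 'I_n * 'I_m) : R[i] :=
  match q with inl q => c q 0 | inr si => F si.2 si.1 a end.

(** * A single boundary-value problem, for either form of boundary operator *)

Section Problem.
Context (A : cjets) (Am : 'I_r -> R -> 'M[R[i]]_m) (hA : inA A) (rA : repA a b n A Am).
Context (al : 'I_K -> 'M[R[i]]_(r * m, m)) (phi : row -> 'I_m -> R -> R[i]).
Context (B : (R -> 'cV[R[i]]_m) -> 'cV[R[i]]_(r * m)).
Context (HB : forall Y y, inX Y -> repX Y y -> forall q, B y q 0 = bform al phi Y q).
Local Notation L := (diff_op a b Am).

Lemma sol_core F f c y : (forall i, jet n (F i)) -> repF a b n F f ->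
  bvp_solution a b p n L B (f, c) y -> exists2 Y, inX Y & [/\ repX Y y,
    forall i, ae_on a b (fun t => cop (cA A) Y i t = F i n t) &
    forall q, bform_ext A al phi Y q = rhs_data F c q].
Proof.
move=> hF rF [/= sy Ly By]; have [Y hY rY] := sobolev_repX hab hp sy.
have [low top] := diff_op_top hab hp hA rA hY rY hF rF Ly.
have aab : a <= a <= b by rewrite lexx ltW.
exists Y => //; split => // -[q|[s i]] /=.
  by rewrite -(HB hY rY) By.
by rewrite low.
Qed.

Lemma core_sol F f c Y : (forall i, jet n (F i)) -> repF a b n F f -> inX Y ->
  (forall i t, a <= t <= b -> cop (cA A) Y i t = F i n t) ->
  (forall q, bform_ext A al phi Y q = rhs_data F c q) -> bvp_solution a b p n L B (f, c) (colX Y).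
Proof.
move=> hF rF hY top low; split => /=.
- exact: (repX_sobolev hab hp hY (colX_rep hab hp hY)).
- apply: (lop_solve hab hp hA rA hY hF rF top) => i s sn.
  by have := low (inr (Ordinal sn, i)).
- by apply/matrixP => q j; rewrite (ord1 j) (HB hY (colX_rep hab hp hY)); exact: (low (inl q)).
Qed.

(** A homogeneous solution of the differentiated system gives one of the original problem, which
    vanishes on [a, b]; hence so do its derivatives below order [K], in particular at [a]. *)
Lemma unique_of_trivial :
  (forall y, bvp_solution a b p n L B (fun=> 0, 0) y -> forall t, t \in `[a, b] -> y t = 0) ->
  unique_core a b p K (@lI n m r) (@sI n m r) (cA A) (bform_ext A al phi).
Proof.
move=> triv Y hY top low i s sK.
have h0 (j : 'I_m) : jet n (fun _ _ => 0) by exact: jet0.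
have r0 : repF a b n (fun (_ : 'I_m) _ _ => 0) (fun=> 0).
  move=> j; apply: (jet_rep hab hp (h0 j)); first by move=> t _ _; rewrite mxE.
  by apply: ae_onT => t _; rewrite mxE.
have sol : bvp_solution a b p n L B (fun=> 0, 0) (colX Y).
  apply: (core_sol h0 r0 hY) => // -[q|si]; first by rewrite low /= mxE.
  by rewrite low.
have y0 : ae_on a b (fun t => Y i 0%N t = 0).
  apply: ae_onT => t tab; have /matrixP/(_ i 0) := triv _ sol t tab.
  by rewrite !mxE.
have [H _] := jet_ae_eq0 hab hp (hY i) y0.
by apply: H => //; rewrite lexx ltW.
Qed.

Context (be : R) (be0 : 0 <= be) (hblin : blin a b p K be (bform_ext A al phi)).
Context (uB : unique_core a b p K (@lI n m r) (@sI n m r) (cA A) (bform_ext A al phi)).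

(** The uniform estimate for a constant sequence. *)
Lemma stability : exists2 C : R, 0 <= C & forall Y, inX Y ->
  fnorm Y <= C * (\sum_i Ln p (cop (cA A) Y i) + \sum_q normc (bform_ext A al phi Y q)).
Proof.
have cdist0 e : 0 < e -> \forall k \near \oo, cdist a b p (cA (n := n) A) (cA A) <= e.
  move=> e0; apply: nearW => k; rewrite /cdist big1 ?ltW// => i _; rewrite big1// => ka _.
  by under eq_fun do rewrite subrr; exact: Ln0.
have B0 Y (q : row + 'I_n * 'I_m) e : inX Y -> 0 < e -> \forall k \near \oo,
    normc (bform_ext A al phi Y q - bform_ext A al phi Y q) <= e.
  by move=> _ e0; apply: nearW => k; rewrite subrr ComplexField.Normc.normc0 ltW.
have [C C0 HC] := uniform_estimate hab hp (@sI_lt n m r) be0 (cA_Lp hab hp hA)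
  (c := fun=> cA A) (B := fun=> bform_ext A al phi) (fun=> cA_Lp hab hp hA) hblin (fun=> hblin) uB
  cdist0 B0.
by exists C => // Y hY; case: HC => k _ /(_ k (leqnn k)); apply.
Qed.

(** The r m boundary conditions and the n m conditions at [a] match the m (n + r) Cauchy data, which
    gives existence. Solutions satisfy the system only almost everywhere, so uniqueness comes from
    [stability], which sees norms, and not from [unique_core], which asks for identities at every
    point. *)
Lemma well_posed : bvp_well_posed a b p n L B.
Proof.
move=> [f c] /= hf.
have /choice[F HF] : forall i, exists G : nat -> R -> R[i], jet n G /\ rep n (fun t => f t i 0) G.
  by move=> i; have [G h1 h2] := sobolev_rep hab hp (hf i 0); exists G.
have hF i : jet n (F i) by have [] := HF i.
have rF : repF a b n F f by move=> i; have [] := HF i.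
split.
  have cQ : #|{: row + 'I_n * 'I_m}| = (m * K)%N.
    by rewrite card_sum card_prod !card_ord -mulnDl addnC mulnC.
  have [Y hY [top low]] := fredholm hab hp (@sI_lt n m r) (cA_Lp hab hp hA) hblin uB cQ
     (rhs_data F c) (fun i => jet_MLp hab hp (hF i) (leqnn n)).
  by exists (colX Y); apply: (core_sol hF rF hY).
move=> y z sy sz t; rewrite in_itv /= => tab.
have [Y hY [rY topY lowY]] := sol_core hF rF sy.
have [Z hZ [rZ topZ lowZ]] := sol_core hF rF sz.
have [C C0 HC] := stability.
have [C2 C20 HC2] := @fam_sup _ a b p hab hp m K.
have h0 : fnorm (subX Y Z) <= 0.
  rewrite (le_trans (HC _ (inXB hab hp hY hZ)))// [\sum_q _]big1 ?addr0; last first.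
    move=> q _; rewrite (blinB hab hp q hblin hY hZ) lowY lowZ subrr.
    exact: ComplexField.Normc.normc0.
  rewrite big1 ?mulr0// => i _.
  rewrite (@Ln_ae_eq _ a b p _ (fun=> 0))//; first exact: Ln0.
  by move: (ae_onI (topY i) (topZ i)); apply: ae_onS => x _ [h1 h2]; rewrite copB h1 h2 subrr.
apply/matrixP => i j; rewrite (ord1 j).
have K0 : (0 < K)%N by rewrite addn_gt0 hr orbT.
have := HC2 _ i 0%N t (inXB hab hp hY hZ) K0 tab.
rewrite /subX => h.
have : normc (Y i 0%N t - Z i 0%N t) <= 0.
  by rewrite (le_trans h)// mulr_ge0_le0.
rewrite -(rep_lt K0 (rY i) tab) -(rep_lt K0 (rZ i) tab) /= => hn.
apply/eqP; rewrite -subr_eq0; apply/eqP/ComplexField.Normc.eq0_normc/eqP.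
by rewrite eq_le hn normc_ge0.
Qed.

End Problem.

End Boundary.

(** * Approximating problems *)

Section KernelApproximation.
Context {R : realType} (a b p : R).
Context (hab : a < b) (hp : 1 <= p).
Local Notation mu := (@lebesgue_measure R).
Local Notation D := (`[a, b]%classic : set R).
Local Notation cmeas := (cmeas a b).
Local Notation MLp := (MLp a b).
Local Notation Ln := (Ln a b).
Local Notation grid := (grid a b).
Local Notation dualp := (dualp a b p).
Context (P : set R) (hP : P `<=` `[a, b]) (hPd : `[a, b] `<=` closure P).

Let p0 : 0 < p. Proof. by rewrite (lt_le_trans _ hp). Qed.

Lemma near_harmonic (M e : R) : 0 < e -> \forall k \near \oo, M * k.+1%:R^-1 <= e.
Proof.
move=> e0; pose C := `|M| + 1.
have C0 : 0 < C by rewrite ltr_wpDl.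
exists (Num.bound (C / e)) => // k /= hk; rewrite ler_pdivrMr//.
have h : C / e <= k.+1%:R.
  have A0 : 0 <= C / e by rewrite divr_ge0 ?(ltW C0) ?(ltW e0).
  by rewrite (le_trans (ltW (archi_boundP A0)))// ler_nat leqW.
move: h; rewrite ler_pdivrMr// mulrC; apply: le_trans.
by rewrite (le_trans (ler_norm M))// lerDl.
Qed.

Lemma pos_lower_bound (T : finType) (d : T -> R) : (forall x, 0 < d x) ->
  exists2 d0, 0 < d0 & forall x, d0 <= d x.
Proof.
move=> dp; have S0 : 0 <= \sum_x (d x)^-1 by apply: sumr_ge0 => x _; rewrite invr_ge0 ltW.
(* Unlike a minimum, this bound also makes sense when [T] is empty. *)
exists (\sum_x (d x)^-1 + 1)^-1; first by rewrite invr_gt0 ltr_wpDl.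
move=> x; rewrite -[leRHS]invrK lef_pV2 ?posrE ?invr_gt0 ?ltr_wpDl//.
rewrite (@le_trans _ _ (\sum_x (d x)^-1)) ?lerDl//.
by apply: (@ler_sum_mem _ _ (fun x => (d x)^-1)) => y; rewrite invr_ge0 ltW.
Qed.

Lemma grid_mono d d' N tau : d <= d' -> grid P d N tau -> grid P d' N tau.
Proof.
move=> dd [h1 h2 h3 h4]; split => //; [|lra|lra].
by move=> j jN; have := h2 j jN; lra.
Qed.

(** The points of a multipoint condition are the same for all matrix entries, so one grid has to be
    fine enough for every entry of the kernel. *)
Lemma common_grid (T : finType) (good : (R -> R[i]) -> Prop) q (phi : T -> R -> R[i]) e :
  (forall x, exists g d, [/\ 0 < d, good g & forall N tau, grid P d N tau ->
     Ln q (fun t => phi x t - stepf N tau (fun j => g (tau j)) t) <= e]) ->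
  exists d N tau (g : T -> R -> R[i]), [/\ grid P d N tau, (forall x, good (g x)) &
    forall x, Ln q (fun t => phi x t - stepf N tau (fun j => g x (tau j)) t) <= e].
Proof.
move=> H; have /choice[g Hg] := H.
have /choice[d Hd] := Hg.
have [x|d0 d00 hd] := @pos_lower_bound T d; first by have [] := Hd x.
have [N [tau gr]] := grid_exists hab hP hPd d00.
exists d0, N, tau, g; split => // x; have [_ gx h] := Hd x => //.
by apply: h; exact: grid_mono gr.
Qed.

(** The conjunct [True] instantiates the predicate [good] of [common_grid]. *)
Lemma step_dense q phi e : 1 <= q -> MLp q phi -> 0 < e ->
  exists g d, [/\ 0 < d, True & forall N tau, grid P d N tau ->
     Ln q (fun t => phi t - stepf N tau (fun j => g (tau j)) t) <= e].
Proof.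
move=> q1 fq e0; have e20 : 0 < e / 2 by rewrite divr_gt0.
have [g [M [cg M0 gM Hg]]] := continuous_dense hab q1 fq e20.
pose M2 := 2 * M; have M20 : 0 <= M2 by rewrite mulr_ge0.
pose e' := (e / 2) `^ q / (M2 `^ (q - 1) + 1).
have e'0 : 0 < e' by rewrite divr_gt0 ?powR_gt0// ltr_wpDl ?powR_ge0.
have [d d0 Hd] := stepf_near hab P cg M0 gM e'0.
exists g, d; split => // N tau gr.
have mg := ccontinuous_cmeas a b cg.
have ms := cmeas_stepf a b N tau (fun j => g (tau j)).
have sM t : normc (stepf N tau (fun j => g (tau j)) t) <= M by exact: (stepf_bound _ gr).
have [gq _] := MLp_bounded hab q1 mg (fun t _ => gM t).
have [sq _] := MLp_bounded hab q1 ms (fun t _ => sM t).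
have [fg _] := MLpB q1 fq gq.
have [gs _] := MLpB q1 gq sq.
have -> : (fun t => phi t - stepf N tau (fun j => g (tau j)) t) =
    (fun t => (phi t - g t) + (g t - stepf N tau (fun j => g (tau j)) t)).
  by apply/funext => t; rewrite addrA subrK.
have [_ h1] := MLpD q1 fg gs.
rewrite (le_trans h1)// [leRHS]splitr lerD//.
apply: (Ln_interp hab (M := M2) q1) => //; first exact: cmeasB.
- by move=> t _; rewrite (le_trans (normcB _ _))// /M2 mulr_natl mulr2n lerD.
- exact: ltW.
rewrite (@le_trans _ _ (M2 `^ (q - 1) * e'))//; first by rewrite ler_wpM2l ?powR_ge0// Hd.
rewrite /e' mulrCA ler_piMr ?powR_ge0// ler_pdivrMr ?ltr_wpDl ?powR_ge0//.
by rewrite mul1r lerDl.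
Qed.

Lemma step_dense_bounded M phi e : 0 <= M -> cmeas phi -> (forall t, normc (phi t) <= M) ->
  0 < e -> exists g d, [/\ 0 < d, (forall t, normc (g t) <= 2 * M) &
    forall N tau, grid P d N tau ->
     Ln 1 (fun t => phi t - stepf N tau (fun j => g (tau j)) t) <= e].
Proof.
move=> M0 mphi phiM e0; have e20 : 0 < e / 2 by rewrite divr_gt0.
have [g [cg gM Hg]] := continuous_approx_cL1 hab M0 mphi (fun t _ => phiM t) e20.
have M20 : 0 <= 2 * M by rewrite mulr_ge0.
have [d d0 Hd] := stepf_near hab P cg M20 gM e20.
exists g, d; split => // N tau gr.
have mg := ccontinuous_cmeas a b cg.
have ms := cmeas_stepf a b N tau (fun j => g (tau j)).
have sM t : normc (stepf N tau (fun j => g (tau j)) t) <= 2 * M by exact: (stepf_bound _ gr).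
have [pq _] := MLp_bounded hab (lexx 1) mphi (fun t _ => phiM t).
have [gq _] := MLp_bounded hab (lexx 1) mg (fun t _ => gM t).
have [sq _] := MLp_bounded hab (lexx 1) ms (fun t _ => sM t).
have [fg _] := MLpB (lexx 1) pq gq.
have [gs _] := MLpB (lexx 1) gq sq.
have -> : (fun t => phi t - stepf N tau (fun j => g (tau j)) t) =
    (fun t => (phi t - g t) + (g t - stepf N tau (fun j => g (tau j)) t)).
  by apply/funext => t; rewrite addrA subrK.
have [_ h1] := MLpD (lexx 1) fg gs.
by rewrite (le_trans h1)// [leRHS]splitr lerD// Hd.
Qed.

Lemma dualp_hoelder q f : 0 < q -> q^-1 + p^-1 = 1 -> MLp q f -> dualp (Ln q f) f.
Proof. by move=> q0 qp fq h hpp; exact: MLp_hoelder. Qed.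

Lemma dualp_bounded M f : cmeas f -> (forall t, normc (f t) <= M) -> p = 1 -> dualp M f.
Proof.
move=> mf fM p1 h; rewrite p1 => h1.
exact: (MLpM_bounded hab (lexx 1) mf (fun t _ => fM t) h1).
Qed.

Lemma dualp_le k k' f : k <= k' -> dualp k f -> dualp k' f.
Proof.
by move=> kk df h hp'; have [h1 h2] := df h hp'; split => //; rewrite (le_trans h2)// ler_wpM2r// Ln_ge0.
Qed.

Lemma Ln_distC q f g : 1 <= q -> MLp q f -> MLp q g ->
  Ln q (fun t => f t - g t) = Ln q (fun t => g t - f t).
Proof.
move=> q1 fq gq; have [d _] := MLpB q1 fq gq; have [_ <-] := MLpN q1 d.
by congr (Ln q _); apply/funext => t; rewrite opprB.
Qed.

(** [ka] bounds the limit kernel and all approximations as functionals on L_p; this provides the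
    common bound for the boundary forms. Strong convergence is the first of the last two clauses,
    and convergence in the dual norm for p > 1 the second. *)
Definition approx_kernel (T : finType) (phi : T -> R -> R[i]) :=
  exists (ka : R) (N : nat -> nat) (tau : nat -> nat -> R) (d : nat -> R)
    (v : nat -> T -> nat -> R[i]),
  let psi k x := stepf (N k) (tau k) (v k x) in
  [/\ 0 <= ka, (forall x, dualp ka (phi x)), (forall k, grid P (d k) (N k) (tau k)),
      (forall k x, dualp ka (psi k x)) &
      (forall x h e, MLp p h -> 0 < e ->
         \forall k \near \oo, Ln 1 (fun t => (psi k x t - phi x t) * h t) <= e) /\
      (1 < p -> forall e, 0 < e ->
         \forall k \near \oo, forall x, dualp e (fun t => psi k x t - phi x t))].

Lemma approx_kernel_hoelder (T : finType) (phi : T -> R -> R[i]) q : 1 < p -> 1 <= q ->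
  q^-1 + p^-1 = 1 -> (forall x, MLp q (phi x)) -> approx_kernel phi.
Proof.
move=> p1 q1 qp phiq; have q0 : 0 < q by rewrite (lt_le_trans _ q1).
have inv0 (k : nat) : 0 < k.+1%:R^-1 :> R by rewrite invr_gt0.
have H k := @common_grid T (fun=> True) q phi (k.+1%:R^-1)
   (fun x => step_dense q1 (phiq x) (inv0 k)).
have /choice[d /choice[N /choice[tau /choice[g Hg]]]] := H.
pose v k x j := g k x (tau k j).
pose psi k x := stepf (N k) (tau k) (v k x).
have gr k : grid P (d k) (N k) (tau k) by have [] := Hg k.
have psiq k x : MLp q (psi k x).
  have [M HM] : exists M, forall t, normc (psi k x t) <= M.
    exists (\sum_(j < N k) normc (v k x j)) => t.
    (* [stepf] uses only the values with index below [N k]; with the others set to 0, a finite sum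
       bounds them all, as [stepf_bound] requires. *)
    pose v' j := if (j < N k)%N then v k x j else 0.
    have -> : psi k x t = stepf (N k) (tau k) v' t.
      by apply: eq_bigr => j _; rewrite /v' ltn_ord.
    apply: (stepf_bound _ (gr k)).
      by apply: sumr_ge0 => j _; exact: normc_ge0.
    move=> j; rewrite /v'; case: ifP => [jN|_].
      by apply: (@ler_sum_mem _ _ (fun j : 'I_(N k) => normc (v k x j)) (Ordinal jN)) => i; exact: normc_ge0.
    by rewrite ComplexField.Normc.normc0; apply: sumr_ge0 => i _; exact: normc_ge0.
  by have [] := MLp_bounded hab q1 (cmeas_stepf a b (N k) (tau k) (v k x)) (fun t _ => HM t).
have dq k x : Ln q (fun t => psi k x t - phi x t) <= k.+1%:R^-1.
  by rewrite Ln_distC//; have [_ _] := Hg k; apply.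
have dM k x : MLp q (fun t => psi k x t - phi x t) by have [] := MLpB q1 (psiq k x) (phiq x).
have small e : 0 < e -> \forall k \near \oo, forall x, dualp e (fun t => psi k x t - phi x t).
  move=> e0; have := near_harmonic 1 e0; apply: filterS => k; rewrite mul1r => ke x.
  by apply: dualp_le (dualp_hoelder q0 qp (dM k x)); rewrite (le_trans (dq k x)).
(* The summand 1 leaves room for the distance 1 / (k + 1) between the kernels. *)
pose ka := \sum_x Ln q (phi x) + 1.
have Lka x : Ln q (phi x) + 1 <= ka.
  rewrite lerD2r; apply: (@ler_sum_mem _ _ (fun x => Ln q (phi x))) => y; exact: Ln_ge0.
exists ka, N, tau, d, v; split => //.
- by rewrite addr_ge0//; apply: sumr_ge0 => x _; exact: Ln_ge0.
- move=> x; apply: dualp_le (dualp_hoelder q0 qp (phiq x)).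
  by apply: le_trans (Lka x); rewrite lerDl.
- move=> k x; apply: dualp_le (dualp_hoelder q0 qp (psiq k x)).
  apply: le_trans (Lka x).
  have -> : psi k x = (fun t => phi x t + (psi k x t - phi x t)).
    by apply/funext => t; rewrite addrC subrK.
  have [_ h] := MLpD q1 (phiq x) (dM k x); rewrite (le_trans h)// lerD2l.
  by rewrite (le_trans (dq k x))// invf_le1 ?ler1n.
- split => // x h e hpp e0; have L0 := Ln_ge0 a b p h.
  have L1 : 0 < Ln p h + 1 by rewrite ltr_wpDl.
  have := small _ (divr_gt0 e0 L1); apply: filterS => k /(_ x h hpp)[_].
  move/le_trans; apply; rewrite mulrAC ler_pdivrMr// ler_wpM2l ?(ltW e0)//.
  by rewrite lerDl.
Qed.

(** Strong convergence on L_1: [h] is replaced by a truncation [h']. On [h - h'] the uniform bound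
    of the kernels is used, and on the bounded [h'] their convergence in L_1. *)
Lemma approx_kernel_bounded (T : finType) (phi : T -> R -> R[i]) M : p = 1 -> 0 <= M ->
  (forall x, cmeas (phi x)) -> (forall x t, normc (phi x t) <= M) -> approx_kernel phi.
Proof.
move=> p1 M0 mphi phiM.
have inv0 (k : nat) : 0 < k.+1%:R^-1 :> R by rewrite invr_gt0.
have H k := @common_grid T (fun g => forall t, normc (g t) <= 2 * M) 1 phi (k.+1%:R^-1)
   (fun x => step_dense_bounded M0 (mphi x) (phiM x) (inv0 k)).
have /choice[d /choice[N /choice[tau /choice[g Hg]]]] := H.
pose v k x j := g k x (tau k j).
pose psi k x := stepf (N k) (tau k) (v k x).
have gr k : grid P (d k) (N k) (tau k) by have [] := Hg k.
have M20 : 0 <= 2 * M by rewrite mulr_ge0.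
have psiM k x t : normc (psi k x t) <= 2 * M.
  by apply: (stepf_bound _ (gr k)) => // j; have [_ h _] := Hg k; exact: h.
have mpsi k x : cmeas (psi k x) by exact: cmeas_stepf.
have psi1 k x : MLp 1 (psi k x).
  by have [] := MLp_bounded hab (lexx 1) (mpsi k x) (fun t _ => psiM k x t).
have phi1 x : MLp 1 (phi x).
  by have [] := MLp_bounded hab (lexx 1) (mphi x) (fun t _ => phiM x t).
have dq k x : Ln 1 (fun t => psi k x t - phi x t) <= k.+1%:R^-1.
  by rewrite Ln_distC//; have [_ _] := Hg k; apply.
have dM k x t : normc (psi k x t - phi x t) <= 3 * M.
  by rewrite (le_trans (normcB _ _))//; have := psiM k x t; have := phiM x t; lra.
have md k x : cmeas (fun t => psi k x t - phi x t) by exact: cmeasB.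
exists (2 * M), N, tau, d, v; split => //.
- by move=> x; apply: dualp_bounded => // t; rewrite (le_trans (phiM x t))// ler_peMl// ler1n.
- by move=> k x; apply: dualp_bounded; [exact: mpsi|move=> t; exact: psiM|exact: p1].
split; last by rewrite p1 ltxx.
move=> x h e; rewrite p1 => h1 e0.
have e' : 0 < e / (2 * (3 * M + 1)).
  by rewrite divr_gt0// mulr_gt0// ltr_wpDl// mulr_ge0.
have [Nh [h' [mh' h'N Hh]]] := trunc_approx (lexx 1) h1 e'.
have h'1 : MLp 1 h'.
  by have [] := MLp_bounded hab (lexx 1) mh' (fun t _ => h'N t).
have [hh _] := MLpB (lexx 1) h1 h'1.
have := near_harmonic Nh%:R (divr_gt0 e0 (ltr0Sn _ 1)); apply: filterS => k hk.
have [d1 _] := MLpB (lexx 1) (psi1 k x) (phi1 x).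
have [m1 b1] := MLpM_bounded hab (lexx 1) (md k x) (fun t _ => dM k x t) hh.
have [m2 b2] := MLpM_bounded hab (lexx 1) mh' (fun t _ => h'N t) d1.
have -> : (fun t => (stepf (N k) (tau k) (v k x) t - phi x t) * h t) =
   (fun t => (psi k x t - phi x t) * (h t - h' t) + h' t * (psi k x t - phi x t)).
  by apply/funext => t; rewrite /psi; ring.
have [_ b3] := MLpD (lexx 1) m1 m2.
rewrite (le_trans b3)// [leRHS]splitr lerD//.
  rewrite (le_trans b1)// (@le_trans _ _ (3 * M * (e / (2 * (3 * M + 1)))))//.
    by rewrite ler_wpM2l// mulr_ge0.
  have -> : 3 * M * (e / (2 * (3 * M + 1))) = e / 2 * ((3 * M) / (3 * M + 1)).
    by field; rewrite gt_eqF// ltr_wpDl// mulr_ge0.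
  rewrite ler_piMr ?divr_ge0 ?(ltW e0)// ler_pdivrMr ?ltr_wpDl ?mulr_ge0//.
  by rewrite mul1r lerDl.
by rewrite (le_trans b2)// (le_trans _ hk)// ler_wpM2l.
Qed.

(** The Borel representative is set to 0 where it exceeds the essential supremum; it becomes bounded
    everywhere and stays almost everywhere equal to [f]. *)
Lemma in_Linfty f : in_Lp a b +oo%E f -> exists (g : R -> R[i]) (M : R),
  [/\ cmeas g, 0 <= M, (forall t, normc (g t) <= M) & ae_on a b (fun t => f t = g t)].
Proof.
move=> [fy [g [m1 m2 fg]]].
(* The norm with infinite exponent is defined by cases on whether the whole space has positive
   measure. *)
have mu0 : (0 < mu [set: R])%E.
  have : (mu D <= mu [set: R])%E by apply: le_measure; rewrite ?inE//; exact: measurable_itv.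
  apply: lt_le_trans; have := lebesgue_measure_itv (`[a, b] : interval R); rewrite /= lte_fin hab => ->.
  by rewrite -EFinB lte_fin subr_gt0.
move: fy; rewrite /Lp_norm unlock mu0.
set F := (X in ess_sup_inf.ess_sup _ X); move=> fy.
pose M := Num.max 0 (fine (ess_sup_inf.ess_sup mu F)).
have Fae : {ae mu, forall t, (F t <= M%:E)%E}.
  apply: (@filterS _ _ (ae_filter_ringOfSetsType mu) _ _ _ (ess_sup_inf.ess_sup_ge mu F)) => t.
  move=> h; apply: (le_trans h); move: fy h; rewrite /M; case: (ess_sup_inf.ess_sup mu F) => [x| |] //= _ _.
  by rewrite lee_fin le_max lexx orbT.
have M0 : 0 <= M by rewrite le_max lexx.
pose w t : R[i] := if normc (g t) <= M then g t else 0.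
have mg : cmeas g by [].
exists w, M; split => //.
- have mb : measurable_fun D (fun t => normc (g t) <= M).
    by apply: measurable_fun_ler; [exact: cmeas_normc|exact: measurable_cst].
  split; rewrite /w.
    rewrite (_ : (fun t => _) = fun t => if normc (g t) <= M then complex.Re (g t) else 0).
      by apply: measurable_fun_if => //; apply: measurable_funS m1 => //; exact: measurable_itv.
    by apply/funext => t; case: ifP.
  rewrite (_ : (fun t => _) = fun t => if normc (g t) <= M then complex.Im (g t) else 0).
    by apply: measurable_fun_if => //; apply: measurable_funS m2 => //; exact: measurable_itv.
  by apply/funext => t; case: ifP.
- by move=> t; rewrite /w; case: ifP => // _; rewrite ComplexField.Normc.normc0.
have Fae' : ae_on a b (fun t => normc (f t) <= M).
  apply: (@filterS _ _ (ae_filter_ringOfSetsType mu) _ _ _ Fae) => t h tab; move: h.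
  by rewrite /F /= /patch mem_set//= lee_fin ger0_norm ?normc_ge0.
move: (ae_onI fg Fae'); apply: ae_onS => t _ [h1 h2].
by rewrite /w -h1 h2.
Qed.

Lemma kernel_approximation (T : finType) (Phi : T -> R -> R[i]) :
  (forall x, in_Lp a b (hoelder_conjugate p%:E) (Phi x)) ->
  exists2 phi : T -> R -> R[i], approx_kernel phi &
    forall x, ae_on a b (fun t => Phi x t = phi x t).
Proof.
move: (hp); rewrite le_eqVlt => /predU1P[p1|p1].
  rewrite -p1 hoelder_conjugate1 => H.
  have /choice[g Hg] := fun x => in_Linfty (H x).
  have /choice[M HM] := Hg.
  exists g; last by move=> x; have [] := HM x.
  have M0 x : 0 <= M x by have [] := HM x.
  apply: (approx_kernel_bounded (M := \sum_x M x)) => //.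
  - exact: sumr_ge0.
  - by move=> x; have [] := HM x.
  - move=> x t; have [_ _ h _] := HM x; rewrite (le_trans (h t))//.
    exact: ler_sum_mem.
pose q := p / (p - 1).
have p10 : 0 < p - 1 by rewrite subr_gt0.
have q1 : 1 <= q by rewrite /q ler_pdivlMr// mul1r gerBl.
have qE : hoelder_conjugate p%:E = q%:E.
  by rewrite /hoelder_conjugate /= eqe gt_eqF//= -EFinB inver gt_eqF// -EFinM.
rewrite qE => H.
have q0 : 0 < q by rewrite (lt_le_trans _ q1).
have /choice[g Hg] : forall x, exists g, MLp q g /\ ae_on a b (fun t => Phi x t = g t).
  by move=> x; have [g h1 h2] := in_Lp_MLp q0 (H x); exists g.
exists g; last by move=> x; have [] := Hg x.
apply: (approx_kernel_hoelder (q := q)) => //.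
  by rewrite /q invf_div; field; rewrite gt_eqF.
by move=> x; have [] := Hg x.
Qed.

End KernelApproximation.

Section ApproximatingProblems.
Context {R : realType} (a b p : R).
Context (hab : a < b) (hp : 1 <= p).
Context (n m r : nat) (hr : (0 < r)%N).
Local Notation MLp := (MLp a b).
Local Notation Ln := (Ln a b).
Local Notation J := (J a).
Local Notation jet := (jet a b p).
Local Notation jnorm := (jnorm a b p).
Local Notation rep := (rep a b).
Local Notation K := (n + r)%N.
Local Notation inX := (@inX _ a b p m K).
Local Notation fam := (@fam R m).
Local Notation inA := (@inA _ a b p n m r).
Local Notation cjets := (@cjets R m r).
Local Notation fnorm := (@fnorm _ a b p m K).
Local Notation lI := (@lI n m r).
Local Notation sI := (@sI n m r).
Local Notation cop := (@cop R m K _ lI sI).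
Local Notation repX := (@repX _ a b n m r).
Local Notation row := 'I_(r * m).
Local Notation adist := (@adist _ a b p n m r).
Local Notation cdist := (@cdist _ a b p m ('I_r * 'I_m * 'I_n.+1)%type).
Local Notation bform_ext := (@bform_ext _ a b n m r).
Local Notation dualp := (dualp a b p).
Implicit Types (A : cjets) (Y Z : fam).

Let p0 : 0 < p. Proof. by rewrite (lt_le_trans _ hp). Qed.
Let aab : a <= a <= b. Proof. by rewrite lexx ltW. Qed.

Context (P : set R) (t0 : R) (ht0 : a <= t0 <= b).
Context (al : 'I_K -> 'M[R[i]]_(r * m, m)).
Context (Am0 : 'I_r -> R -> 'M[R[i]]_m) (A0 : cjets) (hA0 : inA A0) (rA0 : repA a b n A0 Am0).
Context (phi : row * 'I_m -> R -> R[i]).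
Local Notation phi0 := (fun q i => phi (q, i)).
Context (B0 : (R -> 'cV[R[i]]_m) -> 'cV[R[i]]_(r * m)).
Context (HB0 : forall Y y, inX Y -> repX Y y -> forall q, B0 y q 0 = bform a b t0 al phi0 Y q).
Local Notation L0 := (diff_op a b Am0).
Context (triv : forall y, bvp_solution a b p n L0 B0 (fun=> 0, 0) y ->
  forall t, t \in `[a, b] -> y t = 0).
Context (ka : R) (N : nat -> nat) (tau : nat -> nat -> R) (d : nat -> R)
  (v : nat -> row * 'I_m -> nat -> R[i]).
Local Notation phik := (fun k q i => stepf (N k) (tau k) (v k (q, i))).
Context (ka0 : 0 <= ka) (dual0 : forall x, dualp ka (phi x))
  (gr : forall k, grid a b P (d k) (N k) (tau k))
  (dualk : forall k x, dualp ka (stepf (N k) (tau k) (v k x)))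
  (strong : forall x h e, MLp p h -> 0 < e -> \forall k \near \oo,
     Ln 1 (fun t => (stepf (N k) (tau k) (v k x) t - phi x t) * h t) <= e)
  (unif : 1 < p -> forall e, 0 < e -> \forall k \near \oo,
     forall x, dualp e (fun t => stepf (N k) (tau k) (v k x) t - phi x t)).
Context (pol : nat -> 'I_r -> 'I_m -> 'I_m -> {poly R[i]}).
Context (Hpol : forall k j i l,
  jnorm n (fun s t => pjet (pol k j i l) s t - A0 j i l s t) <= k.+1%:R^-1).

Definition approx_jets k : cjets := fun j i l => pjet (pol k j i l).
Definition approx_coef k j : 'M[{poly R[i]}]_m := \matrix_(i, l) pol k j i l.
Local Notation Lk k := (diff_op a b (fun j => poly_mx (approx_coef k j))).
Local Notation Bk k := (multipoint_op a b (n := n) (r := r) t0 al (N k)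
  (beta_of (N k) (fun q i => v k (q, i))) (tau k)).

Lemma poly_rep k q : rep k (pev q) (pjet q).
Proof. by apply: (jet_rep hab hp (poly_jet hab hp k q)) => //; exact: ae_onT. Qed.

Lemma approx_jets_jet k : inA (approx_jets k).
Proof. by move=> j i l; exact: poly_jet. Qed.

Lemma approx_jets_rep k : repA a b n (approx_jets k) (fun j => poly_mx (approx_coef k j)).
Proof.
move=> j i l; rewrite (_ : (fun t => _) = pev (pol k j i l)); first exact: poly_rep.
by apply/funext => t; rewrite /poly_mx !mxE.
Qed.

Lemma approx_bform k Y y : inX Y -> repX Y y -> forall q, Bk k y q 0 = bform a b t0 al (phik k) Y q.
Proof. by move=> hY rY q; rewrite (multipoint_opE hab hp hr ht0 al _ q (gr k) hY rY). Qed.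

Lemma approx_jets_dist k : adist (approx_jets k) A0 <= (m * (r * m))%:R * k.+1%:R^-1.
Proof.
apply: (@le_trans _ _ (\sum_(i < m) \sum_(j < r) \sum_(l < m) k.+1%:R^-1)).
  by do 3 (apply: ler_sum => ? _); exact: Hpol.
rewrite !sumr_const !card_ord -!mulrnA -[leLHS]mulr_natl le_eqVlt; apply/orP; left.
by apply/eqP; congr (_%:R * _); rewrite ?mulnA.
Qed.

Lemma blin_le (Q : finType) be be' (B : fam -> Q -> R[i]) : be <= be' ->
  blin a b p K be B -> blin a b p K be' B.
Proof.
move=> bb [h1 h2 h3]; split => // Y q hY; rewrite (le_trans (h3 Y q hY))// ler_wpM2r//.
exact: fnorm_ge0.
Qed.

(** The coefficients stay within the distance [M], the number of their entries, of [A0], because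
    each entry is approximated up to 1 / (k + 1) <= 1. *)
Lemma blin_all : exists2 be : R, 0 <= be & blin a b p K be (bform_ext t0 A0 al phi0) /\
  forall k, blin a b p K be (bform_ext t0 (approx_jets k) al (phik k)).
Proof.
have [C C0 HC] := bform_ext_blin hab hp ht0 al.
pose Z : cjets := fun _ _ _ _ _ => 0.
pose M : R := (m * (r * m))%:R.
have A00 : 0 <= adist A0 Z by exact: adist_ge0.
exists (C * (1 + ka + (adist A0 Z + M))); first by rewrite mulr_ge0// !addr_ge0.
split.
  apply: (blin_le _ (HC ka A0 phi0 ka0 hA0 _)) => //.
  by rewrite ler_wpM2l// lerD2l lerDl.
move=> k; apply: (blin_le _ (HC ka (approx_jets k) (phik k) ka0 (approx_jets_jet k) _)) => //.
rewrite ler_wpM2l// lerD2l.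
have hZ0 : inA Z by exact: inA0.
apply: (le_trans (adist_triangle hab hp (approx_jets_jet k) hA0 hZ0)); rewrite addrC lerD2l.
by rewrite (le_trans (approx_jets_dist k))// ler_piMr// invf_le1 ?ler1n.
Qed.

Lemma core_unique : unique_core a b p K lI sI (cA A0) (bform_ext t0 A0 al phi0).
Proof. exact: (unique_of_trivial hab hp hA0 rA0 HB0 triv). Qed.

Lemma cdist_small e : 0 < e -> \forall k \near \oo, cdist (cA (approx_jets k)) (cA A0) <= e.
Proof.
move=> e0; have [C C0 HC] := cdist_adist hab hp n m r.
have := near_harmonic (C * (m * (r * m))%:R) e0; apply: filterS => k; apply: le_trans.
by rewrite (le_trans (HC _ _ (approx_jets_jet k) hA0))// -mulrA ler_wpM2l// approx_jets_dist.
Qed.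

Lemma lop_small e : 0 < e -> \forall k \near \oo, forall Y i s, inX Y -> (s < n)%N ->
  normc (lop (approx_jets k) Y i s a - lop A0 Y i s a) <= e * fnorm Y.
Proof.
move=> e0; have [C C0 HC] := lop_diff hab hp n m r.
have := near_harmonic (C * (m * (r * m))%:R) e0; apply: filterS => k h Y i s hY sn.
rewrite (le_trans (HC _ _ _ _ _ (approx_jets_jet k) hA0 hY sn))// ler_wpM2r ?fnorm_ge0//.
by rewrite (le_trans _ h)// -mulrA ler_wpM2l// approx_jets_dist.
Qed.

(** The point terms at [t0] are the same in both forms and cancel. *)
Lemma bform_diff k Y q : inX Y -> bform a b t0 al (phik k) Y q - bform a b t0 al phi0 Y q =
  \sum_i J (fun t => (phik k q i t - phi (q, i) t) * Y i K t) b.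
Proof.
move=> hY; rewrite /bform opprD addrACA subrr add0r -sumrB; apply: eq_bigr => i _.
have hK := jet_MLp hab hp (hY i) (leqnn _).
have [h1 _] := dualk k (q, i) hK; have [h2 _] := dual0 (q, i) hK.
rewrite -(JB h1 h2 (lexx b)); congr J; apply/funext => t; ring.
Qed.

Lemma bform_diff_le k Y q : inX Y ->
  normc (bform a b t0 al (phik k) Y q - bform a b t0 al phi0 Y q) <=
  \sum_i 2 * Ln 1 (fun t => (phik k q i t - phi (q, i) t) * Y i K t).
Proof.
move=> hY; rewrite bform_diff// (le_trans (normc_sum _ _ _))//; apply: ler_sum => i _.
apply: J_bound => //; last exact: ltW.
have hK := jet_MLp hab hp (hY i) (leqnn _).
have [h1 _] := dualk k (q, i) hK; have [h2 _] := dual0 (q, i) hK.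
have [h _] := MLpB (lexx 1) h1 h2.
by apply: MLp_eq h => // t _; ring.
Qed.

Lemma bform_strong Y q e : inX Y -> 0 < e -> \forall k \near \oo,
  normc (bform a b t0 al (phik k) Y q - bform a b t0 al phi0 Y q) <= e.
Proof.
(* [e] is shared among [m] summands, each with the factor 2 of [J_bound]; the successor keeps the
   denominator positive. *)
move=> hY e0; pose e' := e / (2 * m.+1%:R).
have e'0 : 0 < e' by rewrite divr_gt0// mulr_gt0.
have : \forall k \near \oo, forall i : 'I_m,
    Ln 1 (fun t => (stepf (N k) (tau k) (v k (q, i)) t - phi (q, i) t) * Y i K t) <= e'.
  by apply: filter_forall => i; apply: strong => //; exact: (jet_MLp hab hp (hY i) (leqnn _)).
apply: filterS => k H; rewrite (le_trans (bform_diff_le k q hY))//.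
rewrite (@le_trans _ _ (\sum_(i < m) 2 * e'))//.
  by apply: ler_sum => i _; rewrite ler_wpM2l.
rewrite sumr_const card_ord -[leLHS]mulr_natl.
have E (x y : R) : x != 0 -> y * (2 * (e / (2 * x))) = e * (y / x) by move=> x0; field.
by rewrite /e' E ?pnatr_eq0// ler_piMr ?(ltW e0)// ler_pdivrMr// mul1r ler_nat.
Qed.

Lemma bform_unif e : 1 < p -> 0 < e -> \forall k \near \oo, forall Y q, inX Y ->
  normc (bform a b t0 al (phik k) Y q - bform a b t0 al phi0 Y q) <= e * fnorm Y.
Proof.
move=> p1 e0; pose e' := e / (2 * m.+1%:R).
have e'0 : 0 < e' by rewrite divr_gt0// mulr_gt0.
have := unif p1 e'0; apply: filterS => k H Y q hY.
rewrite (le_trans (bform_diff_le k q hY))//.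
have F0 := @fnorm_ge0 _ a b p m K Y.
rewrite (@le_trans _ _ (\sum_(i < m) 2 * (e' * fnorm Y)))//.
  apply: ler_sum => i _; rewrite ler_wpM2l//.
  have [_ h] := H (q, i) _ (jet_MLp hab hp (hY i) (leqnn _)).
  by rewrite (le_trans h)// ler_wpM2l ?(ltW e'0)// Ln_fnorm.
rewrite sumr_const card_ord -[leLHS]mulr_natl /e'.
have E (x y : R) : x != 0 -> y * (2 * (e / (2 * x) * fnorm Y)) = (e * fnorm Y) * (y / x).
  by move=> x0; field.
by rewrite E ?pnatr_eq0// ler_piMr ?mulr_ge0 ?(ltW e0)// ler_pdivrMr// mul1r ler_nat.
Qed.

Lemma bform_ext_strong Y q e : inX Y -> 0 < e -> \forall k \near \oo,
  normc (bform_ext t0 (approx_jets k) al (phik k) Y q - bform_ext t0 A0 al phi0 Y q) <= e.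
Proof.
move=> hY e0; case: q => [q|[s i]] /=; first exact: bform_strong.
have F1 : 0 < fnorm Y + 1 by rewrite ltr_wpDl// fnorm_ge0.
have := lop_small (divr_gt0 e0 F1); apply: filterS => k H.
rewrite (le_trans (H Y i s hY (ltn_ord s)))// mulrAC ler_pdivrMr// ler_wpM2l ?(ltW e0)//.
by rewrite lerDl.
Qed.

(** Bounds the defect of [Z] in the k-th problem, when [Z] solves the limit problem: the last two
    terms of [difference_estimate]. *)
Definition consistency k Z : R := cdist (cA (approx_jets k)) (cA A0) * fnorm Z +
  \sum_q normc (bform_ext t0 (approx_jets k) al (phik k) Z q - bform_ext t0 A0 al phi0 Z q).

Lemma consistency_ge0 k Z : 0 <= consistency k Z.
Proof.
rewrite addr_ge0 ?mulr_ge0 ?cdist_ge0 ?fnorm_ge0//.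
by apply: sumr_ge0 => q _; exact: normc_ge0.
Qed.

Lemma consistency_strong Z e : inX Z -> 0 < e -> \forall k \near \oo, consistency k Z <= e.
Proof.
move=> hZ e0; have F1 : 0 < fnorm Z + 1 by rewrite ltr_wpDl// fnorm_ge0.
have e20 : 0 < e / 2 by rewrite divr_gt0.
pose e' := e / (2 * #|{: row + 'I_n * 'I_m}|.+1%:R).
have e'0 : 0 < e' by rewrite divr_gt0// mulr_gt0.
have h1 := cdist_small (divr_gt0 e20 F1).
have h2 : \forall k \near \oo, forall q,
    normc (bform_ext t0 (approx_jets k) al (phik k) Z q - bform_ext t0 A0 al phi0 Z q) <= e'.
  by apply: filter_forall => q; exact: bform_ext_strong.
move: h2; apply: filterS2 h1 => k H1 H2; rewrite /consistency [leRHS]splitr lerD//.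
  rewrite (le_trans (ler_wpM2r (@fnorm_ge0 _ a b p m K Z) H1))// mulrAC ler_pdivrMr//.
  by rewrite ler_wpM2l ?(ltW e20)// lerDl.
rewrite (le_trans (ler_sum _ (fun q _ => H2 q)))// sumr_const -[leLHS]mulr_natl /e'.
set c := #|_|.
have E (x y : R) : x != 0 -> y * (e / (2 * x)) = e / 2 * (y / x) by move=> x0; field.
by rewrite E ?pnatr_eq0// ler_piMr ?(ltW e20)// ler_pdivrMr// mul1r ler_nat.
Qed.

Lemma consistency_unif e : 1 < p -> 0 < e -> \forall k \near \oo, forall Z, inX Z -> consistency k Z <= e * fnorm Z.
Proof.
move=> p1 e0; have e20 : 0 < e / 2 by rewrite divr_gt0.
pose c := #|{: row + 'I_n * 'I_m}|.
pose e' := e / (2 * c.+1%:R).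
have e'0 : 0 < e' by rewrite divr_gt0// mulr_gt0.
have h1 := cdist_small e20; have h2 := bform_unif p1 e'0; have h3 := lop_small e'0.
move: h3; apply: filterS3 h1 h2 => k H1 H2 H3 Z hZ.
have F0 := @fnorm_ge0 _ a b p m K Z.
rewrite /consistency [e in leRHS]splitr mulrDl lerD//; first by rewrite ler_wpM2r.
rewrite (@le_trans _ _ (\sum_(q : row + 'I_n * 'I_m) e' * fnorm Z))//.
  by apply: ler_sum => -[q|[s i]] _ /=; [exact: H2|exact: H3].
rewrite sumr_const -[leLHS]mulr_natl -/c /e'.
have E (x y : R) : x != 0 -> y * (e / (2 * x) * fnorm Z) = e / 2 * fnorm Z * (y / x).
  by move=> x0; field.
have X0 : 0 <= e / 2 * fnorm Z by apply: mulr_ge0 => //; exact: ltW.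
by rewrite E ?pnatr_eq0// ler_piMr// ler_pdivrMr// mul1r ler_nat.
Qed.

Local Notation rhs_data := (@rhs_data _ a n m r).

Lemma rhs_data_diff : exists2 C : R, 0 <= C & forall F G c,
  (forall i, jet n (F i)) -> (forall i, jet n (G i)) ->
  \sum_q normc (rhs_data F c q - rhs_data G c q) <=
  C * \sum_i jnorm n (fun s t => F i s t - G i s t).
Proof.
have [C C0 HC] := jet_sup_jnorm hab hp; exists (n%:R * C); first by rewrite mulr_ge0.
move=> F G c jF jG; rewrite big_sumType /= big1 ?add0r; last first.
  by move=> q _; rewrite subrr ComplexField.Normc.normc0.
rewrite -(pair_bigA _ (fun (s : 'I_n) i => normc (F i s a - G i s a))) /=.
rewrite -mulrA mulr_natl -[n in _ *+ n]card_ord -sumr_const; apply: ler_sum => s _.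
rewrite mulr_sumr; apply: ler_sum => i _.
exact: (HC n _ s a (jetB hab hp (jF i) (jG i)) (ltn_ord s) aab).
Qed.

(** [difference_estimate] in terms of solutions: [F] and [G] are the jets of the two right-hand
    sides, which share the boundary vector [c]. Uniqueness is included because it holds for the same
    large [k]. *)
Lemma solution_difference : exists2 C : R, 0 <= C & \forall k \near \oo,
  unique_core a b p K lI sI (cA (approx_jets k)) (bform_ext t0 (approx_jets k) al (phik k)) /\
  forall F G f c y z Z, (forall i, jet n (F i)) -> (forall i, jet n (G i)) -> repF a b n F f ->
    bvp_solution a b p n (Lk k) (Bk k) (f, c) y -> inX Z -> repX Z z ->
    (forall i, ae_on a b (fun t => cop (cA A0) Z i t = G i n t)) ->
    (forall q, bform_ext t0 A0 al phi0 Z q = rhs_data G c q) ->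
    exists x, [/\ 0 <= x, msobolev_norm a b K p (y \- z) = x%:E &
      x <= C * (\sum_i jnorm n (fun s t => F i s t - G i s t) + consistency k Z)].
Proof.
have [be be0 [b0 bk]] := blin_all.
have [C C0 DE] := difference_estimate hab hp (@sI_lt n m r) be0 (cA_Lp hab hp hA0)
  (fun k => cA_Lp hab hp (approx_jets_jet k)) b0 bk core_unique cdist_small bform_ext_strong.
have EU := eventually_unique hab hp (@sI_lt n m r) be0 (cA_Lp hab hp hA0)
  (fun k => cA_Lp hab hp (approx_jets_jet k)) b0 bk core_unique cdist_small bform_ext_strong.
have [C5 C50 HC5] := rhs_data_diff.
exists (C * (1 + C5)); first by rewrite mulr_ge0// addr_ge0.
move: EU; apply: filterS2 DE => k H1 uk; split => // F G f c y z Z jF jG rF sy hZ rZ topZ lowZ.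
have [Y hY [rY topY lowY]] := sol_core hab hp (approx_jets_jet k) (approx_jets_rep k) (@approx_bform k) jF rF sy.
exists (fnorm (subX Y Z)); split; first exact: fnorm_ge0.
  apply: (msobolev_rep hab hp (inXB hab hp hY hZ)) => i.
  have := rep_sub hab hp (hY i) (hZ i) (rY i) (rZ i).
  by congr (rep K _ _); apply/funext => t; rewrite !mxE.
apply: (le_trans (H1 Y Z hY hZ)); rewrite -mulrA ler_wpM2l//.
set S := \sum_i jnorm n _.
have S0 : 0 <= S by apply: sumr_ge0 => i _; exact: jnorm_ge0.
have h1 : \sum_i Ln p (fun t => cop (cA (approx_jets k)) Y i t - cop (cA A0) Z i t) <= S.
  apply: ler_sum => i _.
  rewrite (@Ln_ae_eq _ a b p _ (fun t => F i n t - G i n t))//; last first.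
    by move: (ae_onI (topY i) (topZ i)); apply: ae_onS => t _ [-> ->].
  exact: (@Ln_jnorm _ a b p n (fun s t => F i s t - G i s t) n (leqnn n)).
have h2 : \sum_q normc (bform_ext t0 (approx_jets k) al (phik k) Y q - bform_ext t0 A0 al phi0 Z q) <= C5 * S.
  apply: le_trans (HC5 F G c jF jG); apply: ler_sum => q _.
  by rewrite lowY lowZ.
have e0 := consistency_ge0 k Z; have := mulr_ge0 C50 e0.
move: h1 h2; rewrite /consistency !mulrDr !mulrDl; lra.
Qed.

(** Continuity of (L_0, B_0)^-1 at the level of jets. It turns a defect that is small relative to
    [fnorm Z] into one that is small uniformly over the unit ball of right-hand sides. *)
Lemma inverse_bound : exists2 C : R, 0 <= C & forall F f c z,
  (forall i, jet n (F i)) -> repF a b n F f -> bvp_solution a b p n L0 B0 (f, c) z ->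
  exists2 Z, inX Z & [/\ repX Z z, forall i, ae_on a b (fun t => cop (cA A0) Z i t = F i n t),
    forall q, bform_ext t0 A0 al phi0 Z q = rhs_data F c q &
    fnorm Z <= C * (\sum_i jnorm n (F i) + mnormc c)].
Proof.
have [be be0 [b0 _]] := blin_all.
have [C C0 HC] := stability hab hp hA0 be0 b0 core_unique.
have [C5 C50 HC5] := rhs_data_diff.
exists (C * (1 + C5)); first by rewrite mulr_ge0// addr_ge0.
move=> F f c z jF rF sz.
have [Z hZ [rZ topZ lowZ]] := sol_core hab hp hA0 rA0 HB0 jF rF sz.
exists Z => //; split => //; apply: (le_trans (HC Z hZ)); rewrite -mulrA ler_wpM2l//.
set S := \sum_i jnorm n _.
have S0 : 0 <= S by apply: sumr_ge0 => i _; exact: jnorm_ge0.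
have m0 : 0 <= mnormc c by do 2 (apply: sumr_ge0 => ? _); exact: normc_ge0.
have h1 : \sum_i Ln p (cop (cA A0) Z i) <= S.
  apply: ler_sum => i _; rewrite (Ln_ae_eq p0 (topZ i)).
  exact: Ln_jnorm.
have h2 : \sum_q normc (bform_ext t0 A0 al phi0 Z q) <= mnormc c + C5 * S.
  have j0 (i : 'I_m) : jet n (fun _ _ => 0) by exact: jet0.
  have := HC5 F (fun _ _ _ => 0) 0 jF j0; rewrite !big_sumType /= => h.
  rewrite lerD//.
    by apply: ler_sum => q _; have /= -> := lowZ (inl q); rewrite big_ord1.
  have -> : S = \sum_i jnorm n (fun s t => F i s t - 0).
    by apply: eq_bigr => i _; congr (jnorm n _); do 2 apply/funext => ?; rewrite subr0.
  apply: le_trans h; rewrite [X in _ <= X + _]big1 ?add0r; last first.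
    by move=> q _; rewrite subrr ComplexField.Normc.normc0.
  by apply: ler_sum => si _; have /= -> := lowZ (inr si); rewrite subr0.
have := mulr_ge0 C50 m0; move: h1 h2; rewrite !mulrDr !mulrDl; lra.
Qed.

Lemma sobolev_repF (f : R -> 'cV[R[i]]_m) : min_sobolev a b n p f ->
  exists F : fam, (forall i, jet n (F i)) /\ repF a b n F f.
Proof.
move=> hf; have /choice[F HF] : forall i, exists G : nat -> R -> R[i],
    jet n G /\ rep n (fun t => f t i 0) G.
  by move=> i; have [G h1 h2] := sobolev_rep hab hp (hf i 0); exists G.
by exists F; split => i; have [] := HF i.
Qed.

Lemma cvg_ereal0 (u : nat -> \bar R) :
  (forall e, 0 < e -> \forall k \near \oo, (0 <= u k <= e%:E)%E) -> u @ \oo --> 0%E.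
Proof.
move=> H; apply/fine_cvgP; split.
  apply: filterS (H 1 ltr01) => k /andP[u0 u1].
  by rewrite ge0_fin_numE// (le_lt_trans u1)// ltry.
apply/cvgrPdist_le => e e0; apply: filterS (H e e0) => k /andP[u0 u1] /=.
have uf : u k \is a fin_num by rewrite ge0_fin_numE// (le_lt_trans u1)// ltry.
by rewrite sub0r normrN ger0_norm ?fine_ge0// -lee_fin fineK.
Qed.

Lemma jnorm_distC k (F G : nat -> R -> R[i]) : jet k F -> jet k G ->
  jnorm k (fun s t => F s t - G s t) = jnorm k (fun s t => G s t - F s t).
Proof.
move=> jF jG; apply: eq_bigr => s _; apply: (Ln_distC hp).
  exact: (jet_MLp hab hp jF (ltn_ord s)).
exact: (jet_MLp hab hp jG (ltn_ord s)).
Qed.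

Lemma near_addn (k0 : nat) (Pr : nat -> Prop) : (\forall k \near \oo, Pr k) ->
  \forall k \near \oo, Pr (k + k0)%N.
Proof. by move=> [k1 _ H]; exists k1 => // k /= hk; apply: H; exact: leq_trans (leq_addr _ _). Qed.

Lemma sobolev_zero : min_sobolev a b n p (fun=> 0 : 'cV[R[i]]_m) /\
  rhs_norm a b p n (r := r) (fun=> 0 : 'cV[R[i]]_m, 0) = 0%E.
Proof.
have j0 (i : 'I_m) : jet n (fun _ _ => 0) by exact: jet0.
have r0 (i : 'I_m) : rep n (fun t => (0 : 'cV[R[i]]_m) i 0) (fun _ _ => 0).
  apply: (jet_rep hab hp (j0 i)); first by move=> t _ _; rewrite mxE.
  by apply: ae_onT => t _; rewrite mxE.
split.
  by move=> i j; rewrite (ord1 j); exact: (rep_sobolev hab hp (j0 i) (r0 i)).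
rewrite /rhs_norm /= (msobolev_rep hab hp j0 r0) -EFinD; congr (_%:E).
rewrite big1; last by move=> i _; apply: big1 => s _; exact: Ln0.
by rewrite add0r; apply: big1 => i _; apply: big1 => j _; rewrite mxE ComplexField.Normc.normc0.
Qed.

Lemma msobolev_norm_ge0 k (y : R -> 'cV[R[i]]_m) : (0 <= msobolev_norm a b k p y)%E.
Proof. by do 3 (apply: sume_ge0 => ? _); exact: Lp_norm_ge0. Qed.

Lemma op_norm_ge0 T : (0 <= op_norm a b p n (m := m) (r := r) T)%E.
Proof.
have [h1 h2] := sobolev_zero.
apply: (le_trans (msobolev_norm_ge0 K (T (fun=> 0, 0)))).
apply: ereal_sup_ubound; exists (fun=> 0, 0) => //=; split => //.
by rewrite h2 lee_fin.
Qed.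

Context (f0 : R -> 'cV[R[i]]_m) (F0 : fam) (jF0 : forall i, jet n (F0 i)) (rF0 : repF a b n F0 f0).
Context (c0 : 'cV[R[i]]_(r * m)) (y0 : R -> 'cV[R[i]]_m)
  (hy0 : bvp_solution a b p n L0 B0 (f0, c0) y0).
Context (polf : nat -> 'I_m -> {poly R[i]}).
Context (Hpolf : forall k i,
  jnorm n (fun s t => pjet (polf k i) s t - F0 i s t) <= k.+1%:R^-1).

Definition approx_rhs k : 'cV[{poly R[i]}]_m := \col_i polf k i.

Lemma approx_rhs_rep k : repF a b n (fun i => pjet (polf k i)) (poly_mx (approx_rhs k)).
Proof.
move=> i; rewrite (_ : (fun t => _) = pev (polf k i)); first exact: poly_rep.
by apply/funext => t; rewrite /poly_mx !mxE.
Qed.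

Lemma approx_rhs_small e : 0 < e -> \forall k \near \oo,
  \sum_i jnorm n (fun s t => pjet (polf k i) s t - F0 i s t) <= e.
Proof.
move=> e0; have := near_harmonic m%:R e0; apply: filterS => k; apply: le_trans.
rewrite (le_trans (ler_sum _ (fun i _ => Hpolf k i)))// sumr_const card_ord.
by rewrite -[leLHS]mulr_natl.
Qed.

Lemma approx_rhs_cvg : (fun k => msobolev_norm a b n p (poly_mx (approx_rhs k) \- f0)) @ \oo --> 0%E.
Proof.
apply: cvg_ereal0 => e e0; apply: filterS (approx_rhs_small e0) => k h.
rewrite msobolev_norm_ge0 /=.
rewrite (msobolev_rep hab hp (Y := fun i s t => pjet (polf k i) s t - F0 i s t)).
- by rewrite lee_fin.
- by move=> i; apply: jetB => //; exact: poly_jet.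
- move=> i; have := rep_sub hab hp (poly_jet hab hp n (polf k i)) (jF0 i) (approx_rhs_rep k i) (rF0 i).
  by congr (rep n _ _); apply/funext => t; rewrite !mxE.
Qed.

(** All indices are shifted by [k0], from which on uniqueness and the estimate hold. Convergence in
    norm rests on [consistency_unif], the strong statements on [consistency_strong] at one fixed
    solution. *)
Lemma approximating_problems : bvp_well_posed a b p n L0 B0 /\ exists k0,
  let L k := Lk (k + k0) in let B k := Bk (k + k0) in
  let inv0 := bvp_inv a b p n L0 B0 in let inv k := bvp_inv a b p n (L k) (B k) in
  [/\ forall k, bvp_well_posed a b p n (L k) (B k),
      1 < p -> (fun k => op_norm a b p n (fun fc => inv k fc \- inv0 fc)) @ \oo --> 0%E,
      forall fc, min_sobolev a b n p fc.1 ->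
        (fun k => msobolev_norm a b K p (inv k fc \- inv0 fc)) @ \oo --> 0%E &
      forall y : nat -> R -> 'cV[R[i]]_m,
        (forall k, bvp_solution a b p n (L k) (B k) (poly_mx (approx_rhs (k + k0)), c0) (y k)) ->
        (fun k => msobolev_norm a b K p (y k \- y0)) @ \oo --> 0%E].
Proof.
have [be be0 [b0 bk]] := blin_all.
have wp0 := well_posed hab hp hr hA0 rA0 HB0 be0 b0 core_unique.
split => //.
have [C C0 [k0 _ HC]] := solution_difference.
have [C1 C10 HC1] := inverse_bound.
have good k : (k0 <= k + k0)%N by exact: leq_addl.
exists k0 => L B inv0 inv.
have wp k : bvp_well_posed a b p n (L k) (B k).
  have [uk _] := HC (k + k0)%N (good k).
  exact: (well_posed hab hp hr (approx_jets_jet _) (approx_jets_rep _) (@approx_bform _) be0 (bk _) uk).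
(* [bvp_inv] selects some solution; well-posedness provides its existence. *)
have sol0 fc : min_sobolev a b n p fc.1 -> bvp_solution a b p n L0 B0 fc (inv0 fc).
  by move=> hfc; apply: xgetPex; have [] := wp0 fc hfc.
have solk k fc : min_sobolev a b n p fc.1 -> bvp_solution a b p n (L k) (B k) fc (inv k fc).
  by move=> hfc; apply: xgetPex; have [] := wp k fc hfc.
have CC e : 0 < e -> 0 < e / (C + 1) by move=> e0; rewrite divr_gt0// ltr_wpDl.
have CCe e x : 0 < e -> x <= e / (C + 1) -> C * x <= e.
  move=> e0 hx; rewrite (le_trans (ler_wpM2l C0 hx))// mulrCA ler_piMr ?(ltW e0)//.
  by rewrite ler_pdivrMr ?ltr_wpDl// mul1r lerDl.
have dif0 F : \sum_i jnorm n (fun s t => F i s t - F i s t : R[i]) = 0 :> R.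
  by apply: big1 => i _; apply: big1 => s _; under eq_fun do rewrite subrr; exact: Ln0.
split => //.
- move=> p1; apply: cvg_ereal0 => e e0.
  (* [C1] bounds the limit solution for data in the unit ball, and [C] turns its defect into a bound
     for the difference of the solutions. *)
  have e1 : 0 < e / (C + 1) / (C1 + 1) by rewrite divr_gt0 ?CC// ltr_wpDl.
  apply: filterS (near_addn k0 (consistency_unif p1 e1)) => k Herr.
  rewrite op_norm_ge0 /=; apply: ge_ereal_sup => _ [[f c] /= [hf hn] <-].
  have [F [jF rF]] := sobolev_repF hf.
  have [Z hZ [rZ topZ lowZ ZC]] := HC1 F f c _ jF rF (sol0 (f, c) hf).
  have [_ H] := HC (k + k0)%N (good k).
  have [x [x0 -> xC]] := H F F f c _ _ Z jF jF rF (solk k (f, c) hf) hZ rZ topZ lowZ.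
  rewrite lee_fin (le_trans xC)// dif0 add0r; apply: CCe => //.
  rewrite (le_trans (Herr Z hZ))//.
  have rn : \sum_i jnorm n (F i) + mnormc c <= 1.
    by move: hn; rewrite /rhs_norm /= (msobolev_rep hab hp jF rF) -EFinD lee_fin.
  have ZC1 : fnorm Z <= C1 by rewrite (le_trans ZC)// ler_piMr.
  rewrite (le_trans (ler_wpM2l (ltW e1) ZC1))// mulrAC ler_pdivrMr ?ltr_wpDl//.
  by rewrite ler_wpM2l ?(ltW (CC e e0))// lerDl.
- move=> [f c] /= hf; apply: cvg_ereal0 => e e0.
  have [F [jF rF]] := sobolev_repF hf.
  have [Z hZ [rZ topZ lowZ ZC]] := HC1 F f c _ jF rF (sol0 (f, c) hf).
  apply: filterS (near_addn k0 (consistency_strong hZ (CC e e0))) => k Herr.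
  have [_ H] := HC (k + k0)%N (good k).
  have [x [x0 -> xC]] := H F F f c _ _ Z jF jF rF (solk k (f, c) hf) hZ rZ topZ lowZ.
  by rewrite !lee_fin x0 /= (le_trans xC)// dif0 add0r; apply: CCe.
- move=> y hy; apply: cvg_ereal0 => e e0.
  have [Z hZ [rZ topZ lowZ ZC]] := HC1 F0 f0 c0 _ jF0 rF0 hy0.
  have e1 : 0 < e / (C + 1) / 2 by rewrite divr_gt0 ?CC.
  move: (near_addn k0 (consistency_strong hZ e1)); apply: filterS2 (near_addn k0 (approx_rhs_small e1)) => k H1 H2.
  have [_ H] := HC (k + k0)%N (good k).
  have [x [x0 -> xC]] := H _ F0 _ c0 _ _ Z (fun i => poly_jet hab hp n (polf (k + k0) i)) jF0
    (approx_rhs_rep (k + k0)) (hy k) hZ rZ topZ lowZ.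
  rewrite !lee_fin x0 /= (le_trans xC)//; apply: CCe => //.
  by rewrite [leRHS]splitr lerD.
Qed.

End ApproximatingProblems.

Theorem theorem4p1 (R : realType) (a b p : R) (n m r : nat)
  (hab : a < b) (hp : 1 <= p) (hm : (0 < m)%N) (hr : (0 < r)%N)
  (A0 : 'I_r -> R -> 'M[R[i]]_m)
  (hA0 : forall j, min_sobolev a b n p (A0 j))
  (f0 : R -> 'cV[R[i]]_m) (hf0 : min_sobolev a b n p f0)
  (c0 : 'cV[R[i]]_(r * m))
  (t0 : R) (ht0 : t0 \in `[a, b])
  (alpha0 : 'I_(n + r) -> 'M[R[i]]_(r * m, m))
  (Phi0 : R -> 'M[R[i]]_(r * m, m))
  (hPhi0 : min_Lp a b (hoelder_conjugate p%:E) Phi0)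
  (P : set R) (hP : P `<=` `[a, b]) (hPdense : `[a, b] `<=` closure P)
  (L0 := diff_op a b A0)
  (B0 := boundary_op a b t0 alpha0 Phi0)
  (htriv : forall y, bvp_solution a b p n L0 B0 (fun=> 0, 0) y ->
     forall t, t \in `[a, b] -> y t = 0)
  (y0 : R -> 'cV[R[i]]_m)
  (hy0 : bvp_solution a b p n L0 B0 (f0, c0) y0) :
  bvp_well_posed a b p n L0 B0 /\
  exists (A : nat -> 'I_r -> 'M[{poly R[i]}]_m)
         (f : nat -> 'cV[{poly R[i]}]_m)
         (alpha : nat -> 'I_(n + r) -> 'M[R[i]]_(r * m, m))
         (N : nat -> nat)
         (beta : nat -> nat -> 'M[R[i]]_(r * m, m))
         (tau : nat -> nat -> R)
         (c : nat -> 'cV[R[i]]_(r * m)),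
    let L k := diff_op a b (fun j => poly_mx (A k j)) in
    let B k := multipoint_op a b t0 (alpha k) (N k) (beta k) (tau k) in
    let inv0 := bvp_inv a b p n L0 B0 in
    let inv k := bvp_inv a b p n (L k) (B k) in
    [/\ forall k j, (j <= N k)%N -> P (tau k j),
        forall k, bvp_well_posed a b p n (L k) (B k),
        (fun k => msobolev_norm a b n p (poly_mx (f k) \- f0)) @ \oo --> 0%E,
        (fun k => mnormc (c k - c0)) @ \oo --> 0 &
        (1 < p ->
           (fun k => op_norm a b p n (fun fc => inv k fc \- inv0 fc))
             @ \oo --> 0%E) /\
        (p = 1 ->
           (forall fc, min_sobolev a b n p fc.1 ->
              (fun k => msobolev_norm a b (n + r) p (inv k fc \- inv0 fc))
                @ \oo --> 0%E) /\
           (forall y : nat -> R -> 'cV[R[i]]_m,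
              (forall k, bvp_solution a b p n (L k) (B k)
                           (poly_mx (f k), c k) (y k)) ->
              (fun k => msobolev_norm a b (n + r) p (y k \- y0))
                @ \oo --> 0%E))].
Proof.
have ht0' : a <= t0 <= b by move: ht0; rewrite in_itv.
have inv0 (k : nat) : 0 < k.+1%:R^-1 :> R by rewrite invr_gt0.
(* All entries of the kernel are approximated at once, so that they share the points [tau]. *)
have [phi [ka [N [tau [d [v [ka0 dual0 gr dualk [strong unif]]]]]]] phiE] :=
  kernel_approximation hab hp hP hPdense (T := ('I_(r * m) * 'I_m)%type)
    (fun x => hPhi0 x.1 x.2).
have /choice[A HA] : forall x : 'I_r * 'I_m * 'I_m, exists Z : nat -> R -> R[i],
    jet a b p n Z /\ rep a b n (fun t => A0 x.1.1 t x.1.2 x.2) Z.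
  by move=> x; have [Z h1 h2] := sobolev_rep hab hp (hA0 x.1.1 x.1.2 x.2); exists Z.
pose Ad : cjets m r := fun j i l => A (j, i, l).
have hAd : inA a b p n Ad by move=> j i l; have [] := HA (j, i, l).
have rAd : repA a b n Ad A0 by move=> j i l; have [] := HA (j, i, l).
have [F0 [jF0 rF0]] := sobolev_repF hab hp hf0.
have HB0 (Y : fam m) y : inX a b p (n + r) Y -> repX a b n r Y y -> forall q,
    B0 y q 0 = bform a b t0 alpha0 (fun q i => phi (q, i)) Y q.
  move=> hY rY q; rewrite /B0.
  apply: (boundary_opE hab hp ht0' (ka := ka) (phi := fun q i => phi (q, i)) alpha0 q hY rY).
    by move=> q' i; exact: (phiE (q', i)).
  by move=> q' i; exact: dual0.
have /choice[pol Hpol] : forall k : nat, exists pol : 'I_r -> 'I_m -> 'I_m -> {poly R[i]},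
    forall j i l, jnorm a b p n (fun s t => pjet (pol j i l) s t - Ad j i l s t) <= k.+1%:R^-1.
  move=> k; have /choice[q Hq] : forall x : 'I_r * 'I_m * 'I_m, exists q,
      jnorm a b p n (fun s t => pjet q s t - Ad x.1.1 x.1.2 x.2 s t) <= k.+1%:R^-1.
    move=> x; have [q hq] := poly_jet_dense hab hp (hAd x.1.1 x.1.2 x.2) (inv0 k).
    by exists q; rewrite jnorm_distC//; exact: poly_jet.
  by exists (fun j i l => q (j, i, l)) => j i l; exact: (Hq (j, i, l)).
have /choice[polf Hpolf] : forall k : nat, exists polf : 'I_m -> {poly R[i]},
    forall i, jnorm a b p n (fun s t => pjet (polf i) s t - F0 i s t) <= k.+1%:R^-1.
  move=> k; have /choice[q Hq] : forall i, exists q,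
      jnorm a b p n (fun s t => pjet q s t - F0 i s t) <= k.+1%:R^-1.
    move=> i; have [q hq] := poly_jet_dense hab hp (jF0 i) (inv0 k).
    by exists q; rewrite jnorm_distC//; exact: poly_jet.
  by exists q.
have [wp0 [k0 [wp opn strongcv ycv]]] := approximating_problems hab hp hr ht0' hAd rAd HB0 htriv
  ka0 dual0 gr dualk strong unif Hpol jF0 rF0 hy0 Hpolf.
split => //.
(* Every sequence is shifted by [k0], while the point terms [alpha0] and the vector [c0] are kept
   constant. *)
exists (fun k => approx_coef pol (k + k0)), (fun k => approx_rhs polf (k + k0)), (fun=> alpha0),
  (fun k => N (k + k0)%N),
  (fun k => beta_of (N (k + k0)%N) (fun q i => v (k + k0)%N (q, i))),
  (fun k => tau (k + k0)%N), (fun=> c0) => L B inv0' inv.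
split => //.
- by move=> k j jN; have [h _ _ _] := gr (k + k0)%N; have [] := h j jN.
- have := approx_rhs_cvg hab hp jF0 rF0 Hpolf.
  by rewrite -(cvg_shiftn k0).
- rewrite (_ : mnormc (c0 - c0) = 0); first exact: cvg_cst.
  rewrite subrr; apply: big1 => i _; apply: big1 => j _.
  by rewrite mxE ComplexField.Normc.normc0.
Qed.
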